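(* Let $\mathfrak{T}$ be the 4-regular tree. There exist an invariant bond percolation $\omega$ on $\mathfrak{T}$ and constants $\delta_0,\epsilon_0>0$ such that for all $\delta\in(0,\delta_0)$ and $\epsilon\in(0,\epsilon_0)$ the following holds. Let $\eta^{\epsilon}$ and $\eta_{\delta}$ be Bernoulli bond percolations on $E(\mathfrak{T})$ with parameters $\epsilon$ and $\delta$ respectively, with $\omega,\eta^{\epsilon},\eta_{\delta}$ independent, and let $\omega_\delta^\epsilon:=(\omega\cup\eta^{\epsilon})\setminus\eta_{\delta}$. Fix a vertex $o$ of $\mathfrak{T}$. Then the event that the connected component (cluster) of $o$ in $\omega_\delta^\epsilon$ is infinite has positive probability, and, conditioned on this event, the cluster of $o$ almost surely does not have anchored expansion.
   Context: An invariant bond percolation on a transitive graph $G$ is a random subset of $E(G)$ whose distribution is invariant under the automorphism group of $G$. A Bernoulli$(p)$ bond percolation is a random set of edges containing each edge independently with probability $p$. A bounded degree infinite connected graph $\Gamma$ has anchored expansion if for some (equivalently, any) vertex $o\in V(\Gamma)$, $$\inf\Big\{\frac{|\partial K|}{|K|}: o\in K\subset V(\Gamma),\ K \text{ finite and connected}\Big\}>0,$$ where $\partial K$ is the set of edges of $\Gamma$ with one endpoint in $K$ and the other in $V(\Gamma)\setminus K$. Here the notion is applied to $\Gamma$ equal to the cluster, viewed as a graph with the edges of $\omega_\delta^\epsilon$. *)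

(* Defs.v *)
From HB Require Import structures.
From mathcomp Require Import all_boot all_order all_algebra.
From mathcomp Require Import finmap.
From mathcomp Require Import all_classical all_reals all_analysis.

Set Implicit Arguments.
Unset Strict Implicit.
Unset Printing Implicit Defensive.
Import Order.TTheory GRing.Theory Num.Theory.

Local Open Scope classical_set_scope.
Local Open Scope ring_scope.

(* A simple graph whose vertices form a subset of the ambient type V; edges are
   unordered pairs of distinct vertices. *)
Record graph (V : choiceType) := Graph {
  verts : set V;
  edges : set {fset V};
  edgesP : forall e, edges e -> #|` e| = 2%N /\ [set` e] `<=` verts }.

Section Graphs.
Variable V : choiceType.
Implicit Types (G : graph V) (x y o : V) (A : set V) (K : {fset V}).

Definition adj G : rel V := fun x y => [fset x; y]%fset \in edges G.

Definition reachable G x y : Prop :=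
  exists p : seq V, path (adj G) x p /\ last x p = y.

Definition connected_graph G : Prop :=
  verts G !=set0 /\
  forall x y, verts G x -> verts G y -> reachable G x y.

Definition acyclic G : Prop :=
  forall c : seq V, ucycle (adj G) c -> (size c <= 2)%N.

Definition regular (k : nat) G : Prop :=
  forall x, verts G x -> ([set y | adj G x y] #= `I_k)%card.

(* Any two such graphs are isomorphic, so this determines "the" k-regular
   tree. *)
Definition regular_tree (k : nat) G : Prop :=
  [/\ connected_graph G, acyclic G & regular k G].

Definition automorphism G (f : V -> V) : Prop :=
  set_bij (verts G) (verts G) f /\
  forall x y, verts G x -> verts G y -> adj G (f x) (f y) = adj G x y.

Lemma induced_subproof G A (e : {fset V}) :
  (edges G `&` [set e | [set` e] `<=` A]) e ->
  #|` e| = 2%N /\ [set` e] `<=` verts G `&` A.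
Proof.
by move=> [/edgesP[e2 eG] eA]; split=> // x ex; split; [exact: eG|exact: eA].
Qed.

Definition induced G A : graph V := Graph (@induced_subproof G A).

Definition component G o : graph V := induced G (reachable G o).

Definition edge_boundary G K : set {fset V} :=
  [set e | edges G e /\
    exists x y, [/\ e = [fset x; y]%fset, x \in K, verts G y & y \notin K]].

(* Meant for infinite connected graphs of bounded degree: there the edge
   boundary of a finite set is finite, so that fset_set (which sends infinite
   sets to the empty one) returns that boundary. *)
Definition anchored_expansion (R : realType) G : Prop :=
  exists2 o, verts G o &
    0 < inf [set r : R | exists K, [/\ o \in K, [set` K] `<=` verts G,
          connected_graph (induced G [set` K]) &
          r = #|` fset_set (edge_boundary G K)|%:R / #|` K|%:R]].

End Graphs.

Section Percolation.
Variables (V : choiceType) (T : graph V).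

Definition edge_cylinders : set (set (set (edges T))) :=
  [set C | exists e : edges T, C = [set w : set (edges T) | w e]].

(* The subsets of E(T), with the product sigma-algebra of {0,1}^E(T). *)
Definition configs := g_sigma_algebraType edge_cylinders.

Lemma open_graph_subproof (w : set (edges T)) (e : {fset V}) :
  [set val a | a in w] e -> #|` e| = 2%N /\ [set` e] `<=` verts T.
Proof. by move=> [a _ <-]; apply: edgesP; exact: set_valP. Qed.

Definition open_graph (w : set (edges T)) : graph V :=
  Graph (@open_graph_subproof w).

Definition open_cluster (w : set (edges T)) (o : V) : graph V :=
  component (open_graph w) o.

Definition config_image (f : V -> V) (w : set (edges T)) : set (edges T) :=
  [set e | exists2 a, w a & val e = [fset f x | x in val a]%fset].

Definition invariant_law (R : realType) (mu : probability configs R) : Prop :=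
  forall f, automorphism T f ->
  forall A : set configs, measurable A ->
    mu [set w : configs | A (config_image f w)] = mu A.

Definition has_law (R : realType) d (Omega : measurableType d)
    (P : probability Omega R) (X : {RV P >-> configs})
    (mu : probability configs R) : Prop :=
  forall A : set configs, measurable A -> distribution P X A = mu A.

Definition independent_events (R : realType) d (Omega : measurableType d)
    (P : probability Omega R) (I : choiceType) (E : I -> set Omega) : Prop :=
  forall F : {fset I},
    P (\bigcap_(i in [set` F]) E i) = (\prod_(i <- F) P (E i))%E.

Definition bernoulli_percolation (R : realType) d (Omega : measurableType d)
    (P : probability Omega R) (X : {RV P >-> configs}) (p : R) : Prop :=
  let open_event (e : edges T) := [set t | (X t : set (edges T)) e] in
  (forall e, P (open_event e) = p%:E) /\ independent_events P open_event.

(* Taking some of A, B, C to be the whole space gives the product rule for the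
   subfamilies. *)
Definition independent3 (R : realType) d (Omega : measurableType d)
    (P : probability Omega R) (X Y Z : {RV P >-> configs}) : Prop :=
  forall A B C : set configs, measurable A -> measurable B -> measurable C ->
    P (X @^-1` A `&` Y @^-1` B `&` Z @^-1` C) =
    (P (X @^-1` A) * P (Y @^-1` B) * P (Z @^-1` C))%E.

Definition perturbation (w eta_add eta_del : set (edges T)) : set (edges T) :=
  (w `|` eta_add) `\` eta_del.

End Percolation.

(* Main.v *)
Require Import Defs.
From HB Require Import structures.
From mathcomp Require Import all_boot all_order all_algebra.
From mathcomp Require Import finmap.
From mathcomp Require Import all_classical all_reals all_analysis.
From mathcomp Require Import lra zify.

Set Implicit Arguments.
Unset Strict Implicit.
Unset Printing Implicit Defensive.
Import Order.TTheory GRing.Theory Num.Theory.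

Local Open Scope classical_set_scope.
Local Open Scope ring_scope.

(** The law [mu] has to be fixed before the noise parameter [eps] and the expansion constant [1 / M]
    are known, and this dictates the scales. If [2 ^- a <= eps], a trap at scale [n] has probability
    at least [2 ^- (C * radius n)] with [C = 7 * a + 30]. The traps are therefore sought at depth
    [20 * n * radius n]: growth at rate [1 + 1 / M] produces about [2 ^ (20 * (n / M) * radius n)]
    candidates there, which beats every fixed [C] once [n / M] is large. Up to this depth no hole of
    a scale above [n] may interfere, so consecutive radii must have a ratio growing linearly in [n].
    The holes of these larger scales are cut off at a cost of [2 ^- n].

    Two features of the statement add work. Anchored expansion leaves the base vertex free, so that
    failure is proved at each vertex and the countably many null sets are united. Moreover [omega]
    lives on an arbitrary space and is known only through its law: it carries no bits there, which
    is why probabilities are moved to a product space that has them. *)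

(** Independently at every vertex [v] and scale [k], with the very small
    probability [theta k], all edges in the annulus of radii [radius k] and
    [2 * radius k] around [v] are removed; omega is what remains.  Holes and
    deletions are so rare that a second moment argument gives percolation with
    probability at least 1/3.

    Anchored expansion with constant [1 / M] forces the sphere of radius [j] in
    the cluster to have at least of the order of [(1 + 1 / M) ^ j] points.  Below
    each point of a sphere of large radius there is, with a probability that is
    large compared with the inverse of this number, a trap: a hole whose annulus
    is crossed by a path of added edges from above and by nothing from below, and
    whose inside carries an exponentially large open bush.  Given the sphere
    these events are independent, so some trap is present, and the path to it
    together with its bush is a finite connected set with too small a boundary.

    Events depending on finitely many edges are computed on the product of the
    space of the bits with the space of the noises. *)

Lemma big_fsetU_disjoint (R : Type) (idx : R) (op : Monoid.com_law idx) (I : choiceType)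
    (A B : {fset I}) (F : I -> R) : [disjoint A & B]%fset ->
  \big[op/idx]_(i <- (A `|` B)%fset) F i =
  op (\big[op/idx]_(i <- A) F i) (\big[op/idx]_(i <- B) F i).
Proof.
move=> AB; rewrite -big_cat; apply/perm_big/uniq_perm; first exact: fset_uniq.
  rewrite cat_uniq !fset_uniq andbT /=; apply/hasPn => i iB; apply/negP => iA.
  by move/fdisjointP: AB => /(_ i iA); rewrite iB.
by move=> i; rewrite mem_cat inE.
Qed.

(** * Events depending on finitely many coordinates *)

(** One implication suffices, as the assumption is symmetric in [t] and [t']. Coordinates are events
    of an arbitrary space, so the same notion serves for bits, edges and noises. *)
Definition depends_on (I T : Type) (E : I -> set T) (l : I -> Prop) (A : set T) :=
  forall t t', (forall i, l i -> (E i t <-> E i t')) -> A t -> A t'.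

Section DependsOn.
Variables (I : choiceType) (T : Type) (E : I -> set T).

(** In an arbitrary space a single coordinate cannot be switched. The section of [A] is therefore
    taken existentially, over the points of [A] and [B] that agree with [t] on [l]. *)
Let slice (l : seq I) (B A : set T) : set T :=
  [set t | exists t', [/\ A t', B t' & forall i, i \in l -> (E i t <-> E i t')]].

Lemma depends_on_slice l B A : depends_on E [set` l] (slice l B A).
Proof.
move=> t t' tt' [u [Au Bu tu]]; exists u; split => // i il.
by rewrite -(tu _ il); apply: iff_sym; apply: tt'.
Qed.

Lemma depends_on_cons i (l : seq I) (A : set T) : depends_on E [set` i :: l] A ->
  A = (E i `&` slice l (E i) A) `|` (~` E i `&` slice l (~` E i) A).
Proof.
move=> dA; apply/seteqP; split=> t.
  by have [Et|Et] := pselect (E i t) => At; [left|right]; split => //; exists t.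
move=> [[Et [u [Au Eu tu]]]|[Et [u [Au Eu tu]]]]; apply: dA Au => j /=;
  rewrite inE => /orP[/eqP->|jl]; first by split.
- by apply: iff_sym; exact: tu.
- by split.
- by apply: iff_sym; exact: tu.
Qed.

Lemma depends_on_nil (A : set T) : depends_on E [set` [::]] A -> A = set0 \/ A = setT.
Proof.
move=> dA; have [[t At]|nA] := pselect (exists t, A t); [right|left].
  by apply/seteqP; split=> // u _; apply: dA At => i.
by apply/seteqP; split=> // u Au; case: nA; exists u.
Qed.

(* Conditioning on the first coordinate writes a set depending on [i :: l]
   in terms of two sets depending on [l]. *)
Lemma depends_on_ind (Q : seq I -> set T -> Prop) :
  Q [::] set0 -> Q [::] setT ->
  (forall i l A1 A0, Q l A1 -> Q l A0 ->
     depends_on E [set` l] A1 -> depends_on E [set` l] A0 ->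
     Q (i :: l) ((E i `&` A1) `|` (~` E i `&` A0))) ->
  forall l A, depends_on E [set` l] A -> Q l A.
Proof.
move=> Q0 QT Qc; elim=> [A /depends_on_nil[->|->]//|i l IH A dA].
rewrite (depends_on_cons dA); apply: Qc; try exact: depends_on_slice;
by apply: IH; exact: depends_on_slice.
Qed.

Lemma depends_onW (l l' : I -> Prop) A : (forall i, l i -> l' i) ->
  depends_on E l A -> depends_on E l' A.
Proof. by move=> ll' dA t t' tt'; apply: dA => i /ll'; exact: tt'. Qed.

Lemma depends_onC l A : depends_on E l A -> depends_on E l (~` A).
Proof. by move=> dA t t' tt' nAt At'; apply/nAt/(dA _ _ _ At') => i /tt' []. Qed.

Lemma depends_on1 i (l : I -> Prop) : l i -> depends_on E l (E i).
Proof. by move=> li t t' /(_ i li)[]. Qed.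

Lemma depends_on_ex (J : Type) (D : J -> Prop) (A : J -> set T) l :
  (forall j, D j -> depends_on E l (A j)) ->
  depends_on E l [set t | exists2 j, D j & A j t].
Proof. by move=> dA t t' tt' [j Dj Aj]; exists j => //; exact: (dA j Dj t). Qed.

Lemma depends_on_all (J : Type) (D : J -> Prop) (A : J -> set T) l :
  (forall j, D j -> depends_on E l (A j)) ->
  depends_on E l [set t | forall j, D j -> A j t].
Proof. by move=> dA t t' tt' Aj j Dj; exact: (dA j Dj t t' tt' (Aj j Dj)). Qed.

End DependsOn.

Lemma depends_on_measurable d (T : measurableType d) (I : choiceType)
    (E : I -> set T) (l : seq I) (A : set T) :
  (forall i, measurable (E i)) -> depends_on E [set` l] A -> measurable A.
Proof.
move=> mE; move: l A; apply: depends_on_ind => // i l A1 A0 mA1 mA0 _ _.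
by apply: measurableU; apply: measurableI => //; exact: measurableC.
Qed.

Section RealProbability.
Context {R : realType} d {T : measurableType d} (P : probability T R).

Definition prob (A : set T) : R := fine (P A).

Lemma probE A : measurable A -> P A = (prob A)%:E.
Proof. by move=> mA; rewrite fineK// fin_num_measure. Qed.

Lemma prob_ge0 A : 0 <= prob A.
Proof. by rewrite fine_ge0. Qed.

Lemma prob_le1 A : measurable A -> prob A <= 1.
Proof. by move=> mA; rewrite -lee_fin -probE// probability_le1. Qed.

Lemma probT : prob setT = 1.
Proof. by rewrite /prob probability_setT. Qed.

Lemma prob0 : prob set0 = 0.
Proof. by rewrite /prob measure0. Qed.

Lemma prob_le A B : measurable A -> measurable B -> A `<=` B -> prob A <= prob B.
Proof. by move=> mA mB AB; rewrite -lee_fin -!probE// le_measure// inE. Qed.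

Lemma probU A B : measurable A -> measurable B -> A `&` B = set0 ->
  prob (A `|` B) = prob A + prob B.
Proof.
move=> mA mB AB0; apply: EFin_inj; rewrite EFinD -!probE//; last exact: measurableU.
by rewrite measureU//.
Qed.

Lemma probDC A B : measurable A -> measurable B ->
  prob (~` B `&` A) = prob A - prob (B `&` A).
Proof.
move=> mA mB; have mC : measurable (~` B) by exact: measurableC.
have -> : prob A = prob (B `&` A) + prob (~` B `&` A).
  rewrite -probU; try exact: measurableI.
    by congr prob; rewrite -setIUl setUCr setTI.
  by apply/seteqP; split=> t // [[? ?] []].
by rewrite addrAC subrr add0r.
Qed.

Lemma probC A : measurable A -> prob (~` A) = 1 - prob A.
Proof. by move=> mA; rewrite -[~` A]setIT probDC// setIT probT. Qed.

(* Integrate the indicator functions. *)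
Lemma prob_combination (J : Type) (s : seq J) (a : J -> R) (A : J -> set T) :
  (forall j, measurable (A j)) ->
  (forall t, 0 <= \sum_(j <- s) a j * \1_(A j) t) ->
  0 <= \sum_(j <- s) a j * prob (A j).
Proof.
move=> mA pos.
have int j : P.-integrable setT (EFin \o (fun t => a j * \1_(A j) t)).
  apply: (eq_integrable measurableT (fun t => (a j)%:E * (\1_(A j) t)%:E)%E) => //.
  apply: integrableZl => //; exact: integrable_indic.
have -> : \sum_(j <- s) a j * prob (A j) =
          fine (\int[P]_t (\sum_(j <- s) a j * \1_(A j) t)%:E).
  under eq_integral do rewrite -sumEFin.
  rewrite integral_sum//.
  rewrite (eq_bigr (fun j => (a j * prob (A j))%:E)) ?sumEFin// => j _.
  under eq_integral do rewrite EFinM.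
  rewrite integralZl//; last exact: integrable_indic.
  by rewrite integral_indic// setIT EFinM -probE.
by rewrite fine_ge0// integral_ge0// => t _; rewrite lee_fin.
Qed.

End RealProbability.

(** * Independence of events with disjoint finite supports *)

Section Independence.
Context {R : realType} d {T : measurableType d} (P : probability T R).
Variables (I : choiceType) (E : I -> set T) (p : I -> R).
Hypothesis mE : forall i, measurable (E i).
Hypothesis indepE : forall F : {fset I},
  prob P (\bigcap_(i in [set` F]) E i) = \prod_(i <- F) p i.

Let mcyl (F : {fset I}) : measurable (\bigcap_(i in [set` F]) E i).
Proof.
rewrite bigcap_fset; apply: big_ind => //; first exact: measurableI.
Qed.

(** Independence of [B] from the coordinates in [l], required only on intersections of the events
    [E i]. This form is stable when a coordinate of [l] is removed and [B] is intersected with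
    it. *)
Let free (l : seq I) (B : set T) := measurable B /\
  forall F : {fset I}, {subset F <= l} ->
  prob P ((\bigcap_(i in [set` F]) E i) `&` B) = (\prod_(i <- F) p i) * prob P B.

Let freeT l : free l setT.
Proof. by split=> // F _; rewrite setIT indepE probT mulr1. Qed.

Let free_cons i l B : i \notin l -> free (i :: l) B ->
  [/\ free l B, free l (E i `&` B) & prob P (E i `&` B) = p i * prob P B].
Proof.
move=> il [mB fB].
have Ei : prob P (E i `&` B) = p i * prob P B.
  have := fB [fset i]%fset; rewrite big_seq_fset1 bigcap_fset big_seq_fset1 => ->//.
  by move=> j; rewrite !inE => ->.
split=> //; first by split=> // F Fl; apply: fB => j /Fl jl; rewrite inE jl orbT.
split=> [|F Fl]; first exact: measurableI.
have iF : i \notin F by apply: contra il => /Fl.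
have := fB (i |` F)%fset; rewrite big_fsetU1//= Ei mulrCA !mulrA => <-.
  by congr prob; rewrite set_fsetU1 bigcap_setU1 setIA [E i `&` _]setIC.
by move=> j; rewrite !inE => /orP[->//|/Fl->]; rewrite orbT.
Qed.

(** Induction on the support: the part of [A] off [E i] has its probability written as a difference,
    so that only [A1] and [A0] against [B] and against [E i] intersected with [B] remain. Both of
    these are free of the shorter list. The same expansion with [setT] in place of [B] computes the
    probability of [A]. *)
Let free_indep l A : depends_on E [set` l] A -> forall B, uniq l -> free l B ->
  measurable A /\ prob P (A `&` B) = prob P A * prob P B.
Proof.
move: l A; apply: depends_on_ind.
- by move=> B _ _; rewrite set0I prob0 mul0r.
- by move=> B _ _; rewrite setTI probT mul1r.
move=> i l A1 A0 IH1 IH0 _ _ B /= /andP[il ul] fB.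
have split_prob C : free (i :: l) C -> measurable A1 -> measurable A0 ->
    prob P ((E i `&` A1 `|` ~` E i `&` A0) `&` C) =
    prob P (A1 `&` (E i `&` C)) + prob P (A0 `&` C) - prob P (A0 `&` (E i `&` C)).
  move=> fC mA1 mA0; have mC := fC.1; have mA0C := measurableI _ _ mA0 mC.
  have -> : (E i `&` A1 `|` ~` E i `&` A0) `&` C =
    (A1 `&` (E i `&` C)) `|` (~` E i `&` (A0 `&` C)).
    by rewrite setIUl -!setIA [E i `&` (A1 `&` C)]setICA.
  rewrite probU ?probDC//; first by rewrite [E i `&` (A0 `&` C)]setICA addrA.
  - by apply: measurableI => //; exact: measurableI.
  - by apply: measurableI => //; exact: measurableC.
  - by apply/seteqP; split=> t // [[_ [? _]] []].
have [fT1 fT2 pT] := free_cons il (freeT (i :: l)).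
have [f1 f2 pB] := free_cons il fB.
have [mA1 IH1B] := IH1 _ ul f2; have [mA0 IH0B] := IH0 _ ul f1.
split; first by apply: measurableU; apply: measurableI => //; exact: measurableC.
rewrite split_prob// -[in RHS](setIT (_ `|` _)) split_prob//.
rewrite IH1B IH0B (IH0 _ ul f2).2 (IH1 _ ul fT2).2 (IH0 _ ul fT1).2 (IH0 _ ul fT2).2.
by rewrite pB pT probT; lra.
Qed.

(** [free_indep] is used twice: once to show that [B] is free of [l], by testing it against
    cylinders over [l], and once for [A] against [B]. *)
Lemma depends_indep (l l' : seq I) A B :
  depends_on E [set` l] A -> depends_on E [set` l'] B ->
  (forall i, i \in l -> i \in l' -> False) ->
  prob P (A `&` B) = prob P A * prob P B.
Proof.
move=> dA dB ll'.
have dAu : depends_on E [set` undup l] A by apply: depends_onW dA => i /=; rewrite mem_undup.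
have dBu : depends_on E [set` undup l'] B by apply: depends_onW dB => i /=; rewrite mem_undup.
apply: (free_indep dAu _ _).2; first exact: undup_uniq.
split=> [|F Fl]; first exact: depends_on_measurable dB.
rewrite setIC (free_indep dBu _ _).2 ?undup_uniq//; first by rewrite mulrC indepE.
split=> // G Gl; rewrite -bigcap_setU -set_fsetU.
rewrite !indepE big_fsetU_disjoint//; apply/fdisjointP => i /Gl.
rewrite mem_undup => il'; apply/negP => /Fl; rewrite mem_undup => il.
exact: ll' il il'.
Qed.

Lemma depends_indep_all (J : eqType) (s : seq J) (A : J -> set T) (l : J -> seq I)
    (B : set T) (lB : seq I) :
  uniq s -> depends_on E [set` lB] B ->
  (forall j, j \in s -> depends_on E [set` l j] (A j)) ->
  (forall j i, j \in s -> i \in l j -> i \in lB -> False) ->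
  (forall j j' i, j \in s -> j' \in s -> i \in l j -> i \in l j' -> j = j') ->
  prob P (B `&` [set t | forall j, j \in s -> A j t]) =
  prob P B * \prod_(j <- s) prob P (A j).
Proof.
elim: s B lB => [|j s IH] B lB /= us dB dA disB dis.
  by rewrite big_nil mulr1; congr prob; apply/seteqP; split=> t // [].
case/andP: us => js us.
have sub j' : j' \in s -> j' \in j :: s by rewrite inE => ->; rewrite orbT.
have dAj := dA j (mem_head _ _).
have -> : B `&` [set t | forall j', j' \in j :: s -> A j' t] =
  (B `&` A j) `&` [set t | forall j', j' \in s -> A j' t].
  apply/seteqP; split=> t /= [].
    move=> Bt At; split; first by split=> //; apply: At; rewrite mem_head.
    by move=> j' j's; apply: At; apply: sub.
  by move=> [Bt Aj] At; split=> // j'; rewrite inE => /orP[/eqP->|/At].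
rewrite (IH _ (lB ++ l j))//.
- by rewrite (depends_indep dB dAj) ?big_cons ?mulrA// => i iB /disB; apply => //; rewrite mem_head.
- move=> t t' tt' [Bt At]; split.
    by apply: dB Bt => i /= il; apply: tt'; rewrite /= mem_cat il.
  by apply: dAj At => i /= il; apply: tt'; rewrite /= mem_cat il orbT.
- by move=> j' /sub; exact: dA.
- move=> j' i j's il; rewrite mem_cat => /orP[|ij]; first exact: (disB j' i (sub _ j's)).
  by move: js; rewrite (dis j j' i) ?mem_head ?j's ?sub.
- by move=> j1 j2 i /sub j1s /sub j2s; exact: dis.
Qed.

Lemma indep_off (F : {fset I}) :
  prob P [set t | forall i, i \in F -> ~ E i t] = \prod_(i <- F) (1 - p i).
Proof.
have := @depends_indep_all _ (enum_fset F) (fun i => ~` E i) (fun i => [:: i]) setT [::].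
rewrite setTI probT mul1r => ->; first last.
- by move=> j j' i _ _; rewrite !inE => /eqP-> /eqP.
- by [].
- by move=> j _; apply: depends_onC; apply: (@depends_on1 _ _ _ j); exact: mem_head.
- by [].
- exact: fset_uniq.
apply: eq_bigr => i _; rewrite probC//.
have := indepE [fset i]%fset; rewrite big_seq_fset1 bigcap_fset big_seq_fset1 => ->.
by [].
Qed.

End Independence.

(** The hypothesis compares the two laws on intersections only. Proving equality of the
    probabilities intersected with an arbitrary cylinder lets the induction expand the complement of
    a coordinate as a difference of two cylinders. *)
Lemma prob_transfer (R : realType) d d' (T : measurableType d) (T' : measurableType d')
    (P : probability T R) (P' : probability T' R) (I : choiceType)
    (E : I -> set T) (E' : I -> set T') (l : seq I) (A : set (I -> Prop)) :
  (forall i, measurable (E i)) -> (forall i, measurable (E' i)) ->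
  (forall F : {fset I},
    prob P (\bigcap_(i in [set` F]) E i) = prob P' (\bigcap_(i in [set` F]) E' i)) ->
  depends_on (fun i (x : I -> Prop) => x i) [set` l] A ->
  prob P [set t | A (E^~ t)] = prob P' [set t | A (E'^~ t)].
Proof.
move=> mE mE' EE' dA.
suff H : forall F : {fset I},
    [/\ measurable [set t | A (E^~ t)], measurable [set t | A (E'^~ t)] &
    prob P (\bigcap_(i in [set` F]) E i `&` [set t | A (E^~ t)]) =
    prob P' (\bigcap_(i in [set` F]) E' i `&` [set t | A (E'^~ t)])].
  by have [_ _] := H fset0; rewrite !bigcap_fset !big_seq_fset0 !setTI.
move: l A dA; apply: depends_on_ind.
- move=> F; split; [exact: measurable0|exact: measurable0|].
  by rewrite [X in prob P X](_ : _ = set0) ?[X in prob P' X](_ : _ = set0) ?prob0//;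
    apply/seteqP; split=> t // [].
- move=> F; split; [exact: measurableT|exact: measurableT|].
  rewrite [X in prob P X](_ : _ = \bigcap_(i in [set` F]) E i).
    rewrite [X in prob P' X](_ : _ = \bigcap_(i in [set` F]) E' i)//.
    by apply/seteqP; split=> t // [].
  by apply/seteqP; split=> t // [].
move=> i l A1 A0 IH1 IH0 _ _ F.
have mcyl d0 (T0 : measurableType d0) (E0 : I -> set T0) :
    (forall i, measurable (E0 i)) -> measurable (\bigcap_(i in [set` F]) E0 i).
  by move=> mE0; rewrite bigcap_fset; apply: big_ind => //; exact: measurableI.
have key d0 (T0 : measurableType d0) (P0 : probability T0 R) (E0 : I -> set T0)
    (mE0 : forall i, measurable (E0 i)) :
    measurable [set t | A1 (E0^~ t)] -> measurable [set t | A0 (E0^~ t)] ->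
    measurable [set t | ((fun x : I -> Prop => x i) `&` A1 `|`
      ~` (fun x : I -> Prop => x i) `&` A0) (E0^~ t)] /\
    prob P0 (\bigcap_(i in [set` F]) E0 i `&` [set t |
     ((fun x : I -> Prop => x i) `&` A1 `|` ~` (fun x : I -> Prop => x i) `&` A0) (E0^~ t)]) =
    prob P0 (\bigcap_(i in [set` (i |` F)%fset]) E0 i `&` [set t | A1 (E0^~ t)]) +
    (prob P0 (\bigcap_(i in [set` F]) E0 i `&` [set t | A0 (E0^~ t)]) -
     prob P0 (\bigcap_(i in [set` (i |` F)%fset]) E0 i `&` [set t | A0 (E0^~ t)])).
  move=> mA1 mA0.
  have -> : \bigcap_(i0 in [set` (i |` F)%fset]) E0 i0 =
      E0 i `&` \bigcap_(i0 in [set` F]) E0 i0.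
    by rewrite set_fsetU1 bigcap_setU1.
  set C := \bigcap_(i in _) _; have mC : measurable C by exact: mcyl.
  have -> : [set t | ((fun x : I -> Prop => x i) `&` A1 `|`
      ~` (fun x : I -> Prop => x i) `&` A0) (E0^~ t)] =
      (E0 i `&` [set t | A1 (E0^~ t)]) `|` (~` E0 i `&` [set t | A0 (E0^~ t)]) by [].
  have mU : measurable (E0 i `&` [set t | A1 (E0^~ t)] `|` ~` E0 i `&` [set t | A0 (E0^~ t)]).
    by apply: measurableU; apply: measurableI => //; exact: measurableC.
  split=> //; rewrite -[E0 i `&` C `&` [set t | A0 _]]setIA -probDC//; last exact: measurableI.
  rewrite -probU; last first.
  - by apply/seteqP; split=> t // [[[? _] _] []].
  - by apply: measurableI; [exact: measurableC|exact: measurableI].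
  - by apply: measurableI => //; exact: measurableI.
  by rewrite setIUr setIA -[in X in _ `|` X]setICA [C `&` E0 i]setIC.
have [mA1 mA1' _] := IH1 F; have [mA0 mA0' e0] := IH0 F.
have [_ _ e1] := IH1 (i |` F)%fset; have [_ _ e2] := IH0 (i |` F)%fset.
have [m1 ->] := key _ _ P E mE mA1 mA0; have [m2 ->] := key _ _ P' E' mE' mA1' mA0'.
by rewrite e0 e1 e2.
Qed.

(** * Geometry of the tree *)

Lemma card_bigfcup (I V : choiceType) (s : seq I) (F : I -> {fset V}) :
  uniq s -> (forall i j x, x \in F i -> x \in F j -> i = j) ->
  #|` \bigcup_(i <- s) F i|%fset = (\sum_(i <- s) #|` F i|)%N.
Proof.
move=> us disj; elim: s us => [|i s IH] /=; first by rewrite !big_nil cardfs0.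
case/andP=> is_ /IH {}IH; rewrite !big_cons cardfsU IH.
rewrite (_ : _ `&` _ = fset0)%fset ?cardfs0 ?subn0//.
apply/fsetP => x; rewrite !inE; apply/negP => /andP[xi /bigfcupP[j /andP[js _] xj]].
by move: is_; rewrite (disj _ _ _ xi xj) js.
Qed.

Lemma leq_card_bigfcup (I V : choiceType) (s : seq I) (F : I -> {fset V}) :
  (#|` \bigcup_(i <- s) F i|%fset <= \sum_(i <- s) #|` F i|)%N.
Proof.
elim: s => [|i s IH] /=; first by rewrite !big_nil cardfs0.
rewrite !big_cons (leq_trans (leq_card_fsetU _ _))// leq_add2l//.
Qed.

Lemma in_bigfcup (I V : choiceType) (s : {fset I}) (F : I -> {fset V}) x :
  reflect (exists2 i, i \in s & x \in F i) (x \in (\bigcup_(i <- s) F i)%fset).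
Proof.
apply: (iffP (bigfcupP _ _ _ _)) => [[i /andP[is_ _] xi]|[i is_ xi]]; exists i => //.
by rewrite is_.
Qed.

Section GraphBasics.
Variables (V : choiceType) (G : graph V).

Lemma adjC x y : adj G x y = adj G y x.
Proof. by rewrite /adj fsetUC. Qed.

Lemma adj_neq x y : adj G x y -> x != y.
Proof. by rewrite /adj inE => /edgesP[]; rewrite cardfs2; case: eqP. Qed.

Lemma adj_verts x y : adj G x y -> verts G x /\ verts G y.
Proof.
rewrite /adj inE => /edgesP[_ sub].
by split; apply: sub => /=; rewrite !inE eqxx ?orbT.
Qed.

End GraphBasics.

Section Tree.
Variables (V : choiceType) (T : graph V).
Hypothesis hT : regular_tree 4 T.
Implicit Types (x y z v : V).

Definition nbrs x : {fset V} := fset_set [set y | adj T x y].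

Lemma finite_nbrs x : finite_set [set y | adj T x y].
Proof.
have [vx|nvx] := pselect (verts T x).
  by have [_ _ /(_ x vx) h] := hT; exists 4%N.
rewrite (_ : [set y | _] = set0)//; apply/seteqP; split=> y //= /adj_verts[].
by [].
Qed.

Lemma in_nbrs x y : (y \in nbrs x) = adj T x y.
Proof. by rewrite in_fset_set ?mem_setE//; exact: finite_nbrs. Qed.

Lemma card_nbrs x : verts T x -> #|` nbrs x| = 4%N.
Proof. by have [_ _ reg] := hT => /reg h; apply: card_fset_set. Qed.

Lemma card_nbrs_le x : (#|` nbrs x| <= 4)%N.
Proof.
have [/card_nbrs->//|nvx] := pselect (verts T x).
rewrite (_ : nbrs x = fset0) ?cardfs0//; apply/fsetP => y; rewrite in_nbrs inE.
by apply/negP => /adj_verts[].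
Qed.

Fixpoint tball n x : {fset V} :=
  if n is m.+1 then (tball m x `|` \bigcup_(y <- nbrs x) tball m y)%fset else [fset x]%fset.

Lemma tballS n x y : y \in tball n.+1 x <->
  y \in tball n x \/ exists2 z, adj T x z & y \in tball n z.
Proof.
rewrite inE; split.
  case/orP=> [->|/bigfcupP[z /andP[zx _] yz]]; first by left.
  by right; exists z; rewrite -?in_nbrs.
case=> [->//|[z xz yz]]; apply/orP; right; apply/bigfcupP; exists z => //.
by rewrite in_nbrs xz.
Qed.

Lemma tball_center n x : x \in tball n x.
Proof. by elim: n => [|n IH]; [rewrite /= inE|apply/tballS; left]. Qed.

Lemma tball_le n m x y : (n <= m)%N -> y \in tball n x -> y \in tball m x.
Proof.
move=> /subnKC <-; elim: (m - n)%N => [|k IH]; first by rewrite addn0.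
by rewrite addnS => /IH ?; apply/tballS; left.
Qed.

Lemma tball_trans n m x y z : y \in tball n x -> z \in tball m y -> z \in tball (n + m) x.
Proof.
elim: n x => [|n IH] x; first by rewrite /= inE => /eqP->.
case/tballS=> [/IH h /h ?|[u xu /IH h /h ?]]; rewrite addSn; apply/tballS; first by left.
by right; exists u.
Qed.

Lemma tball1 x y : adj T x y -> y \in tball 1 x.
Proof. by move=> xy; apply/tballS; right; exists y => //; rewrite /= inE. Qed.

Lemma tball_sym n x y : y \in tball n x -> x \in tball n y.
Proof.
elim: n x y => [|n IH] x y; first by rewrite /= !inE eq_sym.
case/tballS=> [/IH ?|[z xz /IH zy]]; first by apply/tballS; left.
by rewrite -addn1; apply: tball_trans zy _; apply: tball1; rewrite adjC.
Qed.

Lemma tball_verts n x y : verts T x -> y \in tball n x -> verts T y.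
Proof.
elim: n x => [|n IH] x vx; first by rewrite /= inE => /eqP->.
by case/tballS=> [/IH|[z /adj_verts[_ vz] /IH]]; apply.
Qed.

(** A ball of radius [n + 1] is a union of at most five balls of radius [n]: the one at the centre
    and those at its neighbours. *)
Lemma card_tball n x : (#|` tball n x| <= 5 ^ n)%N.
Proof.
elim: n x => [|n IH] x; first by rewrite cardfs1.
rewrite (leq_trans (leq_card_fsetU _ _))//.
rewrite (leq_trans (n := 5 ^ n + \sum_(y <- nbrs x) 5 ^ n))%N//.
  rewrite leq_add// (leq_trans (leq_card_bigfcup _ _))//.
  by apply: leq_sum.
rewrite big_const_seq count_predT iter_addn_0 expnS [(5 * _)%N]mulSn leq_add2l mulnC leq_mul2r.
by rewrite card_nbrs_le orbT.
Qed.

Lemma path_tball x p : path (adj T) x p -> last x p \in tball (size p) x.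
Proof.
elim: p x => [|y p IH] x /=; first by rewrite inE.
by case/andP=> xy /IH h; rewrite -/(tball (size p).+1 x); apply/tballS; right; exists y.
Qed.

(** Connectedness exhausts the vertices by countably many finite balls. The injection lets the bits
    be indexed by pairs of naturals, hence be constructed without reference to the tree. *)
Lemma ex_code : exists code : V -> nat, forall x y, verts T x -> verts T y ->
  code x = code y -> x = y.
Proof.
have [[[r vr] conn] _ _] := hT.
have : countable (verts T).
  apply: (@sub_countable _ _ _ (\bigcup_n [set` tball n r])).
    apply: subset_card_le => x vx; have [p [xp <-]] := conn _ _ vr vx.
    by exists (size p) => //=; exact: path_tball.
  by apply: bigcup_countable => // n _; exact/finite_set_countable/finite_fset.
by move=> /countable_injP[f inj]; exists f => x y vx vy; apply: inj; rewrite inE.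
Qed.

Section Root.
Variables (o : V) (e0 : edges T).
Hypothesis vo : verts T o.

Definition depth z : nat :=
  if pselect (exists n, z \in tball n o) is left h then ex_minn h else 0%N.

Lemma depth_ball z : verts T z -> z \in tball (depth z) o.
Proof.
move=> vz; rewrite /depth; case: pselect => [h|[]]; first by case: ex_minnP.
have [[_ conn] _ _] := hT; have [p [op <-]] := conn _ _ vo vz.
by exists (size p); exact: path_tball.
Qed.

Lemma depth_min n z : z \in tball n o -> (depth z <= n)%N.
Proof.
move=> zn; rewrite /depth; case: pselect => [h|//].
by case: ex_minnP => m _; apply.
Qed.

Lemma depth_root : depth o = 0%N.
Proof. by apply/eqP; rewrite -leqn0 depth_min//= inE. Qed.

Lemma depth_eq0 z : verts T z -> depth z = 0%N -> z = o.
Proof. by move=> /depth_ball + d0; rewrite d0 inE => /eqP. Qed.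

Lemma depth_gt0 z : verts T z -> z != o -> (0 < depth z)%N.
Proof. by move=> vz; apply: contraR; rewrite -eqn0Ngt => /eqP /(depth_eq0 vz)->. Qed.

Lemma depth_tball n x y : verts T x -> y \in tball n x -> (depth y <= depth x + n)%N.
Proof. by move=> vx yx; apply: depth_min; exact: tball_trans (depth_ball vx) yx. Qed.

Lemma depth_adj x y : adj T x y -> (depth y <= (depth x).+1)%N.
Proof.
by move=> xy; rewrite -addn1; apply: depth_tball (tball1 xy); have [] := adj_verts xy.
Qed.

Lemma ex_parent z : verts T z -> z != o -> exists2 y, adj T z y & depth z = (depth y).+1.
Proof.
move=> vz zo; have := depth_gt0 vz zo; have := tball_sym (depth_ball vz).
case dz: (depth z) => [//|n] /tballS[oz|[y zy oy]] _.
  by have := depth_min (tball_sym oz); rewrite dz ltnn.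
exists y => //; congr S; apply/eqP; rewrite eqn_leq (depth_min (tball_sym oy)) andbT.
by have := depth_adj (etrans (adjC _ _ _) zy); rewrite dz ltnS.
Qed.

Lemma path_to_root z : verts T z -> exists p, [/\ path (adj T) z p, last z p = o &
  {in p, forall x, (depth x < depth z)%N}].
Proof.
move: {2}(depth z) (erefl (depth z)) => n; elim: n z => [|n IH] z dz vz.
  by exists [::]; split=> //=; exact: depth_eq0.
have zo : z != o by apply/eqP => zo; move: dz; rewrite zo depth_root.
have [y zy dzy] := ex_parent vz zo; have [_ vy] := adj_verts zy.
have [|p [yp lp dp]] := IH y _ vy; first by move: dzy; rewrite dz => -[].
exists (y :: p); split=> //=; first by rewrite zy.
by move=> x; rewrite inE => /orP[/eqP->|/dp]; rewrite dzy ltnS//; exact: ltnW.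
Qed.

(* Two such neighbours would close a cycle through the root. *)
Lemma parent_unique z u u' : adj T z u -> adj T z u' ->
  (depth u <= depth z)%N -> (depth u' <= depth z)%N -> u = u'.
Proof.
move=> zu zu' du du'; apply/eqP; apply: contraT => uu'.
have [_ vu] := adj_verts zu; have [_ vu'] := adj_verts zu'.
have [p [pp lp dp]] := path_to_root vu; have [q [pq lq dq]] := path_to_root vu'.
pose r := p ++ rev (belast u' q).
have pr : path (adj T) u r.
  rewrite cat_path pp lp -lq rev_path.
  by rewrite (eq_path (e' := adj T))// => x y; rewrite adjC.
have lr : last u r = u'.
  rewrite /r last_cat lp; case: (q) lq => [/= <-//|a q' _] /=.
  by rewrite rev_cons last_rcons.
have zr : z \notin u :: r.
  rewrite inE negb_or (adj_neq zu)/= mem_cat negb_or mem_rev.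
  apply/andP; split; apply/negP; [move=> /dp|move=> /mem_belast].
    by rewrite ltnNge du.
  by rewrite inE (negPf (adj_neq zu'))/= => /dq; rewrite ltnNge du'.
case: (shortenP pr) lr zr => r' pr' ur' sub lr' zr.
have zr' : z \notin u :: r'.
  apply: contra zr; rewrite !inE => /orP[->//|/sub ->].
  by rewrite orbT.
have cyc : ucycle (adj T) (z :: u :: r').
  rewrite /ucycle [uniq _]cons_uniq zr' ur' andbT /= zu rcons_path pr' lr'.
  by rewrite (adjC _ u') zu'.
have [_ acyc _] := hT; have := acyc _ cyc.
case: (r') lr' => // /= uu'' _.
by rewrite uu'' eqxx in uu'.
Qed.

(** The root is its own parent, so that ancestors [iter j parent z] make sense for all [j]. *)
Definition parent z : V :=
  if z == o then o else xget o [set y | adj T z y /\ depth z = (depth y).+1].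

Lemma parent_root : parent o = o.
Proof. by rewrite /parent eqxx. Qed.

Lemma parentP z : verts T z -> z != o ->
  adj T z (parent z) /\ depth z = (depth (parent z)).+1.
Proof.
move=> vz zo; rewrite /parent (negPf zo); case: xgetP => [y _ //|h].
by have [y zy dy] := ex_parent vz zo; have := h y; case.
Qed.

Lemma parent_verts z : verts T z -> verts T (parent z).
Proof.
move=> vz; have [->|zo] := eqVneq z o; first by rewrite parent_root.
by have [/adj_verts[]] := parentP vz zo.
Qed.

Lemma depth_parent z : verts T z -> depth (parent z) = (depth z).-1.
Proof.
move=> vz; have [->|zo] := eqVneq z o; first by rewrite parent_root depth_root.
by have [_ ->] := parentP vz zo.
Qed.

Lemma adj_parent x y : adj T x y -> (depth y <= depth x)%N -> x != o /\ y = parent x.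
Proof.
move=> xy yx; have [vx vy] := adj_verts xy.
have xo : x != o.
  apply/eqP => xo; move: yx (adj_neq xy); rewrite xo depth_root leqn0.
  by move=> /eqP /(depth_eq0 vy)->; rewrite eqxx.
have [xp dx] := parentP vx xo; split=> //.
by apply: parent_unique xy xp yx _; rewrite dx.
Qed.

Lemma adj_cases x y : adj T x y ->
  (x != o /\ y = parent x) \/ (y != o /\ x = parent y).
Proof.
move=> xy; have [yx|/ltnW xy'] := leqP (depth y) (depth x); [left|right].
  exact: adj_parent.
by apply: adj_parent => //; rewrite adjC.
Qed.

Lemma iter_parent_verts j z : verts T z -> verts T (iter j parent z).
Proof. by move=> vz; elim: j => //= j; exact: parent_verts. Qed.

Lemma depth_iter j z : verts T z -> depth (iter j parent z) = (depth z - j)%N.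
Proof.
move=> vz; elim: j => [|j IH]; first by rewrite subn0.
by rewrite iterS depth_parent ?IH ?subnS//; exact: iter_parent_verts.
Qed.

Definition children x : {fset V} := [fset y in nbrs x | (y != o) && (parent y == x)]%fset.

Lemma in_children x y : verts T y -> (y \in children x) = (y != o) && (parent y == x).
Proof.
move=> vy; rewrite !inE in_nbrs /=; apply: andb_idl => /andP[yo /eqP <-].
by rewrite adjC; have [] := parentP vy yo.
Qed.

Lemma children_verts x y : y \in children x -> verts T y.
Proof. by rewrite !inE in_nbrs /= => /andP[/adj_verts[]]. Qed.

Lemma card_children_le x : (#|` children x| <= 4)%N.
Proof.
apply: leq_trans (card_nbrs_le x); apply: fsubset_leq_card.
by apply/fsubsetP => y; rewrite !inE => /andP[].
Qed.

Lemma card_children x : verts T x -> x != o -> #|` children x| = 3%N.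
Proof.
move=> vx xo; have := card_nbrs vx.
have -> : nbrs x = (parent x |` children x)%fset.
  apply/fsetP => y; rewrite in_nbrs !inE in_nbrs; apply/idP/idP.
    move=> xy; case: (adj_cases xy) => [[_ ->]|[yo xy']]; first by rewrite eqxx.
    by rewrite xy yo -xy' eqxx orbT.
  by case/orP=> [/eqP->|/andP[]//]; have [] := parentP vx xo.
rewrite cardfsU1 (_ : _ \notin _ = true); first by move=> -[].
rewrite in_children; last exact: parent_verts.
apply/negP => /andP[px /eqP ppx]; have [_ d1] := parentP vx xo.
by have [_ d2] := parentP (parent_verts vx) px; rewrite ppx d1 in d2; lia.
Qed.

Lemma card_children_root : #|` children o| = 4%N.
Proof.
rewrite -(card_nbrs vo); congr (#|` _|); apply/fsetP => y; rewrite !inE in_nbrs /=.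
apply: andb_idr => oy; case: (adj_cases oy) => [[/eqP//]|[-> <-]].
by rewrite eqxx.
Qed.

Fixpoint desc j x : {fset V} :=
  if j is i.+1 then (\bigcup_(y <- desc i x) children y)%fset else [fset x]%fset.

Lemma in_descS j x z : z \in desc j.+1 x <->
  [/\ verts T z, z != o & parent z \in desc j x].
Proof.
split.
  case/bigfcupP=> y /andP[yj _] zy; have vz := children_verts zy.
  by move: zy; rewrite in_children// => /andP[zo /eqP yz]; rewrite yz.
case=> vz zo pz; apply/bigfcupP; exists (parent z); first by rewrite pz.
by rewrite in_children// zo eqxx.
Qed.

(** The condition on depth matters at the root: [parent] fixes it, so [iter j parent z = x] alone
    does not determine the generation. *)
Lemma descP j x z : verts T x ->
  z \in desc j x <-> [/\ verts T z, depth z = (depth x + j)%N & iter j parent z = x].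
Proof.
move=> vx; elim: j z => [|j IH] z.
  by rewrite /= inE addn0; split=> [/eqP->|[_ _ ->]].
split.
  move=> /in_descS[vz zo /IH[_ dz iz]]; split=> //; last by rewrite iterSr.
  by have [_ ->] := parentP vz zo; rewrite dz addnS.
case=> vz dz iz; apply/in_descS; split=> //.
  by apply/eqP => zo; move: dz; rewrite zo depth_root addnS.
apply/IH; split; first exact: parent_verts; last by rewrite -iterSr.
by rewrite depth_parent// dz addnS.
Qed.

Lemma card_desc_le j x : (#|` desc j x| <= 4 ^ j)%N.
Proof.
elim: j => [|j IH]; first by rewrite cardfs1.
apply: leq_trans (leq_card_bigfcup _ _) _.
apply: (@leq_trans (\sum_(y <- desc j x) 4)%N).
  by apply: leq_sum => y _; exact: card_children_le.
by rewrite big_const_seq count_predT iter_addn_0 expnS leq_mul2l IH.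
Qed.

Lemma children_disj i j x : x \in children i -> x \in children j -> i = j.
Proof.
move=> xi; have vx := children_verts xi.
by move: xi; rewrite !in_children// => /andP[_ /eqP->] /andP[_ /eqP->].
Qed.

Lemma desc_root j x : verts T x -> o \in desc j x -> x = o.
Proof.
move=> vx /(descP _ _ vx)[_]; rewrite depth_root => /esym/eqP.
by rewrite addn_eq0 => /andP[/eqP /(depth_eq0 vx)].
Qed.

Lemma card_desc j x : verts T x -> x != o -> #|` desc j x| = (3 ^ j)%N.
Proof.
move=> vx xo; elim: j => [|j IH]; first by rewrite cardfs1.
rewrite card_bigfcup ?fset_uniq//; last exact: children_disj.
rewrite big_seq (eq_bigr (fun=> 3%N)).
  by rewrite -big_seq big_const_seq count_predT iter_addn_0 expnS IH.
move=> y yj; have [vy _ _] := (descP j y vx).1 yj; apply: card_children => //.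
by apply/eqP => yo; move: yj xo; rewrite yo => /(desc_root vx)->; rewrite eqxx.
Qed.

Lemma card_desc_root j : (3 ^ j <= #|` desc j o|)%N.
Proof.
elim: j => [|j IH]; first by rewrite cardfs1.
rewrite card_bigfcup ?fset_uniq//; last exact: children_disj.
apply: (@leq_trans (\sum_(y <- desc j o) 3)%N).
  by rewrite big_const_seq count_predT iter_addn_0 expnS leq_mul2l IH.
rewrite big_seq [X in (_ <= X)%N]big_seq; apply: leq_sum => y.
move=> /(descP _ _ vo)[vy _ _]; have [->|yo] := eqVneq y o.
  by rewrite card_children_root.
by rewrite card_children.
Qed.

(** The truncated subtraction is harmless: if [z] is higher than [x], generation 0 contains only [x]
    itself, which is not [z]. *)
Definition in_subtree x z := z \in desc (depth z - depth x) x.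

Lemma desc_in_subtree j x z : verts T x -> z \in desc j x -> in_subtree x z.
Proof.
by move=> vx zj; have [_ dz _] := (descP _ _ vx).1 zj; rewrite /in_subtree dz addKn.
Qed.

Lemma in_subtree_depth x z : verts T x -> in_subtree x z -> (depth x <= depth z)%N.
Proof. by move=> vx /(descP _ _ vx)[_ -> _]; rewrite leq_addr. Qed.

Lemma in_subtree_adj x z z' : verts T x -> in_subtree x z -> adj T z z' ->
  in_subtree x z' \/ [/\ z = x, x != o & z' = parent x].
Proof.
move=> vx xz zz'; have dxz := in_subtree_depth vx xz; move: xz.
case: (adj_cases zz') => [[zo ->]|[zo ->]]; rewrite /in_subtree.
  case dz: (depth z - depth x)%N => [|j].
    by rewrite /= inE => /eqP zx; right; rewrite -zx; split.
  by case/in_descS => vz _ pz; left; exact: (desc_in_subtree vx pz).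
move=> pz; left; apply: (@desc_in_subtree _.+1) => //; apply/in_descS; split=> //.
  by have [] := adj_verts zz'.
exact: pz.
Qed.

(** A walk can leave the subtree of [x] only through the edge from [x] to its parent, so it first
    climbs [depth z - depth x] steps and then visits both ends of that edge. *)
Lemma subtree_exit n x z v : verts T x -> in_subtree x z -> v \in tball n z ->
  ~~ in_subtree x v ->
  [/\ v \in tball n x, v \in tball n (parent x) & (depth z - depth x < n)%N].
Proof.
move=> vx; elim: n z => [|n IH] z xz.
  by rewrite /= inE => /eqP->; rewrite xz.
case/tballS=> [vz|[y zy vy]] xv.
  have [h1 h2 h3] := IH z xz vz xv.
  by split; [apply/tballS; left|apply/tballS; left|exact: leqW].
case: (in_subtree_adj vx xz zy) => [xy|[-> xo yx]].
  have [h1 h2 h3] := IH y xy vy xv.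
  split; [by apply/tballS; left|by apply/tballS; left|].
  by have := depth_adj (etrans (adjC _ _ _) zy); have := in_subtree_depth vx xz; lia.
rewrite subnn; split=> //; first by apply/tballS; right; exists y => //; rewrite yx; have [] := parentP vx xo.
by apply/tballS; left; rewrite -yx.
Qed.

Lemma desc_tball j x z : verts T x -> z \in desc j x -> z \in tball j x.
Proof.
move=> vx; elim: j z => [|j IH] z; first by [].
case/in_descS=> vz zo /IH pz; rewrite -addn1; apply: tball_trans pz _.
by apply: tball1; rewrite adjC; have [] := parentP vz zo.
Qed.

Lemma desc_trans i j x y z : verts T x -> y \in desc i x -> z \in desc j y ->
  z \in desc (i + j) x.
Proof.
move=> vx yi zj; have [vy dy iy] := (descP _ _ vx).1 yi.
have [vz dz iz] := (descP _ _ vy).1 zj; apply/descP => //; split=> //.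
  by rewrite dz dy addnA.
by rewrite iterD iz.
Qed.

Lemma iter_parent_desc i j x z : verts T x -> (i <= j)%N -> z \in desc j x ->
  iter i parent z \in desc (j - i) x.
Proof.
move=> vx ij /(descP _ _ vx)[vz dz iz]; apply/descP => //; split.
- exact: iter_parent_verts.
- by rewrite depth_iter// dz addnBA.
- by rewrite -iterD subnK.
Qed.

Lemma desc_iter_parent i j x z : verts T x -> (i <= j)%N -> z \in desc j x ->
  z \in desc i (iter i parent z).
Proof.
move=> vx ij /(descP _ _ vx)[vz dz iz]; apply/descP; first exact: iter_parent_verts.
split=> //; rewrite depth_iter// subnK// dz; lia.
Qed.

Lemma desc_depth z : verts T z -> z \in desc (depth z) o.
Proof.
move=> vz; apply/descP => //; split=> //; first by rewrite depth_root.
apply: depth_eq0; first exact: iter_parent_verts.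
by rewrite depth_iter// subnn.
Qed.

Lemma ex_desc j x : verts T x -> exists z, z \in desc j x.
Proof.
move=> vx; suff : (0 < #|` desc j x|)%N.
  by rewrite cardfs_gt0 => /fset0Pn.
have [->|xo] := eqVneq x o; last by rewrite card_desc// expn_gt0.
by apply: leq_trans (card_desc_root j); rewrite expn_gt0.
Qed.

Definition edge z : edges T := insubd e0 [fset z; parent z]%fset.

Lemma edgeE z : verts T z -> z != o -> val (edge z) = [fset z; parent z]%fset.
Proof. by move=> vz zo; rewrite insubdK//; have [] := parentP vz zo. Qed.

(** Two distinct vertices with the same edge would each be the parent of the other, which the depths
    forbid. *)
Lemma edge_inj z z' : verts T z -> z != o -> verts T z' -> z' != o ->
  edge z = edge z' -> z = z'.
Proof.
move=> vz zo vz' zo' /(congr1 val); rewrite !edgeE// => /fsetP h.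
have := h z; have := h z'; rewrite !inE !eqxx /=.
have [//|zz'] := eqVneq z z'.
move=> /= /eqP e1 /esym/eqP e2.
have [_ d1] := parentP vz zo; have [_ d2] := parentP vz' zo'.
by rewrite -e1 in d1; rewrite -e2 in d2; lia.
Qed.

End Root.
End Tree.

(** * Open clusters of the tree and their finite rooted subtrees *)

Section Reachable.
Variables (V : choiceType) (G : graph V).

Lemma reachable_refl x : reachable G x x.
Proof. by exists [::]. Qed.

Lemma reachable_trans x y z : reachable G x y -> reachable G y z -> reachable G x z.
Proof.
move=> [p [xp <-]] [q [pq <-]]; exists (p ++ q).
by rewrite cat_path xp pq last_cat.
Qed.

Lemma reachable_adj x y : adj G x y -> reachable G x y.
Proof. by move=> xy; exists [:: y]; rewrite /= xy. Qed.

Lemma reachable_sym x y : reachable G x y -> reachable G y x.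
Proof.
move=> [p [xp <-]]; elim: p x xp => [|z p IH] x /=; first by move=> _; exact: reachable_refl.
case/andP=> xz zp; apply: reachable_trans (IH _ zp) _.
by apply: reachable_adj; rewrite adjC.
Qed.

End Reachable.

Section Clusters.
Variables (V : choiceType) (T : graph V).
Hypothesis hT : regular_tree 4 T.
Variables (o : V) (e0 : edges T).
Hypothesis vo : verts T o.
Implicit Types (x y z v : V) (w : set (edges T)) (K : {fset V}).

Local Notation depth := (depth T o).
Local Notation parent := (parent T o).
Local Notation children := (children T o).
Local Notation desc := (desc T o).
Local Notation edge := (edge o e0).

(* [edge z] joins [z] to its parent; [edge o] is the junk value [e0]. *)
Definition upopen w j z := forall i, (i < j)%N -> w (edge (iter i parent z)).

Definition conn w z := upopen w (depth z) z.

Lemma upopen_iter w i j z : upopen w (i + j) z -> upopen w j (iter i parent z).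
Proof. by move=> h k kj; rewrite -iterD; apply: h; rewrite addnC ltn_add2l. Qed.

Lemma upopenD w i j z : upopen w i z -> upopen w j (iter i parent z) -> upopen w (i + j) z.
Proof.
move=> hi hj k kij; have [ki|ik] := ltnP k i; first exact: hi.
by rewrite -(subnK ik) iterD; apply: hj; rewrite ltn_subLR.
Qed.

Lemma upopen_sub w w' j z : w `<=` w' -> upopen w j z -> upopen w' j z.
Proof. by move=> ww' h i /h; exact: ww'. Qed.

Lemma open_graph_adj w x y : verts T x -> x != o -> y = parent x -> w (edge x) ->
  adj (open_graph w) x y.
Proof.
move=> vx xo -> wx; rewrite /adj inE; exists (edge x) => //.
by rewrite edgeE.
Qed.

Lemma open_graph_adjP w x y : adj (open_graph w) x y ->
  [/\ verts T x, x != o, y = parent x & w (edge x)] \/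
  [/\ verts T y, y != o, x = parent y & w (edge y)].
Proof.
rewrite /adj inE => -[e we ee].
have axy : adj T x y by rewrite /adj -ee inE; exact: set_valP.
have [vx vy] := adj_verts axy.
case: (adj_cases hT vo axy) => -[zo pz]; [left|right]; split=> //.
- by rewrite (_ : edge x = e)//; apply: val_inj; rewrite (edgeE hT)// -pz ee.
- by rewrite (_ : edge y = e)//; apply: val_inj; rewrite (edgeE hT)// -pz ee fsetUC.
Qed.

Lemma conn_parent w z : verts T z -> z != o -> conn w z <-> conn w (parent z) /\ w (edge z).
Proof.
move=> vz zo; have [_ dz] := parentP hT vo vz zo; rewrite /conn dz; split.
  move=> h; split; last exact: (h 0%N).
  by apply: (@upopen_iter w 1 (depth (parent z)) z).
by move=> [h wz]; apply: (@upopenD w 1 (depth (parent z)) z) => // -[].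
Qed.

Lemma conn_root w : conn w o.
Proof. by rewrite /conn depth_root. Qed.

(** In a tree the open cluster of the root consists of the vertices whose whole ancestral line is
    open. An open path is followed edge by edge, each step going to a parent or to a child;
    conversely one descends from the root by induction on depth. *)
Lemma reachable_conn w z : reachable (open_graph w) o z <-> verts T z /\ conn w z.
Proof.
split.
  move=> [p [+ <-]]; elim/last_ind: p => [_|p y IH].
    by split=> //; exact: conn_root.
  rewrite rcons_path last_rcons => /andP[/IH[vl cl]].
  case/open_graph_adjP => -[vx xo yx wx].
    by rewrite yx; split; [exact: parent_verts|have [] := (conn_parent w vx xo).1 cl].
  by split=> //; apply/conn_parent => //; rewrite -yx.
move=> [vz]; move: {2}(depth z) (erefl (depth z)) => n.
elim: n z vz => [|n IH] z vz dz; first by rewrite (depth_eq0 hT vo vz dz) => _; exact: reachable_refl.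
have zo : z != o by apply/eqP => zo; move: dz; rewrite zo depth_root.
move=> /(conn_parent w vz zo)[cp wz].
apply: reachable_trans (IH (parent z) _ _ cp) _; first exact: parent_verts.
  by rewrite depth_parent// dz.
by apply/reachable_adj; rewrite adjC; exact: open_graph_adj.
Qed.

(** Ancestors of connected vertices are connected, so a cluster missing generation [n] stays inside
    a finite ball. A finite cluster has bounded depth. *)
Lemma infinite_clusterP w : infinite_set (verts (open_cluster w o)) <->
  forall n, exists2 z, z \in desc n o & conn w z.
Proof.
have clE z : verts (open_cluster w o) z <-> verts T z /\ conn w z.
  by split=> [[_ /reachable_conn]//|h]; split=> //; [exact: h.1|exact/reachable_conn].
split.
  move=> inf n; apply: contrapT => nz; apply: inf.
  apply: (@sub_finite_set _ _ [set` tball T n o]); last exact: finite_fset.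
  move=> z /clE[vz cz] /=; have [zn|nz'] := leqP (depth z) n.
    by apply: (tball_le hT zn); exact: (depth_ball hT vo vz).
  case: nz; exists (iter (depth z - n) parent z).
    have := @iter_parent_desc _ _ hT _ vo (depth z - n) _ _ _ vo (leq_subr n _)
      (desc_depth hT vo vz).
    by rewrite subKn// ltnW.
  rewrite /conn depth_iter// subKn 1?ltnW//.
  by apply: upopen_iter; rewrite subnK 1?ltnW.
move=> h fin; have [X eX] := finite_fsetP.1 fin.
have [z zd cz] := h (\max_(x <- X) depth x).+1%N.
have [vz dz _] := (descP hT vo _ _ vo).1 zd; rewrite depth_root// add0n in dz.
have zX : z \in X by have /clE : verts T z /\ conn w z by []; rewrite eX.
have := @leq_bigmax_seq _ (enum_fset X) xpredT depth z zX isT.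
by rewrite dz ltnn.
Qed.

(** In a tree, the finite connected subgraphs through [o] are exactly the finite sets closed under
    open parent edges. *)
Definition rooted_tree w K := o \in K /\
  forall z, z \in K -> verts T z /\ (z != o -> parent z \in K /\ w (edge z)).

(** Every open boundary edge of a rooted subtree leads downwards and is recorded by its lower
    end. *)
Definition bdry w K : {fset V} :=
  [fset z in \bigcup_(x <- K) children x | (z \notin K) && `[< w (edge z) >]]%fset.

Lemma in_bdry w K z : verts T z ->
  z \in bdry w K <-> [/\ z != o, parent z \in K, z \notin K & w (edge z)].
Proof.
move=> vz; rewrite !inE /=; split.
  case/and3P=> /bigfcupP[x /andP[xK _]]; rewrite in_children//.
  by move=> /andP[zo /eqP zx] zK /asboolP wz; rewrite zx; split.
case=> zo pz zK wz; apply/and3P; split=> //; last exact/asboolP.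
by apply/bigfcupP; exists (parent z); rewrite ?pz// in_children// zo eqxx.
Qed.

Lemma bdry_verts w K z : z \in bdry w K -> verts T z.
Proof.
rewrite !inE /= => /and3P[/bigfcupP[x _ zx] _ _]; exact: (children_verts hT zx).
Qed.

(** Anchored expansion at [o] with constant [1 / M], tested only on sets within distance [D], which
    makes it an event of finitely many edges. *)
Definition expanding (M D : nat) w := forall K, rooted_tree w K ->
  {subset K <= tball T D o} -> (#|` K| <= M * #|` bdry w K|)%N.

Lemma rooted_tree_conn w K z : rooted_tree w K -> z \in K -> conn w z.
Proof.
move=> [_ tK]; move: {2}(depth z) (erefl (depth z)) => n.
elim: n z => [|n IH] z dz zK; first by rewrite /conn dz.
have [vz h] := tK z zK.
have zo : z != o by apply/eqP => zo; move: dz; rewrite zo depth_root.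
have [pK wz] := h zo; apply/conn_parent => //; split=> //.
by apply: IH => //; rewrite depth_parent// dz.
Qed.

(** Here [o] is the base vertex provided by anchored expansion in the cluster of [o']. Each rooted
    subtree is an admissible set for the infimum, and its boundary edges are among those recorded by
    [bdry]. *)
Lemma anchored_expanding (R : realType) w o' :
  verts (open_cluster w o') o ->
  0 < inf [set r : R | exists K, [/\ o \in K, [set` K] `<=` verts (open_cluster w o'),
          connected_graph (Defs.induced (open_cluster w o') [set` K]) &
          r = #|` fset_set (edge_boundary (open_cluster w o') K)|%:R / #|` K|%:R]] ->
  exists M, forall D, expanding M D w.
Proof.
move=> [_ oo'] /=; set G := open_cluster w o'; set S := [set r | _] => infS.
(* Any integer at least the inverse of the infimum will do for [M]. *)
pose c := inf S; exists (Num.truncn c^-1).+1 => D K tK _.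
have [oK hK] := tK.
have KG : [set` K] `<=` verts G.
  move=> z /= zK; have [vz _] := hK z zK; split=> //.
  apply: reachable_trans oo' _; apply/reachable_conn; split=> //.
  exact: rooted_tree_conn tK zK.
have connK : connected_graph (Defs.induced G [set` K]).
  split; first by exists o; split=> //; exact: KG.
  have toroot n z : depth z = n -> z \in K -> reachable (Defs.induced G [set` K]) o z.
    elim: n z => [|n IH] z dz zK; have [vz hz] := hK z zK.
      by rewrite (depth_eq0 hT vo vz dz); exact: reachable_refl.
    have zo : z != o by apply/eqP => zo; move: dz; rewrite zo depth_root.
    have [pK wz] := hz zo.
    apply: reachable_trans (IH (parent z) _ pK) _; first by rewrite depth_parent// dz.
    apply: reachable_adj; rewrite adjC /adj inE.
    have sub (A : set V) : [set` K] `<=` A -> [set` [fset z; parent z]%fset] `<=` A.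
      by move=> KA x /=; rewrite !inE => /orP[]/eqP->; exact: KA.
    split; last exact: sub.
    split; last by apply: sub => x /KG[].
    by exists (edge z) => //; rewrite edgeE.
  move=> x y [_ xK] [_ yK]; apply: reachable_trans (toroot _ _ erefl yK).
  by apply: reachable_sym; exact: toroot xK.
have bdK : edge_boundary G K `<=` [set` [fset [fset z; parent z]%fset | z in bdry w K]%fset].
  move=> e [Ge [x [y [ee xK vy yK]]]] /=.
  have axy : adj (open_graph w) x y by rewrite /adj -ee inE; case: Ge.
  have [vx hx] := hK x xK.
  case: (open_graph_adjP axy) => -[vz zo pz wz].
    by have [] := hx zo; rewrite -pz (negPf yK).
  apply/imfsetP; exists y => /=; last by rewrite ee -pz fsetUC.
  by apply/in_bdry => //; split=> //; rewrite -pz.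
have card_bd : (#|` fset_set (edge_boundary G K)| <= #|` bdry w K|)%N.
  apply: (@leq_trans #|` [fset [fset z; parent z]%fset | z in bdry w K]%fset|);
    last exact: leq_imfset_card.
  apply: fsubset_leq_card; apply/fsubsetP => e.
  rewrite in_fset_set; last by apply: sub_finite_set bdK _; exact: finite_fset.
  by rewrite inE => /bdK.
have Kpos : (0 < #|` K|)%N by rewrite cardfs_gt0; apply/fset0Pn; exists o.
have cK : c <= #|` fset_set (edge_boundary G K)|%:R / #|` K|%:R.
  apply: ge_inf; last by exists K.
  by exists 0 => r [K' [_ _ _ ->]]; rewrite divr_ge0.
rewrite -(ler_nat R) natrM.
rewrite ler_pdivlMr ?ltr0n// in cK.
have cM : c^-1 <= (Num.truncn c^-1).+1%:R by apply/ltW/truncnS_gt.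
have Kc : #|` K|%:R <= c^-1 * #|` fset_set (edge_boundary G K)|%:R.
  by rewrite mulrC ler_pdivlMr// mulrC.
apply: (le_trans Kc); apply: ler_pM => //; first by rewrite invr_ge0 ltW.
by rewrite ler_nat.
Qed.

End Clusters.

(** * Independent bits *)

Section FairBits.
Context {R : realType}.
Local Notation P := (@uniform_prob R 0 1 ltr01).

Definition dyadic (N j : nat) : set R :=
  [set` `[j%:R / 2 ^+ N, j.+1%:R / 2 ^+ N[].

Lemma prob_dyadic N j : (j < 2 ^ N)%N -> prob P (dyadic N j) = 2 ^- N.
Proof.
move=> jN.
transitivity (fine (\int[lebesgue_measure]_(x in dyadic N j) (uniform_pdf 0 1 x)%:E)) => //.
rewrite integral_uniform_pdf setIidl; last first.
  move=> x; rewrite /dyadic /= !in_itv /= => /andP[jx xj]; apply/andP; split.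
    by apply: le_trans jx; rewrite divr_ge0// exprn_ge0.
  apply: (le_trans (ltW xj)).
  by rewrite ler_pdivrMr ?exprn_gt0// mul1r -natrX ler_nat.
rewrite (eq_integral (fun=> 1%E)).
  rewrite integral_cst//=; last exact: measurable_itv.
  rewrite mul1e lebesgue_measure_itv/= lte_fin ltr_pM2r ?invr_gt0 ?exprn_gt0//.
  rewrite ltr_nat leqnn -EFinB /= -mulrBl -(natrB _ (leqnSn j)) subSnn div1r//.
move=> x; rewrite inE /dyadic /= in_itv /= => /andP[jx xj]; rewrite /uniform_pdf subr0 invr1.
rewrite ifT//; apply/andP; split.
  by apply: le_trans jx; rewrite divr_ge0// exprn_ge0.
apply: (le_trans (ltW xj)).
by rewrite ler_pdivrMr ?exprn_gt0// mul1r -natrX ler_nat.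
Qed.

Lemma dyadic_floor N j (x : R) : dyadic N j x <-> 0 <= x /\ Num.truncn (x * 2 ^+ N) = j.
Proof.
have pos : (0 : R) < 2 ^+ N by rewrite exprn_gt0.
rewrite /dyadic /= in_itv /= ler_pdivrMr// ltr_pdivlMr//; split.
  move=> /andP[jx xj]; have x0 : 0 <= x.
    by rewrite -(pmulr_lge0 _ pos); apply: le_trans jx.
  by split=> //; apply/eqP; rewrite truncn_eq ?jx//; rewrite mulr_ge0// ltW.
by move=> [x0 /eqP]; rewrite truncn_eq//; rewrite mulr_ge0// ltW.
Qed.

(** The event that binary digit number [n + 1] of a uniform point of [[0, 1)] is one. *)
Definition digit (n : nat) : set R :=
  [set x | 0 <= x < 1 /\ odd (Num.truncn (x * 2 ^+ n.+1))].

(** Selects the dyadic intervals of level [N] on which all digits indexed by [F] below [N] are one: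
    digit [n] of [j / 2 ^ N] is the parity of [j %/ 2 ^ (N - n.+1)]. *)
Let good N (F : {fset nat}) j := all (fun n => (n < N)%N ==> odd (j %/ 2 ^ (N - n.+1))) F.

Let truncn_half (x : R) k : 0 <= x -> Num.truncn (x / 2 ^+ k) = (Num.truncn x %/ 2 ^ k)%N.
Proof.
move=> x0; have pos : (0 : R) < 2 ^+ k by rewrite exprn_gt0.
apply/eqP; rewrite truncn_eq; last by rewrite divr_ge0// ltW.
rewrite ler_pdivlMr// ltr_pdivrMr// -natrX -!natrM; apply/andP; split.
  by rewrite -(truncn_ge_nat _ x0) leq_divM.
by rewrite -(truncn_lt_nat _ x0) -ltn_divLR ?expn_gt0.
Qed.

Let digits_dyadic N (F : {fset nat}) : (forall n, n \in F -> (n < N)%N) ->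
  \bigcap_(n in [set` F]) digit n `&` [set x | 0 <= x < 1] =
  \big[setU/set0]_(j < 2 ^ N | good N F j) dyadic N j.
Proof.
move=> FN; have pos k : (0 : R) < 2 ^+ k by rewrite exprn_gt0.
have dig (x : R) n : (n < N)%N -> 0 <= x ->
    Num.truncn (x * 2 ^+ n.+1) = (Num.truncn (x * 2 ^+ N) %/ 2 ^ (N - n.+1))%N.
  move=> nN x0; rewrite -truncn_half; last by rewrite mulr_ge0// ltW.
  have -> : (2 : R) ^+ N = 2 ^+ n.+1 * 2 ^+ (N - n.+1) by rewrite -exprD subnKC.
  by rewrite mulrA mulfK// gt_eqF.
apply/seteqP; split=> x.
  move=> [dx /= /andP[x0 x1]].
  have jN : (Num.truncn (x * 2 ^+ N) < 2 ^ N)%N.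
    by rewrite truncn_lt_nat; [rewrite natrX gtr_pMl|rewrite mulr_ge0// ltW].
  rewrite -(big_mkord (good N F) (dyadic N)) -bigcup_seq_cond; exists (Num.truncn (x * 2 ^+ N)) => /=.
    rewrite mem_index_iota jN /=; apply/allP => n nF; apply/implyP => nN.
    by rewrite -dig//; have [] := dx n nF.
  exact/dyadic_floor.
rewrite -(big_mkord (good N F) (dyadic N)) -bigcup_seq_cond => -[j /=].
rewrite mem_index_iota /= => /andP[jN gj] /dyadic_floor[x0 xj].
have x01 : 0 <= x < 1.
  rewrite x0 /=; have : x * 2 ^+ N < 2 ^+ N.
    have p0 : 0 <= x * 2 ^+ N by rewrite mulr_ge0// ltW.
    by rewrite -[X in _ < X]natrX -truncn_lt_nat// xj.
  by rewrite gtr_pMl.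
split=> // n nF; split=> //; have nN := FN n nF; rewrite dig// xj.
by have /allP/(_ n nF) := gj; rewrite nN.
Qed.

Let sum_double m (f : nat -> nat) :
  (\sum_(j < 2 * m) f j = \sum_(j < m) (f (2 * j) + f (2 * j).+1))%N.
Proof.
elim: m => [|m IH]; first by rewrite muln0 !big_ord0.
by rewrite mulnS addnC addn2 !big_ord_recr /= IH addnA.
Qed.

(** Passing to the next level splits the index [j] into [2 * j] and [2 * j + 1], which differ in the
    new digit. Both remain good if that digit is unconstrained, only the odd one otherwise. *)
Let card_good N F : (\sum_(j < 2 ^ N) good N F j = \prod_(n < N) (if nat_of_ord n \in F then 1 else 2))%N.
Proof.
elim: N => [|N IH].
  rewrite expn0 big_ord_recl !big_ord0 addn0 (_ : good _ _ _ = true)//.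
  by apply/allP => n _.
rewrite expnS (sum_double _ (fun j => good N.+1 F j)) [RHS]big_ord_recr /= -IH big_distrl /=; apply: eq_bigr => j _.
have half b : (b < 2)%N -> good N.+1 F (2 * j + b) = good N F j && ((N \in F) ==> (b == 1%N)).
  move=> b2; have hb n : (n < N)%N -> ((2 * j + b) %/ 2 ^ (N.+1 - n.+1) = j %/ 2 ^ (N - n.+1))%N.
    move=> nN; rewrite subSS -[in LHS](subnSK nN) expnS divnMA mulnC divnMDl//.
    by rewrite (divn_small b2) addn0.
  have oddb : odd (2 * j + b) = (b == 1%N).
    by rewrite oddD mul2n odd_double /=; case: b b2 {hb} => [|[|]].
  apply/allP/andP.
    move=> h; split.
      apply/allP => n nF; apply/implyP => nN.
      by have := h n nF; rewrite ltnS (ltnW nN) /= hb.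
    apply/implyP => NF; have := h N NF; rewrite ltnSn /= subnn expn0 divn1.
    by rewrite oddb.
  move=> [/allP h /implyP hN] n nF; apply/implyP; rewrite ltnS leq_eqVlt.
  case/orP=> [/eqP nN|nN]; last by rewrite hb//; have := h n nF; rewrite nN.
  by rewrite nN subnn expn0 divn1 oddb; apply: hN; rewrite -nN.
have h0 := half 0%N isT; have h1 := half 1%N isT; rewrite addn0 in h0; rewrite addn1 in h1.
rewrite h0 h1 /=.
by case: (good N F j); case: (N \in F).
Qed.

Lemma measurable_digit n : measurable (digit n).
Proof.
have := @digits_dyadic n.+1 [fset n]%fset; rewrite bigcap_fset big_seq_fset1.
rewrite setIidl; last by move=> x [].
move=> ->; last by move=> k; rewrite inE => /eqP->.
by apply: bigsetU_measurable => i _; exact: measurable_itv.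
Qed.

Lemma prob_digits (F : {fset nat}) :
  prob P (\bigcap_(n in [set` F]) digit n) = 2 ^- #|` F|.
Proof.
pose N := (\max_(n <- F) n).+1%N.
have FN n : n \in F -> (n < N)%N.
  by move=> nF; rewrite ltnS (@leq_bigmax_seq _ (enum_fset F) xpredT id).
have m01 : measurable [set x : R | 0 <= x < 1].
  rewrite (_ : mkset _ = [set` `[0, 1[]); first exact: measurable_itv.
  by apply/seteqP; split=> x /=; rewrite in_itv.
have p01 : prob P [set x : R | 0 <= x < 1] = 1.
  have := @prob_dyadic 0 0 isT; rewrite expr0 invr1; apply: etrans; congr prob.
  by apply/seteqP; split=> x; rewrite /dyadic /= in_itv /= expr0 !divr1.
have mF : measurable (\bigcap_(n in [set` F]) digit n).
  rewrite bigcap_fset; apply: big_ind => // [A B|n _]; first exact: measurableI.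
  exact: measurable_digit.
(* For empty [F] the intersection is the whole line, so it is first cut down to the unit interval,
   which has probability one. *)
have -> : prob P (\bigcap_(n in [set` F]) digit n) =
    prob P (\bigcap_(n in [set` F]) digit n `&` [set x | 0 <= x < 1]).
  apply/eqP; rewrite eq_le; apply/andP; split; last first.
    by apply: prob_le => //; first exact: measurableI.
  rewrite -[X in prob P X <= _]setIT -(setUv [set x : R | 0 <= x < 1]) setIUr.
  rewrite probU; last 3 first.
  - exact: measurableI.
  - by apply: measurableI => //; exact: measurableC.
  - by apply/seteqP; split=> t // [[_ ?] []].
  rewrite gerDl.
  apply: (@le_trans _ _ (prob P (~` [set x : R | 0 <= x < 1]))); last first.
    by rewrite probC// p01 subrr.
  by apply: prob_le => //; [apply: measurableI => //; exact: measurableC|exact: measurableC].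
rewrite (digits_dyadic FN).
have : forall S : {set 'I_(2 ^ N)},
    measurable (\big[setU/set0]_(j in S) dyadic N j) /\
    prob P (\big[setU/set0]_(j in S) dyadic N j) = #|S|%:R * 2 ^- N.
  move=> S; split.
    by apply: bigsetU_measurable => i _; exact: measurable_itv.
  apply: EFin_inj; rewrite -probE; last first.
    by apply: bigsetU_measurable => i _; exact: measurable_itv.
  rewrite measure_bigsetU_ord_cond//=.
  - rewrite (eq_bigr (fun=> (2 ^- N)%:E)).
      by rewrite sumEFin big_const iter_addr_0 mulr_natl.
    by move=> j _; rewrite (@probE _ _ _ P) ?prob_dyadic//; exact: measurable_itv.
  - by move=> j _; exact: measurable_itv.
  - move=> i j _ _ [x [/dyadic_floor[_ xi] /dyadic_floor[_ xj]]].
    by apply/val_inj; rewrite /= -xi xj.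
move=> /(_ [set j | good N F (nat_of_ord j)]%SET)[_].
rewrite (eq_bigl (fun j : 'I_(2 ^ N) => good N F j)); last by move=> j; rewrite inE.
move=> ->; rewrite -sum1_card big_mkcond /=.
rewrite (eq_bigr (fun j : 'I_(2 ^ N) => good N F j : nat)); last first.
  by move=> j _; rewrite inE; case: (good _ _ _).
rewrite card_good natr_prod.
have cF : (\sum_(n < N | nat_of_ord n \in F) 1 = #|` F|)%N.
  have -> : #|` F| = size [seq n <- iota 0 N | n \in F].
    apply/perm_size/uniq_perm; [exact: fset_uniq|by rewrite filter_uniq// iota_uniq|].
    move=> n; rewrite mem_filter mem_iota add0n /=; apply/idP/andP => [nF|[]//].
    by split=> //; exact: FN.
  by rewrite size_filter -sum1_count -(big_mkord (fun n => n \in F) (fun=> 1%N)) /index_iota subn0.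
rewrite -cF -!exprVn -prodrXr [in RHS]big_mkcond /=.
have -> : 2^-1 ^+ N = \prod_(n < N) (2^-1 : R).
  by rewrite big_const card_ord iter_mulr_1.
rewrite -big_split /=; apply: eq_bigr => n _.
by case: ifP => _; rewrite ?mul1r ?expr1// divff.
Qed.

End FairBits.

(** Each bit is the conjunction of [lam] private binary digits of one uniform variable, allotted
    through an injective numbering. This is why the probabilities of holes are chosen as powers of
    one half. *)
Lemma exists_bits (R : realType) (lam : nat -> nat) :
  exists d (Om : measurableType d) (P : probability Om R) (B : nat * nat -> set Om),
    (forall i, measurable (B i)) /\
    forall F : {fset nat * nat},
      prob P (\bigcap_(i in [set` F]) B i) = \prod_(i <- F) 2 ^- (lam i.1).
Proof.
pose c (i : nat * nat) (j : nat) : nat := choice.pickle (i, j).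
have c_inj i j i' j' : c i j = c i' j' -> i = i' /\ j = j'.
  by move=> /(pcan_inj (@choice.pickleK _))[-> ->].
pose D (i : nat * nat) : {fset nat} := [fset c i j | j in iota 0 (lam i.1)]%fset.
pose B (i : nat * nat) : set R := \bigcap_(n in [set` D i]) digit n.
exists _, _, (@uniform_prob R 0 1 ltr01), B; split.
  move=> i; rewrite /B bigcap_fset; apply: big_ind => // [A A'|n _].
    exact: measurableI.
  exact: measurable_digit.
move=> F; have -> : \bigcap_(i in [set` F]) B i =
    \bigcap_(n in [set` (\bigcup_(i <- F) D i)%fset]) digit n.
  apply/seteqP; split=> x h.
    by move=> n /= /bigfcupP[i /andP[iF _] nD]; exact: (h i iF n nD).
  by move=> i iF n nD; apply: h; apply/bigfcupP; exists i; rewrite ?iF.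
rewrite prob_digits card_bigfcup ?fset_uniq//; last first.
  move=> i j n /imfsetP[k _ ->] /imfsetP[k' _ /c_inj[]].
  by [].
rewrite -exprVn -prodrXr; apply: eq_bigr => i _; rewrite exprVn; congr (_ ^- _).
rewrite card_imfset; last by move=> j j' /c_inj[].
by rewrite /= undup_id ?iota_uniq// size_iota.
Qed.

(** * The law of the holes and its invariance under automorphisms *)

Section Holes.
Variables (V : choiceType) (T : graph V).
Hypothesis hT : regular_tree 4 T.
Variables (code : V -> nat) (Rad : nat -> nat).
Hypothesis code_inj : forall x y, verts T x -> verts T y -> code x = code y -> x = y.
Implicit Types (x y v : V) (k N : nat).

(** For positive [Rad k] the predecessor keeps the distance [Rad k] itself in the annulus: both ends
    of [e] are at distance between [Rad k] and [2 * Rad k] from [v]. *)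
Definition hit k v (e : {fset V}) := forall x, x \in e ->
  x \in tball T (2 * Rad k) v /\ x \notin tball T (Rad k).-1 v.

(* The bit of scale [k] at [v], when on, closes a whole annulus around [v]. *)
Definition holes (D : set nat) (b : nat * nat -> Prop) : set (edges T) :=
  [set e | forall k v, D k -> verts T v -> hit k v (val e) -> ~ b (k, code v)].

Lemma edge_ends (e : edges T) : exists x y, adj T x y /\ val e = [fset x; y]%fset.
Proof.
have [card2 _] := edgesP (set_valP e).
have /fset0Pn[x xe] : val e != fset0 by rewrite -cardfs_gt0 card2.
have := cardfsD1 x (val e); rewrite xe card2 => -[/esym/eqP/cardfs1P[y ey]].
have exy : val e = [fset x; y]%fset by rewrite -(fsetD1K xe) ey.
by exists x, y; split=> //; rewrite /adj -exy inE; exact: set_valP.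
Qed.

Definition hitset k (F : {fset edges T}) : {fset V} :=
  fset_set [set v | verts T v /\ exists2 e, e \in F & hit k v (val e)].

Lemma in_hitset k F v :
  v \in hitset k F <-> verts T v /\ exists2 e, e \in F & hit k v (val e).
Proof.
rewrite in_fset_set ?inE//.
pose X := (\bigcup_(e <- F) \bigcup_(x <- val e) tball T (2 * Rad k) x)%fset.
apply: (@sub_finite_set _ _ [set` X]); last exact: finite_fset.
move=> u [_ [e eF hu]] /=; apply/bigfcupP; exists e; first by rewrite eF.
have [x [y [_ exy]]] := edge_ends e; have xe : x \in val e by rewrite exy !inE eqxx.
apply/bigfcupP; exists x; first by rewrite xe.
by apply: (tball_sym hT); have [] := hu x xe.
Qed.

Definition hitcoords N (F : {fset edges T}) : {fset nat * nat} :=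
  (\bigcup_(k <- iota 0 N) [fset (k, code v) | v in hitset k F])%fset.

Lemma in_hitcoords N F i : i \in hitcoords N F <->
  exists k v, [/\ (k < N)%N, v \in hitset k F & i = (k, code v)].
Proof.
split.
  case/bigfcupP=> k; rewrite mem_iota andbT /= => kN /imfsetP[v /= vk ->].
  by exists k, v.
move=> [k [v [kN vk ->]]]; apply/bigfcupP; exists k; first by rewrite mem_iota kN.
by apply/imfsetP; exists v.
Qed.

Lemma holes_hitcoords N (F : {fset edges T}) (b : nat * nat -> Prop) :
  (forall e, e \in F -> holes `I_N b e) <-> forall i, i \in hitcoords N F -> ~ b i.
Proof.
split.
  move=> h i /in_hitcoords[k [v [kN /in_hitset[vv [e eF hv]] ->]]].
  exact: h eF k v kN vv hv.
move=> h e eF k v kN vv hv; apply: h; apply/in_hitcoords; exists k, v; split=> //.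
by apply/in_hitset; split=> //; exists e.
Qed.

(** Injectivity of [code] makes the coordinates of scale [k] as numerous as the vertices in
    [hitset k F]. The law of the holes thus sees [F] only through these cardinals, and this yields
    its invariance. *)
Lemma prod_hitcoords (R : realType) (th : nat -> R) N F :
  \prod_(i <- hitcoords N F) th i.1 = \prod_(k < N) th k ^+ #|` hitset k F|.
Proof.
elim: N => [|N IH].
  rewrite big_ord0 (_ : hitcoords 0 F = fset0) ?big_seq_fset0//.
  by rewrite /hitcoords /= big_nil.
have -> : hitcoords N.+1 F =
    (hitcoords N F `|` [fset (N, code v) | v in hitset N F])%fset.
  by rewrite /hitcoords -addn1 iotaD big_cat big_seq1.
rewrite big_fsetU_disjoint /=; last first.
  apply/fdisjointP => i /in_hitcoords[k [v [kN _ ->]]]; apply/negP => /imfsetP[u _ [kE _]].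
  by rewrite kE ltnn in kN.
rewrite IH big_ord_recr /=; congr (_ * _).
rewrite big_seq (eq_bigr (fun=> th N)); last by move=> i /imfsetP[v _ ->].
rewrite -big_seq big_const_seq count_predT iter_mulr_1; congr (_ ^+ _).
rewrite card_in_imfset// => x y /in_hitset[vx _] /in_hitset[vy _] [].
exact: code_inj.
Qed.

Lemma holesT (b : nat * nat -> Prop) e :
  holes setT b e <-> forall N, holes `I_N b e.
Proof.
split; first by move=> h N k v _; exact: h.
by move=> h k v _; apply: (h k.+1); exact: ltnSn.
Qed.

Lemma holes_le N M b : (N <= M)%N -> holes `I_M b `<=` holes `I_N b.
Proof. by move=> NM e h k v kN; apply: h; exact: leq_trans kN NM. Qed.

Section Automorphism.
Variable f : V -> V.
Hypothesis hf : automorphism T f.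

Lemma automorphism_verts x : verts T x -> verts T (f x).
Proof. by have [[fun_f _ _] _] := hf; exact: fun_f. Qed.

Lemma automorphism_inj x y : verts T x -> verts T y -> f x = f y -> x = y.
Proof. by have [[_ inj _] _] := hf; move=> vx vy; apply: inj; rewrite inE. Qed.

Lemma automorphism_surj y : verts T y -> exists2 x, verts T x & f x = y.
Proof. by have [[_ _ surj] _] := hf; move=> /surj[x vx <-]; exists x. Qed.

Lemma automorphism_tball n x y : verts T x -> verts T y ->
  (f y \in tball T n (f x)) = (y \in tball T n x).
Proof.
have [_ adjf] := hf.
elim: n x => [|n IH] x vx vy.
  rewrite /= !inE; apply/eqP/eqP => [|->//]; exact: automorphism_inj.
apply/idP/idP => /(tballS hT) h; apply/(tballS hT).
  case: h => [|[z' xz' yz']]; first by rewrite IH//; left.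
  have [_ vz'] := adj_verts xz'; have [z vz fz] := automorphism_surj vz'.
  right; exists z; first by rewrite -adjf// fz.
  by rewrite -IH// fz.
case: h => [|[z xz yz]]; first by left; rewrite IH.
by have [_ vz] := adj_verts xz; right; exists (f z); rewrite ?adjf ?IH.
Qed.

Lemma edge_pull (e : edges T) : exists a : edges T, val e = [fset f x | x in val a]%fset.
Proof.
have [_ adjf] := hf; have [x' [y' [xy' exy]]] := edge_ends e.
have [vx' vy'] := adj_verts xy'.
have [x vx fx] := automorphism_surj vx'; have [y vy fy] := automorphism_surj vy'.
have xy : [fset x; y]%fset \in edges T by move: xy'; rewrite -fx -fy adjf.
exists (Sub [fset x; y]%fset xy); rewrite exy SubK; apply/fsetP => z; rewrite !inE.
apply/idP/imfsetP => /= [|[u + ->]].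
  case/orP=> /eqP->; [exists x|exists y] => //=; by rewrite !inE eqxx ?orbT.
by rewrite !inE => /orP[]/eqP->; rewrite ?fx ?fy eqxx ?orbT.
Qed.

Lemma edge_verts (e : edges T) x : x \in val e -> verts T x.
Proof. by have [_ sub] := edgesP (set_valP e); exact: sub. Qed.

Lemma edge_image_inj (a a' : edges T) :
  [fset f x | x in val a]%fset = [fset f x | x in val a']%fset -> a = a'.
Proof.
move=> h; apply: val_inj; apply/fsetP => x; apply/idP/idP => xa.
  have : f x \in [fset f x | x in val a']%fset by rewrite -h; apply/imfsetP; exists x.
  case/imfsetP=> y /= ya fxy.
  by rewrite (automorphism_inj (edge_verts xa) (edge_verts ya) fxy).
have : f x \in [fset f x | x in val a]%fset by rewrite h; apply/imfsetP; exists x.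
case/imfsetP=> y /= ya fxy.
  by rewrite (automorphism_inj (edge_verts xa) (edge_verts ya) fxy).
Qed.

Lemma hit_automorphism k v (a e : edges T) : verts T v ->
  val e = [fset f x | x in val a]%fset -> hit k (f v) (val e) <-> hit k v (val a).
Proof.
move=> vv ->; split=> h x xa.
  have vx := edge_verts xa; rewrite -(automorphism_tball _ vv vx) -(automorphism_tball (Rad k).-1 vv vx).
  by apply: h; apply/imfsetP; exists x.
case/imfsetP: xa => y /= ya ->; have vy := edge_verts ya.
by rewrite !automorphism_tball//; exact: h.
Qed.

(** Codes are not preserved by [f], so invariance cannot be seen bit by bit. But [f] preserves
    distances, hence maps the hit set of the preimage of [F] bijectively onto the hit set of [F]. *)
Lemma ex_pull (F : {fset edges T}) : exists G : {fset edges T},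
  (forall w : set (edges T), (forall e, e \in F -> config_image f w e) <->
     forall a, a \in G -> w a) /\
  forall k, #|` hitset k G| = #|` hitset k F|.
Proof.
have /choice[pull pullE] := edge_pull.
have in_G a : a \in [fset pull e | e in F]%fset <-> exists2 e, e \in F & a = pull e.
  by split=> [/imfsetP[e eF ->]|[e eF ->]]; [exists e|apply/imfsetP; exists e].
exists [fset pull e | e in F]%fset; split=> [w|k].
  split=> h.
    move=> a /in_G[e eF ->]; have [a' wa' ea'] := h e eF.
    by rewrite (_ : pull e = a')//; apply: edge_image_inj; rewrite -pullE.
  move=> e eF; exists (pull e) => //; apply: h; apply/in_G; by exists e.
have -> : hitset k F = [fset f v | v in hitset k [fset pull e | e in F]%fset]%fset.
  apply/fsetP => v'; apply/idP/imfsetP => /=.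
    move=> /in_hitset[vv' [e eF hv]]; have [v vv fv] := automorphism_surj vv'.
    exists v => //; apply/in_hitset; split=> //; exists (pull e).
      by apply/in_G; exists e.
    by apply/(hit_automorphism k vv (pullE e)); rewrite fv.
  move=> [v /in_hitset[vv [a /in_G[e eF ->] hv]] ->]; apply/in_hitset.
  split; first exact: automorphism_verts.
  by exists e => //; apply/(hit_automorphism k vv (pullE e)).
rewrite card_in_imfset// => x y /in_hitset[vx _] /in_hitset[vy _].
exact: automorphism_inj.
Qed.

End Automorphism.

Lemma configs_cylinder (e : edges T) : measurable ([set w | w e] : set (configs T)).
Proof. by apply: sub_sigma_algebra; exists e. Qed.

Lemma configs_measurable_fun d (Om : measurableType d) (X : Om -> configs T) :
  (forall e, measurable [set t | (X t : set (edges T)) e]) -> measurable_fun setT X.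
Proof.
move=> mX; apply: (@measurability _ _ Om (configs T) setT X (@edge_cylinders V T)) => // _ [_ [e ->] <-].
by rewrite setTI; exact: mX.
Qed.

(* The events that all edges of a finite set are open form a generating
   pi-system. *)
Lemma configs_measure_unique (R : realType) (m1 m2 : probability (configs T) R) :
  (forall F : {fset edges T},
     m1 [set w : configs T | forall e, e \in F -> (w : set (edges T)) e] =
     m2 [set w : configs T | forall e, e \in F -> (w : set (edges T)) e]) ->
  forall A, measurable A -> m1 A = m2 A.
Proof.
move=> m12 A mA.
pose cyl (F : {fset edges T}) : set (configs T) :=
  [set w | forall e, e \in F -> (w : set (edges T)) e].
have mcyl F : measurable (cyl F).
  have -> : cyl F = \bigcap_(e in [set` F]) [set w : configs T | (w : set (edges T)) e].
    by apply/seteqP; split=> w h e; exact: h.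
  rewrite bigcap_fset; apply: big_ind => // [B C|e _]; first exact: measurableI.
  exact: configs_cylinder.
have cyl0 : cyl fset0 = setT by apply/seteqP; split=> w.
apply: (measure_unique [set cyl F | F in setT] (fun=> setT)) => //.
- apply/seteqP; split; last first.
    by apply: smallest_sub => [|_ [F _ <-]]; [exact: sigma_algebra_measurable|exact: mcyl].
  apply: smallest_sub; first exact: smallest_sigma_algebra.
  move=> _ [e ->]; apply: sub_sigma_algebra; exists [fset e]%fset => //.
  apply/seteqP; split=> w; first by apply; rewrite inE.
  by move=> we e'; rewrite inE => /eqP->.
- move=> _ _ [F _ <-] [G _ <-]; exists (F `|` G)%fset => //; apply/seteqP; split=> w.
    by move=> h; split=> e ?; apply: h; rewrite inE; apply/orP; [left|right].
  by move=> [h1 h2] e; rewrite inE => /orP[/h1|/h2].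
- by move=> _; exists fset0.
- by rewrite bigcup_const.
- by move=> _ [F _ <-]; exact: m12.
- move=> _; rewrite [X in (X < _)%E](_ : _ = 1%E) ?ltry//; exact: (@probability_setT _ _ _ m1).
Qed.

Section Law.
Context {R : realType} d {Om : measurableType d} (P : probability Om R).
Variables (B : nat * nat -> set Om) (th : nat -> R).
Hypothesis mB : forall i, measurable (B i).
Hypothesis indepB : forall F : {fset nat * nat},
  prob P (\bigcap_(i in [set` F]) B i) = \prod_(i <- F) th i.1.

Let bits u i := B i u.

Lemma measurable_holes_fset N (F : {fset edges T}) :
  measurable [set u | forall e, e \in F -> holes `I_N (bits u) e].
Proof.
have -> : [set u | forall e, e \in F -> holes `I_N (bits u) e] =
    \bigcap_(i in [set` hitcoords N F]) ~` B i.
  by apply/seteqP; split=> u /=; [move/holes_hitcoords|move=> h; apply/holes_hitcoords].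
rewrite bigcap_fset; apply: big_ind => // [A C|i _]; first exact: measurableI.
exact: measurableC.
Qed.

Let holesT_bigcap (F : {fset edges T}) :
  [set u | forall e, e \in F -> holes setT (bits u) e] =
  \bigcap_N [set u | forall e, e \in F -> holes `I_N (bits u) e].
Proof.
apply/seteqP; split=> u.
  by move=> h N _ e eF; have /holesT := h e eF; exact.
by move=> h e eF; apply/holesT => N; exact: h.
Qed.

Lemma measurable_holesT_fset (F : {fset edges T}) :
  measurable [set u | forall e, e \in F -> holes setT (bits u) e].
Proof.
by rewrite holesT_bigcap; apply: bigcapT_measurable => N; exact: measurable_holes_fset.
Qed.

Lemma measurable_holesT e : measurable [set u | holes setT (bits u) e].
Proof.
rewrite (_ : mkset _ = [set u | forall a, a \in [fset e]%fset -> holes setT (bits u) a]).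
  exact: measurable_holesT_fset.
apply/seteqP; split=> u; first by move=> h a; rewrite inE => /eqP->.
by apply; rewrite inE.
Qed.

(** With the scales below [N] the probability is the product of the powers of [1 - th k] with
    exponents the cardinals of the hit sets. The events decrease in [N], and continuity from above
    gives all scales. *)
Lemma prob_holesT (F G : {fset edges T}) :
  (forall k, #|` hitset k F| = #|` hitset k G|) ->
  P [set u | forall e, e \in F -> holes setT (bits u) e] =
  P [set u | forall e, e \in G -> holes setT (bits u) e].
Proof.
move=> FG; pose A (F : {fset edges T}) N :=
  [set u | forall e, e \in F -> holes `I_N (bits u) e].
have cvgA F0 : P \o A F0 @ \oo --> P [set u | forall e, e \in F0 -> holes setT (bits u) e].
  rewrite holesT_bigcap; apply: nonincreasing_cvg_mu.
  - by rewrite (le_lt_trans (probability_le1 _ _)) ?ltry//; exact: measurable_holes_fset.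
  - by move=> N; exact: measurable_holes_fset.
  - by rewrite -holesT_bigcap; exact: measurable_holesT_fset.
  - move=> N M NM; apply/subsetPset => u h e eF; apply: holes_le NM _ _.
    exact: h.
have PA F0 N : P (A F0 N) = (\prod_(k < N) (1 - th k) ^+ #|` hitset k F0|)%:E.
  rewrite probE; last exact: measurable_holes_fset.
  congr EFin; rewrite -(prod_hitcoords (fun k => 1 - th k)) -(indep_off mB indepB).
  by congr prob; apply/seteqP; split=> u /=; [move/holes_hitcoords|move=> h; apply/holes_hitcoords].
have AFG : P \o A F = P \o A G.
  by apply/funext => N /=; rewrite !PA; congr EFin; apply: eq_bigr => k _; rewrite FG.
have := cvgA F; rewrite AFG => hF.
exact: (cvg_unique (@ereal_hausdorff R) hF (cvgA G)).
Qed.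

Lemma exists_law : exists mu : probability (configs T) R, invariant_law mu /\
  forall A, measurable A -> mu A = P [set u | A (holes setT (bits u))].
Proof.
pose X u : configs T := holes setT (bits u).
have mX : measurable_fun setT X.
  by apply: configs_measurable_fun => e; exact: measurable_holesT.
pose X' : {RV P >-> configs T} := mfun_Sub (mem_set mX).
exists (distribution P X'); split=> // f hf A mA.
pose Y u : configs T := config_image f (X u).
have YF (F : {fset edges T}) : exists G : {fset edges T},
   (forall k, #|` hitset k G| = #|` hitset k F|) /\
   [set u | forall e, e \in F -> (Y u : set (edges T)) e] =
   [set u | forall e, e \in G -> holes setT (bits u) e].
  have [G [GE cG]] := ex_pull hf F; exists G; split=> //.
  by apply/seteqP; split=> u /=; [move/GE|move=> h; apply/GE].
have mY : measurable_fun setT Y.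
  apply: configs_measurable_fun => e; have [G [_ eG]] := YF [fset e]%fset.
  rewrite (_ : mkset _ = [set u | forall a, a \in [fset e]%fset -> (Y u : set (edges T)) a]).
    by rewrite eG; exact: measurable_holesT_fset.
  apply/seteqP; split=> u; first by move=> h a; rewrite inE => /eqP->.
  by apply; rewrite inE.
pose Y' : {RV P >-> configs T} := mfun_Sub (mem_set mY).
suff : distribution P Y' A = distribution P X' A by [].
apply: configs_measure_unique => // F; rewrite /distribution /pushforward /=.
have [G [cG eG]] := YF F.
transitivity (P [set u | forall e, e \in G -> holes setT (bits u) e]).
  by rewrite -eG.
by rewrite (prob_holesT cG).
Qed.

End Law.
End Holes.

(** * Moment bounds *)

Section Products.
Context {R : realType} (I : choiceType) (q : I -> R).
Hypothesis q01 : forall i, 0 <= q i <= 1.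
Implicit Types (A B : {fset I}).

Let q_ge0 i : 0 <= q i. Proof. by case/andP: (q01 i). Qed.
Let q_le1 i : q i <= 1. Proof. by case/andP: (q01 i). Qed.

Lemma prod_fset_ge0 A : 0 <= \prod_(i <- A) q i.
Proof. by apply: prodr_ge0 => i _. Qed.

Lemma prod_fset_le1 A : \prod_(i <- A) q i <= 1.
Proof. by rewrite big_seq; apply: prodr_ile1 => i _; rewrite q_ge0 q_le1. Qed.

Lemma prod_fset_sub A B : {subset A <= B} -> \prod_(i <- B) q i <= \prod_(i <- A) q i.
Proof.
move=> AB; have -> : B = (A `|` (B `\` A))%fset.
  apply/fsetP => i; rewrite !inE; case iA: (i \in A) => //=; exact: AB.
rewrite big_fsetU_disjoint /=; last first.
  by apply/fdisjointP => i iA; rewrite !inE iA.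
by rewrite ler_piMr ?prod_fset_ge0 ?prod_fset_le1.
Qed.

Lemma prod_fsetUI A B : \prod_(i <- (A `|` B)%fset) q i * \prod_(i <- (A `&` B)%fset) q i =
  \prod_(i <- A) q i * \prod_(i <- B) q i.
Proof.
have -> : (A `|` B = A `|` (B `\` A))%fset by rewrite fsetUDl fsetDv fsetD0.
rewrite big_fsetU_disjoint /=; last first.
  by apply/fdisjointP => i iA; rewrite !inE iA.
have BE : (B = (B `\` A) `|` (A `&` B))%fset.
  by apply/fsetP => i; rewrite !inE; case: (i \in A); case: (i \in B).
rewrite -mulrA [in RHS]BE big_fsetU_disjoint//.
by apply/fdisjointP => i; rewrite !inE => /andP[/negPf-> _].
Qed.

(** Factors of common indices, which are at most one, occur once on the right and twice on the
    left. *)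
Lemma prod_fsetU_ge A B : \prod_(i <- A) q i * \prod_(i <- B) q i <=
  \prod_(i <- (A `|` B)%fset) q i.
Proof. by rewrite -prod_fsetUI ler_piMr ?prod_fset_ge0 ?prod_fset_le1. Qed.

Lemma prod_bigfcup_ge (J : Type) (s : seq J) (F : J -> {fset I}) :
  \prod_(j <- s) \prod_(i <- F j) q i <= \prod_(i <- (\bigcup_(j <- s) F j)%fset) q i.
Proof.
elim: s => [|j s IH]; first by rewrite !big_nil.
rewrite !big_cons (le_trans _ (prod_fsetU_ge _ _))//.
by apply: ler_wpM2l IH; exact: prod_fset_ge0.
Qed.

Lemma weierstrass (s : seq I) : 1 - \sum_(i <- s) (1 - q i) <= \prod_(i <- s) q i.
Proof.
elim: s => [|i s IH]; first by rewrite !big_nil subr0.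
rewrite !big_cons; have h := ler_wpM2l (q_ge0 i) IH; apply: le_trans h.
have s0 : 0 <= \sum_(j <- s) (1 - q j).
  by apply: sumr_ge0 => j _; rewrite subr_ge0.
have := mulr_ge0 s0 (q_ge0 i); have := q_le1 i; have := q_ge0 i; nra.
Qed.

End Products.

(* Expand the square of Z - a on Z > 0, where Z is the sum of the indicator
   functions divided by their means and a = K n. *)
Lemma second_moment (R : realType) d (T : measurableType d) (P : probability T R)
    (J : choiceType) (s : seq J) (A : J -> set T) (K : R) :
  (forall j, measurable (A j)) -> (forall j, 0 < prob P (A j)) ->
  (0 < size s)%N -> 0 < K ->
  \sum_(i <- s) \sum_(j <- s) prob P (A i `&` A j) / (prob P (A i) * prob P (A j))
    <= K * (size s)%:R ^+ 2 ->
  K^-1 <= prob P [set t | exists2 j, j \in s & A j t].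
Proof.
move=> mA q0 s0 K0; set S := \sum_(i <- s) _ => SK.
set U := [set t | _]; pose n : R := (size s)%:R; pose q j := prob P (A j).
have n0 : 0 < n by rewrite ltr0n.
have mU : measurable U.
  rewrite (_ : U = \big[setU/set0]_(j <- s) A j); first exact: bigsetU_measurable.
  rewrite -bigcup_seq; apply/seteqP; split=> t [j js At]; by exists j.
pose a := K * n.
pose Bs (k : option (J + J * J)) : set T :=
  match k with None => U | Some (inl j) => A j | Some (inr ij) => A ij.1 `&` A ij.2 end.
pose c (k : option (J + J * J)) : R :=
  match k with None => a ^+ 2 | Some (inl j) => - (2 * a) / q j
  | Some (inr ij) => (q ij.1 * q ij.2)^-1 end.
pose l : seq (option (J + J * J)) := None :: [seq Some (inl j) | j <- s] ++
  [seq Some (inr (i, j)) | i <- s, j <- s].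
have sumE (f : set T -> R) : \sum_(k <- l) c k * f (Bs k) =
    a ^+ 2 * f U - 2 * a * (\sum_(j <- s) f (A j) / q j) +
    \sum_(i <- s) \sum_(j <- s) f (A i `&` A j) / (q i * q j).
  rewrite big_cons big_cat /= big_map big_allpairs_dep /= addrA; congr (_ + _ + _).
    by rewrite mulr_sumr -sumrN; apply: eq_bigr => j _; rewrite !mulNr -mulrA [(q j)^-1 * _]mulrC.
  by apply: eq_bigr => i _; apply: eq_bigr => j _; rewrite mulrC.
have comb : (forall t, 0 <= \sum_(k <- l) c k * \1_(Bs k) t) ->
    0 <= \sum_(k <- l) c k * prob P (Bs k).
  by apply: prob_combination => -[[j|[i j]]|] //=; exact: measurableI.
have {comb} : 0 <= \sum_(k <- l) c k * prob P (Bs k).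
  apply: comb => t; rewrite (sumE (fun B => \1_B t)).
  pose Z := \sum_(j <- s) \1_(A j) t / q j.
  have -> : \sum_(i <- s) \sum_(j <- s) \1_(A i `&` A j) t / (q i * q j) = Z ^+ 2.
    rewrite expr2 /Z big_distrl /=; apply: eq_bigr => i _.
    rewrite big_distrr /=; apply: eq_bigr => j _.
    by rewrite indicI /= invfM mulrACA.
  have [tU|tU] := pselect (U t).
    by rewrite (indicE _ U) mem_set// mulr1 -/Z; have := sqr_ge0 (Z - a); rewrite !expr2; lra.
  have Z0 : Z = 0.
    rewrite /Z big_seq big1// => j js; rewrite indicE memNset ?mul0r// => At.
    by apply: tU; exists j.
  by rewrite -/Z Z0 indicE memNset// !mulr0 expr2 mulr0 subr0 addr0.
rewrite (sumE (prob P)) -/S.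
have -> : \sum_(j <- s) prob P (A j) / q j = n.
  rewrite (eq_bigr (fun=> 1)); first by rewrite big_const_seq count_predT iter_addr_0.
  by move=> j _; rewrite divff// gt_eqF.
move=> h; rewrite -[K^-1]mul1r ler_pdivrMr//.
have : 0 <= K * n ^+ 2 * (K * prob P U - 1).
  apply: le_trans h _; move: SK; rewrite -/n /a expr2; lra.
by rewrite pmulr_rge0 ?mulr_gt0 ?exprn_gt0// subr_ge0 mulrC.
Qed.

(** The number of events that occur is at most [k] off the event in question and at most [size s] on
    it. Taking expectations gives the bound. *)
Lemma reverse_markov (R : realType) d (T : measurableType d) (P : probability T R)
    (J : choiceType) (s : seq J) (A : J -> set T) (a : R) (k : nat) :
  (forall j, measurable (A j)) -> {in s, forall j, a <= prob P (A j)} ->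
  measurable [set t | (k <= size [seq j <- s | `[< A j t >]])%N] ->
  a * (size s)%:R - k%:R <=
  (size s)%:R * prob P [set t | (k <= size [seq j <- s | `[< A j t >]])%N].
Proof.
move=> mA aA; set U := [set t | _] => mU; pose n : R := (size s)%:R.
pose Bs (j : option (option J)) : set T :=
  match j with None => U | Some None => setT | Some (Some j) => A j end.
pose c (j : option (option J)) : R :=
  match j with None => n | Some None => k%:R | Some (Some j) => - 1 end.
pose l : seq (option (option J)) := None :: Some None :: [seq Some (Some j) | j <- s].
have sumE (f : set T -> R) : \sum_(j <- l) c j * f (Bs j) =
    n * f U + k%:R * f setT - \sum_(j <- s) f (A j).
  rewrite !big_cons big_map /= addrA -sumrN; congr (_ + _).
  by apply: eq_bigr => j _; rewrite mulN1r.
have : 0 <= \sum_(j <- l) c j * prob P (Bs j).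
  apply: prob_combination; first by move=> [[j|]|] //=.
  move=> t; rewrite (sumE (fun B => \1_B t)) indicT mulr1 subr_ge0.
  have -> : \sum_(j <- s) \1_(A j) t = (size [seq j <- s | `[< A j t >]])%:R :> R.
    rewrite size_filter -sum1_count natr_sum [RHS]big_mkcond; apply: eq_bigr => j _.
    rewrite indicE; case: asboolP => h; first by rewrite mem_set.
    by rewrite memNset.
  have [Ut|nUt] := pselect (U t).
    rewrite indicE mem_set// mulr1 (@le_trans _ _ n)// ?lerDl// /n ler_nat.
    by rewrite size_filter count_size.
  rewrite indicE memNset// mulr0 add0r ler_nat leqNgt; apply/negP => /ltnW; exact: nUt.
rewrite (sumE (prob P)) probT mulr1 => h.
have : a * n <= \sum_(j <- s) prob P (A j).
  have -> : a * n = \sum_(j <- s) a.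
    by rewrite big_const_seq count_predT iter_addr_0 mulr_natr.
  by rewrite big_seq [leRHS]big_seq; apply: ler_sum => j; exact: aA.
by rewrite -/n; lra.
Qed.

Lemma prob_union_le (R : realType) d (T : measurableType d) (P : probability T R)
    (J : choiceType) (s : seq J) (A : J -> set T) :
  (forall j, measurable (A j)) ->
  prob P [set t | exists2 j, j \in s & A j t] <= \sum_(j <- s) prob P (A j).
Proof.
move=> mA; elim: s => [|j s IH].
  rewrite big_nil [X in prob P X](_ : _ = set0) ?prob0//.
  by apply/seteqP; split=> // t [].
set U := [set t | exists2 j, j \in s & A j t] in IH *.
have mU : measurable U.
  rewrite (_ : U = \big[setU/set0]_(j <- s) A j); first exact: bigsetU_measurable.
  by rewrite -bigcup_seq; apply/seteqP; split=> t [i ? ?]; exists i.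
have -> : [set t | exists2 j0, j0 \in j :: s & A j0 t] = A j `|` (~` A j `&` U).
  apply/seteqP; split=> t.
    move=> [i]; rewrite inE => /orP[/eqP-> At|is_ At]; first by left.
    by have [?|?] := pselect (A j t); [left|right; split=> //; exists i].
  move=> [At|[_ [i is_ At]]]; first by exists j => //; rewrite mem_head.
  by exists i => //; rewrite inE is_ orbT.
have mC : measurable (~` A j) by exact: measurableC.
rewrite big_cons probU//; last first.
- by apply/seteqP; split=> t // [? []].
- exact: measurableI.
rewrite lerD2l (le_trans _ IH)//; apply: prob_le => //; exact: measurableI.
Qed.

(* The sets [B s] are pairwise disjoint, so that their probabilities are the
   weights of a subprobability. *)
Lemma prob_partition_le (R : realType) d (T : measurableType d) (P : probability T R)
    (J : choiceType) (s : seq J) (B : J -> set T) :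
  uniq s -> (forall j, measurable (B j)) ->
  (forall i j t, i \in s -> j \in s -> B i t -> B j t -> i = j) -> \sum_(j <- s) prob P (B j) <= 1.
Proof.
move=> us mB dB.
pose Bs (j : option J) : set T := if j is Some j then B j else setT.
pose c (j : option J) : R := if j is Some _ then - 1 else 1.
have sumE (f : set T -> R) : \sum_(j <- None :: [seq Some j | j <- s]) c j * f (Bs j) =
    f setT - \sum_(j <- s) f (B j).
  rewrite big_cons big_map mul1r -sumrN; congr (_ + _).
  by apply: eq_bigr => j _; rewrite mulN1r.
have : 0 <= \sum_(j <- None :: [seq Some j | j <- s]) c j * prob P (Bs j).
  apply: prob_combination; first by move=> [j|] /=.
  move=> t; rewrite (sumE (fun B => \1_B t)) indicT subr_ge0.
  have [[j js Bj]|nB] := pselect (exists2 j, j \in s & B j t).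
    rewrite (bigD1_seq j)//= indicE mem_set// big_seq_cond big1 ?addr0// => i /andP[is_ ij].
    by rewrite indicE memNset// => Bi; move: ij; rewrite (dB _ _ _ is_ js Bi Bj) eqxx.
  rewrite big_seq big1// => j js; rewrite indicE memNset// => Bj; apply: nB; by exists j.
by rewrite (sumE (prob P)) probT subr_ge0.
Qed.

(** A vertex at generation [r] of a bush is connected with probability at least [(4 / 5) ^ r.+1] and
    there are [3 ^ r] of them, so the mean number exceeds the required [2 ^ r.-1] by at least
    one. *)
Lemma mean_bush_ge (R : realType) r : (2 <= r)%N ->
  1 <= (4 / 5) ^+ r.+1 * 3 ^+ r - 2 ^+ r.-1 :> R.
Proof.
move=> r2; have -> : r = (r - 2).+2 by lia.
move: (r - 2)%N => m /=.
have h : (2 : R) ^+ m.+2 <= (12 / 5) ^+ m.+2.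
  by apply: lerXn2r; rewrite ?nnegrE; lra.
have one : 1 <= (2 : R) ^+ m by apply: exprn_ege1; lra.
have e : 4 / 5 * 3 = 12 / 5 :> R by lra.
rewrite [(4 / 5) ^+ _]exprS -mulrA -exprMn e.
move: h one; rewrite [2 ^+ m.+2]exprS [2 ^+ m.+1]exprS.
by move: ((12 / 5) ^+ _) (2 ^+ m) => A B; lra.
Qed.

(* Coordinates: the bits of all scales, then the two noises. *)
Definition coord_prob (R : realType) (E : choiceType) (th : nat -> R) (eps del : R)
    (i : nat * nat + (E + E)) : R :=
  match i with inl km => th km.1 | inr (inl _) => eps | inr (inr _) => del end.

Lemma sum_bigfcup_le (R : realType) (I : choiceType) (g : I -> R) (J : Type)
    (s : seq J) (F : J -> {fset I}) : (forall i, 0 <= g i) ->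
  \sum_(i <- (\bigcup_(j <- s) F j)%fset) g i <= \sum_(j <- s) \sum_(i <- F j) g i.
Proof.
move=> g0; elim: s => [|j s IH]; first by rewrite !big_nil.
rewrite !big_cons; set U := (\bigcup_(j <- s) F j)%fset in IH *.
have -> : (F j `|` U = F j `|` (U `\` F j))%fset by rewrite fsetUDl fsetDv fsetD0.
rewrite big_fsetU_disjoint /=; last first.
  by apply/fdisjointP => i iA; rewrite !inE iA.
rewrite lerD2l (le_trans _ IH)//.
have UE : (U = (U `\` F j) `|` (U `&` F j))%fset by rewrite fsetUC fsetID.
rewrite [leRHS](_ : _ = \sum_(i <- ((U `\` F j) `|` (U `&` F j))%fset) g i); last by rewrite -UE.
rewrite big_fsetU_disjoint /=; last first.
  by apply/fdisjointP => i; rewrite !inE => /andP[/negPf-> _]; rewrite andbF.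
by rewrite lerDl sumr_ge0.
Qed.

Lemma depends_on_preimage d (Om : measurableType d) (E : choiceType)
    (w : Om -> set E) (l : seq E) (Q : set (set E)) :
  (forall e, measurable [set t | w t e]) ->
  depends_on (fun e (u : set E) => u e) [set` l] Q -> measurable [set t | Q (w t)].
Proof.
move=> mw dQ; apply: (@depends_on_measurable _ _ _ (fun e => [set t | w t e]) l) => //.
by move=> t t' tt' /(dQ _ _ tt').
Qed.

Section Percolates.
Variables (V : choiceType) (T : graph V) (o : V) (e0 : edges T).

Definition percolates n (w : set (edges T)) :=
  exists2 z, z \in desc T o n o & upopen o e0 w n z.

Definition path_edges n : seq (edges T) :=
  [seq edge o e0 (iter i (parent T o) z) | z <- desc T o n o, i <- iota 0 n].

Lemma percolates_depends n :
  depends_on (fun e (w : set (edges T)) => w e) [set` path_edges n] (percolates n).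
Proof.
apply: depends_on_ex => z zn; apply: depends_on_all => i ilt.
apply: (@depends_on1 _ _ _ (edge o e0 (iter i (parent T o) z))).
by apply/allpairsP; exists (z, i); rewrite mem_iota.
Qed.

End Percolates.

(** * Percolation of the holes and the deletions *)

Section Model.
Variables (V : choiceType) (T : graph V).
Hypothesis hT : regular_tree 4 T.
Variables (code : V -> nat) (Rad : nat -> nat).
Hypothesis code_inj : forall x y, verts T x -> verts T y -> code x = code y -> x = y.
Variables (o : V) (e0 : edges T).
Hypothesis vo : verts T o.
Context {R : realType} d {Om : measurableType d} (P : probability Om R).
Variables (X : nat * nat + (edges T + edges T) -> set Om) (th : nat -> R) (eps del : R).
Hypothesis mX : forall i, measurable (X i).
Hypothesis indepX : forall F : {fset nat * nat + (edges T + edges T)},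
  prob P (\bigcap_(i in [set` F]) X i) = \prod_(i <- F) coord_prob th eps del i.
Hypothesis th01 : forall k, 0 < th k < 1.
Hypothesis th_sum : forall N, \sum_(k < N) th k * 5 ^+ (2 * Rad k) <= 10^-1.
Hypothesis eps01 : 0 < eps <= 32^-1.
Hypothesis del01 : 0 < del <= 10^-1.

Local Notation I := (nat * nat + (edges T + edges T))%type.
Local Notation depth := (depth T o).
Local Notation parent := (parent T o).
Local Notation desc := (desc T o).
Local Notation edge := (edge o e0).
Local Notation p := (coord_prob th eps del).

Definition bit_coord k v : I := inl (k, code v).
Definition add_coord (e : edges T) : I := inr (inl e).
Definition del_coord (e : edges T) : I := inr (inr e).
Definition holesX D t := holes (T := T) code Rad D (fun i => X (inl i) t).
Definition addX t : set (edges T) := [set e | X (add_coord e) t].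
Definition delX t : set (edges T) := [set e | X (del_coord e) t].

Definition perturbed D t : set (edges T) := perturbation (holesX D t) (addX t) (delX t).

(** The bits of scale below [N] whose hole can touch an edge at [z]. *)
Definition near_coords N z : {fset I} :=
  (\bigcup_(k <- iota 0 N) [fset bit_coord k v | v in tball T (2 * Rad k) z])%fset.

(* With these coordinates off, no hole of scale below [N] and no deletion
   touches the path from [z] to its [j]-th ancestor. *)
Definition branch_coords N j z : {fset I} :=
  (near_coords N (iter j parent z) `|` \bigcup_(i <- iota 0 j)
     (near_coords N (iter i parent z) `|` [fset del_coord (edge (iter i parent z))]))%fset.

Lemma in_near_coords N z c : c \in near_coords N z <->
  exists k v, [/\ (k < N)%N, v \in tball T (2 * Rad k) z & c = bit_coord k v].
Proof.
split.
  case/bigfcupP=> k; rewrite mem_iota andbT /= => kN /imfsetP[v /= vk ->].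
  by exists k, v.
move=> [k [v [kN vk ->]]]; apply/bigfcupP; exists k; first by rewrite mem_iota kN.
by apply/imfsetP; exists v.
Qed.

Lemma in_branch_coords N j z c : c \in branch_coords N j z <->
  (exists2 i, (i <= j)%N & c \in near_coords N (iter i parent z)) \/
  (exists2 i, (i < j)%N & c = del_coord (edge (iter i parent z))).
Proof.
rewrite inE; split.
  case/orP=> [h|/bigfcupP[i]]; first by left; exists j.
  rewrite mem_iota andbT add0n => ij /fsetUP[h|/fset1P->].
    by left; exists i => //; exact: ltnW.
  by right; exists i.
case=> [[i]|[i ij ->]].
  rewrite leq_eqVlt => /orP[/eqP->->//|ij h]; apply/orP; right.
  by apply/bigfcupP; exists i; [rewrite mem_iota add0n ij|apply/fsetUP; left].
apply/orP; right; apply/bigfcupP; exists i; first by rewrite mem_iota add0n ij.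
by apply/fsetUP; right; exact/fset1P.
Qed.

Lemma coord_prob_bounds (i : I) : 0 <= p i <= 1.
Proof.
case: i => [[k m]|[e|e]] /=; first by have := th01 k; lra.
  by move: eps01; lra.
by move: del01; lra.
Qed.

Lemma off_bounds (i : I) : 0 <= 1 - p i <= 1.
Proof. by have := coord_prob_bounds i; lra. Qed.

Lemma sum_near_coords N z : \sum_(c <- near_coords N z) p c <= 10^-1.
Proof.
apply: le_trans (th_sum N); apply: le_trans (sum_bigfcup_le _ _ _) _.
  by move=> i; have /andP[] := coord_prob_bounds i.
rewrite -(big_mkord xpredT (fun k => th k * 5 ^+ (2 * Rad k))) /index_iota subn0.
apply: ler_sum => k _; set S := [fset _ | _ in _]%fset.
rewrite big_seq (eq_bigr (fun=> th k)); last by move=> c /imfsetP[v _ ->].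
rewrite -big_seq big_const_seq count_predT iter_addr_0 -[leLHS]mulr_natr /=.
apply: ler_wpM2l; first by have /andP[/ltW] := th01 k.
rewrite -natrX ler_nat (leq_trans _ (card_tball hT _ z))//.
exact: leq_imfset_card.
Qed.

(** No nearby bit is on with probability at least 9/10 at each vertex, by the bound on [th_sum]. The
    edge above it survives deletion with probability at least 9/10, and the product is at least
    4/5. *)
Lemma prod_branch_coords N j z : (4 / 5) ^+ j.+1 <= \prod_(c <- branch_coords N j z) (1 - p c).
Proof.
have wsite z' : 9 / 10 <= \prod_(c <- near_coords N z') (1 - p c).
  apply: le_trans (weierstrass off_bounds _).
  rewrite (eq_bigr p); last by move=> c _; rewrite opprB addrC subrK.
  have := sum_near_coords N z'; lra.
have wlink z' : 4 / 5 <= \prod_(c <- (near_coords N z' `|` [fset del_coord (edge z')])%fset) (1 - p c).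
  apply: le_trans (prod_fsetU_ge off_bounds _ _).
  rewrite big_seq_fset1 /=; have := wsite z'; move: del01; nra.
apply: le_trans (prod_fsetU_ge off_bounds _ _); rewrite exprS; apply: ler_pM.
- lra.
- by apply: exprn_ge0; lra.
- have := wsite (iter j parent z); lra.
apply: le_trans (prod_bigfcup_ge off_bounds _ _).
rewrite -[X in _ ^+ X](size_iota 0 j); elim: (iota 0 j) => [|i s IH].
  by rewrite big_nil expr0.
rewrite big_cons exprS; exact: ler_pM.
Qed.

Definition off (F : {fset I}) : set Om := [set t | forall c, c \in F -> ~ X c t].

Lemma prob_off (F : {fset I}) : prob P (off F) = \prod_(c <- F) (1 - p c).
Proof. exact: indep_off. Qed.

Lemma depends_off (F : {fset I}) : depends_on X [set` F] (off F).
Proof.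
by apply: depends_on_all => c cF; apply: depends_onC; apply: (@depends_on1 _ _ _ c).
Qed.

Lemma measurable_off (F : {fset I}) : measurable (off F).
Proof.
by apply: (@depends_on_measurable _ _ _ X (enum_fset F)) => //; exact: depends_off.
Qed.

(** The exceptional set [H] serves the bush of a trap, which must be connected although the bit of
    the surrounding hole is on: that bit may be left free because its annulus does not meet the
    branch. *)
Lemma branch_off_except (H : {fset I}) N j z t : verts T z -> (j <= depth z)%N ->
  (forall i k v, (i < j)%N -> bit_coord k v \in H -> verts T v ->
     hit T Rad k v (val (edge (iter i parent z))) -> False) ->
  (forall e, del_coord e \notin H) ->
  off (branch_coords N j z `\` H)%fset t -> upopen o e0 (holesX `I_N t `\` delX t) j z.
Proof.
move=> vz jz nohit nodel hoff i ij; set u := iter i parent z.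
have vu : verts T u by exact: iter_parent_verts.
have uo : u != o.
  apply/eqP => uo; have := depth_iter hT vo i vz.
  by rewrite -/u uo depth_root// => /esym/eqP; rewrite subn_eq0 leqNgt (leq_trans ij jz).
split; last first.
  by apply: hoff; rewrite inE nodel; apply/in_branch_coords; right; exists i.
move=> k v kN vv hv; apply: hoff; rewrite inE; apply/andP; split.
  by apply/negP => kH; exact: nohit ij kH vv hv.
apply/in_branch_coords; left; exists i; first exact: ltnW.
apply/in_near_coords; exists k, v; split=> //; apply: (tball_sym hT).
by apply: (hv u _).1; rewrite (edgeE hT)// !inE eqxx.
Qed.

Lemma branch_off N j z t : verts T z -> (j <= depth z)%N ->
  off (branch_coords N j z) t -> upopen o e0 (holesX `I_N t `\` delX t) j z.
Proof.
move=> vz jz hoff; apply: (@branch_off_except fset0) => //.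
by rewrite fsetD0.
Qed.

(* A vertex close to two diverging branches is close to the branching point. *)
Lemma branch_meet N n z z' : z \in desc n o -> z' \in desc n o ->
  exists m, [/\ (m <= n)%N, iter (n - m) parent z = iter (n - m) parent z' &
    {subset (branch_coords N n z `&` branch_coords N n z')%fset <= branch_coords N m (iter (n - m) parent z)}].
Proof.
move=> zn zn'; have [vz dz iz] := (descP hT vo n z vo).1 zn.
have [vz' dz' iz'] := (descP hT vo n z' vo).1 zn'.
rewrite depth_root// add0n in dz; rewrite depth_root// add0n in dz'.
pose Q m := iter (n - m) parent z == iter (n - m) parent z'.
have exQ : exists m, (m <= n)%N && Q m by exists 0%N; rewrite /Q subn0 iz iz' eqxx.
(* The maximal [m] is the depth of the last common ancestor of [z] and [z']. *)
case: (ex_maxnP exQ (fun m => (fun h => proj1 (andP h)))) => m /andP[mn /eqP Qm] max.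
exists m; split=> //; set w := iter (n - m) parent z.
have vw : verts T w by exact: iter_parent_verts.
have dw : depth w = m by rewrite depth_iter// dz subKn.
have belowE i : (n - m <= i)%N -> iter i parent z = iter (i - (n - m)) parent w.
  by move=> h; rewrite -iterD subnK.
have belowE' i : (n - m <= i)%N -> iter i parent z' = iter (i - (n - m)) parent w.
  by move=> h; rewrite /w Qm -iterD subnK.
have same i i' : (i <= n)%N -> (i' <= n)%N -> iter i parent z = iter i' parent z' ->
    i = i' /\ (n - m <= i)%N.
  move=> iN iN' e; have := congr1 depth e; rewrite !depth_iter// dz dz' => dd.
  have ii' : i = i' by lia.
  split=> //; have : (n - i <= m)%N.
    by apply: max; rewrite leq_subr /Q subKn// e ii' eqxx.
  lia.
move=> c; rewrite inE => /andP[/in_branch_coords c1 /in_branch_coords c2]; apply/in_branch_coords.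
have side i : (i <= n)%N -> (n - m <= i)%N -> c \in near_coords N (iter i parent z) ->
    (exists2 i0, (i0 <= m)%N & c \in near_coords N (iter i0 parent w)).
  by move=> iN h; rewrite belowE// => cs; exists (i - (n - m))%N => //; lia.
case: c1 => [[i iN cz]|[i iN cz]]; last first.
  case: c2 => [[i' _ /in_near_coords[k [v [_ _]]]]|[i' iN' cz']]; first by rewrite cz.
  right; have [] := same i i' (ltnW iN) (ltnW iN').
    move: cz; rewrite cz' => -[] /(edge_inj hT vo) h; apply/esym/h.
    - exact: iter_parent_verts.
    - apply/eqP => uo; have := depth_iter hT vo i' vz'.
      by rewrite uo depth_root// dz'; lia.
    - exact: iter_parent_verts.
    - apply/eqP => uo; have := depth_iter hT vo i vz.
      by rewrite uo depth_root// dz; lia.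
  by move=> _ h; exists (i - (n - m))%N; [lia|rewrite cz belowE].
left; case: c2 => [[i' iN' cz']|[i' _ cz']]; last first.
  by move: cz => /in_near_coords[k [v [_ _]]]; rewrite cz'.
have [h|h] := leqP (n - m) i; first exact: side cz.
have [h'|h'] := leqP (n - m) i'.
  by move: cz'; rewrite belowE'// => cs; exists (i' - (n - m))%N => //; lia.
move: cz cz' => /in_near_coords[k [v [kN vk ->]]] /in_near_coords[k' [v' [_ vk' [kk' vv']]]].
have vv : v = v'.
  have vi k0 z0 : verts T z0 -> verts T (iter k0 parent z0) by exact: iter_parent_verts.
  by apply: code_inj => //;
    [apply: (tball_verts hT _ vk)|apply: (tball_verts hT _ vk')]; exact: vi.
rewrite -kk' -vv in vk'; exists 0%N => //; apply/in_near_coords; exists k, v; split=> //.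
have nm0 : (n - m).-1.+1 = (n - m)%N by rewrite prednK//; exact: leq_ltn_trans h.
pose u := iter (n - m).-1 parent z; pose u' := iter (n - m).-1 parent z'.
have pu : parent u = w by rewrite /u -iterS nm0.
have pu' : parent u' = w by rewrite /u' -iterS nm0 /w Qm.
have vu : verts T u by exact: iter_parent_verts.
have vu' : verts T u' by exact: iter_parent_verts.
have du : depth u = m.+1 by rewrite depth_iter// dz; lia.
have du' : depth u' = m.+1 by rewrite depth_iter// dz'; lia.
have sub z0 i0 (vz0 : verts T z0) : depth z0 = n -> (i0 < n - m)%N ->
    in_subtree T o (iter (n - m).-1 parent z0) (iter i0 parent z0).
  move=> dz0 hi; apply: (@desc_in_subtree _ _ hT _ vo ((n - m).-1 - i0)); first exact: iter_parent_verts.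
  apply/(descP hT vo); first exact: iter_parent_verts.
  split; first exact: iter_parent_verts.
    by rewrite !depth_iter// dz0; lia.
  by rewrite -iterD subnK//; lia.
(* By maximality of [m] the children [u] and [u'] of the branching point are distinct, so [v] lies
   outside one of their subtrees. The walk from that branch to [v] passes through the branching
   point. *)
have [vin|vout] := boolP (in_subtree T o u v).
  have vout' : ~~ in_subtree T o u' v.
    apply/negP => vin'; have uu' : u = u'.
      have [_ _ e1] := (descP hT vo _ _ vu).1 vin; have [_ _ e2] := (descP hT vo _ _ vu').1 vin'.
      by rewrite -e1 -e2 du du'.
    have : (m.+1 <= m)%N.
by apply: max; rewrite -subn_gt0 -nm0 /= /Q subnS -/u -/u' uu' eqxx.
    by rewrite ltnn.
  by have [_] := subtree_exit hT vo vu' (sub _ _ vz' dz' h') vk' vout'; rewrite pu'.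
by have [_] := subtree_exit hT vo vu (sub _ _ vz dz h) vk vout; rewrite pu.
Qed.

Lemma offU (A B : {fset I}) : off (A `|` B)%fset = off A `&` off B.
Proof.
apply/seteqP; split=> t; last by move=> [h h'] c /fsetUP[/h|/h'].
by move=> h; split=> c cz; apply: h; apply/fsetUP; [left|right].
Qed.

(** Independence up to the common coordinates, whose factor is at least the product over [C]. *)
Lemma prob_off_pair (A B C : {fset I}) : {subset (A `&` B)%fset <= C} ->
  prob P (off A `&` off B) * \prod_(c <- C) (1 - p c) <= prob P (off A) * prob P (off B).
Proof.
move=> sub; rewrite -offU !prob_off -(prod_fsetUI (fun c => 1 - p c) A B).
apply: ler_wpM2l; first exact: (prod_fset_ge0 off_bounds).
exact: (prod_fset_sub off_bounds sub).
Qed.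

(** In the second moment, a pair of branches with last common ancestor at depth [m] contributes at
    most [(5 / 4) ^ m.+1], and at most a fraction [3 ^- m] of the vertices share the ancestor of [z]
    at depth [m]. The geometric series of ratio 5/12 gives [5 / 4 * 12 / 7 = 15 / 7], which is less
    than 3. *)
Lemma prob_percolates_truncated N n :
  3^-1 <= prob P [set t | percolates o e0 n (holesX `I_N t `\` delX t)].
Proof.
have q0 z : 0 < prob P (off (branch_coords N n z)).
  rewrite prob_off; apply: lt_le_trans (prod_branch_coords N n z); apply: exprn_gt0; lra.
pose s := enum_fset (desc n o).
have s0 : (0 < size s)%N by apply: leq_trans (card_desc_root hT vo n); rewrite expn_gt0.
have mdel e : measurable [set t | ~ delX t e] by apply: measurableC; exact: mX.
have mopen e : measurable [set t | (holesX `I_N t `\` delX t) e].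
  have mh : measurable [set t | holesX `I_N t e]; last exact: measurableI mh (mdel e).
  rewrite (_ : mkset _ = [set t | forall e', e' \in [fset e]%fset -> holesX `I_N t e']).
    exact: (@measurable_holes_fset _ _ hT _ _ _ _ (fun i => X (inl i))).
  apply/seteqP; split=> t; first by move=> h a; rewrite inE => /eqP->.
  by apply; rewrite inE.
apply: (@le_trans _ _ (prob P [set t | exists2 z, z \in s & off (branch_coords N n z) t])); last first.
  apply: prob_le.
  - apply: (@depends_on_measurable _ _ _ X (flatten [seq enum_fset (branch_coords N n z) | z <- s])) => //.
    apply: depends_on_ex => z zs; apply: (depends_onW _ (@depends_off _)) => c cz.
    by apply/flattenP; exists (enum_fset (branch_coords N n z)) => //; apply: map_f.
  - apply: (@depends_on_preimage _ _ _ _ (path_edges o e0 n) (percolates o e0 n) mopen).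
    exact: percolates_depends.
  move=> t [z zs zt]; exists z => //; apply: branch_off => //.
    by have [] := (descP hT vo n z vo).1 zs.
  by have [_ -> _] := (descP hT vo n z vo).1 zs; rewrite depth_root.
apply: second_moment => //; first by move=> z; exact: measurable_off.
rewrite big_seq.
apply: (@le_trans _ _ (\sum_(z <- s | z \in s) (3 * (size s)%:R))); last first.
  by rewrite -big_seq big_const_seq count_predT iter_addr_0 -[leLHS]mulr_natr expr2 mulrA.
apply: ler_sum => z zs; have [vz dz iz] := (descP hT vo n z vo).1 zs.
rewrite depth_root// add0n in dz.
have e54 : 5 / 4 * (4 / 5) = 1 :> R by lra.
have e45 k : 0 <= (5 / 4 : R) ^+ k by apply: exprn_ge0; lra.
pose same m z' := iter (n - m) parent z == iter (n - m) parent z'.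
(* Summing over all depths where the ancestors agree, not only the last one, enlarges the bound and
   allows the two sums to be exchanged. *)
have pair z' : z' \in s ->
    prob P (off (branch_coords N n z) `&` off (branch_coords N n z')) / (prob P (off (branch_coords N n z)) * prob P (off (branch_coords N n z'))) <=
    \sum_(m <- iota 0 n.+1) (5 / 4) ^+ m.+1 * (same m z')%:R.
  move=> z's; have [m [mn Qm sub]] := branch_meet N zs z's.
  apply: (@le_trans _ _ ((5 / 4) ^+ m.+1)); last first.
    rewrite (bigD1_seq m) ?iota_uniq ?mem_iota//= /same Qm eqxx mulr1 lerDl.
    by apply: sumr_ge0 => i _; rewrite mulr_ge0// exprn_ge0.
  have := prob_off_pair sub; move=> off_pair.
  have := prod_branch_coords N m (iter (n - m) parent z).
  move: (\prod_(c <- _) _) off_pair => w off_pair w0.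
  rewrite ler_pdivrMr; last by apply: mulr_gt0; exact: q0.
  move: (prob P (_ `&` _)) (prob_ge0 P (off (branch_coords N n z) `&` off (branch_coords N n z'))) off_pair => u u0 uw.
  have h1 : u * (4 / 5) ^+ m.+1 <= prob P (off (branch_coords N n z)) * prob P (off (branch_coords N n z')).
    by apply: le_trans uw; exact: ler_wpM2l.
  have h2 : (5 / 4) ^+ m.+1 * (4 / 5) ^+ m.+1 = 1 :> R.
    by rewrite -exprMn e54 expr1n.
  have -> : u = (5 / 4) ^+ m.+1 * (u * (4 / 5) ^+ m.+1) by rewrite mulrCA h2 mulr1.
  by apply: ler_wpM2l => //; exact: e45.
rewrite big_seq; apply: le_trans (ler_sum _ pair) _; rewrite -big_seq exchange_big.
have n0 : 0 < (size s)%:R :> R by rewrite ltr0n.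
have cnt m : (m <= n)%N -> \sum_(z' <- s) (same m z')%:R <= (size s)%:R * 3^-1 ^+ m :> R.
  (* Depth 0 is separate: the root has four children and its generations are larger than powers of
     three. *)
  move=> mn; have [->|m0] := posnP m.
    by rewrite expr0 mulr1 -natr_sum ler_nat -sum1_size; apply: leq_sum => z' _; exact: leq_b1.
  set w := iter (n - m) parent z; have vw : verts T w by exact: iter_parent_verts.
  have dw : depth w = m by rewrite depth_iter// dz subKn.
  have wo : w != o by apply/eqP => wo; move: m0; rewrite -dw wo depth_root.
  have sub : (\sum_(z' <- s) same m z' <= 3 ^ (n - m))%N.
    rewrite -(card_desc hT vo (n - m) vw wo).
    rewrite (_ : (\sum_(z' <- s) same m z')%N = size [seq z' <- s | same m z']).
      apply: uniq_leq_size; first by rewrite filter_uniq// fset_uniq.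
      move=> z'; rewrite mem_filter => /andP[/eqP sz z's].
      have := desc_iter_parent hT vo vo (leq_subr m n) z's.
      by rewrite -sz.
    by rewrite size_filter -sum1_count [RHS]big_mkcond; apply: eq_bigr => z' _; case: ifP.
  rewrite -natr_sum; apply: (@le_trans _ _ ((3 ^ (n - m))%N%:R)); first by rewrite ler_nat.
  rewrite exprVn ler_pdivlMr ?exprn_gt0// -natrX -natrM ler_nat -expnD subnK//.
  exact: card_desc_root.
apply: (@le_trans _ _ (\sum_(m <- iota 0 n.+1) (5 / 4) * (size s)%:R * (5 / 12) ^+ m)).
  rewrite big_seq [leRHS]big_seq; apply: ler_sum => m; rewrite mem_iota add0n ltnS => /andP[_ mn].
  rewrite -mulr_sumr exprS -[leLHS]mulrA -[leRHS]mulrA; apply: ler_wpM2l; first lra.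
  rewrite (_ : 5 / 12 = 5 / 4 / 3 :> R); last by lra.
  by rewrite [in leRHS]exprMn [leRHS]mulrCA; apply: ler_wpM2l; [exact: e45|exact: cnt].
rewrite -mulr_sumr.
have geom k : \sum_(m <- iota 0 k) (5 / 12) ^+ m <= 12 / 7 - 12 / 7 * (5 / 12) ^+ k :> R.
  elim: k => [|k IH]; first by rewrite big_nil expr0; lra.
  by rewrite -addn1 iotaD big_cat big_seq1 /= add0n exprD expr1; lra.
have := geom n.+1; have : (0 : R) <= (5 / 12) ^+ n.+1 by apply: exprn_ge0; lra.
set G := \sum_(m <- _) _; set Y := _ ^+ n.+1 => Y0 GY.
by rewrite mulrAC ler_pM2r//; lra.
Qed.

Lemma measurable_hole_edge N e : measurable [set t | holesX `I_N t e].
Proof.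
rewrite (_ : mkset _ = [set t | forall e', e' \in [fset e]%fset -> holesX `I_N t e']).
  exact: (@measurable_holes_fset _ _ hT _ _ _ _ (fun i => X (inl i))).
apply/seteqP; split=> t; first by move=> h a; rewrite inE => /eqP->.
by apply; rewrite inE.
Qed.

Lemma measurable_hole_edgeT e : measurable [set t | holesX setT t e].
Proof. exact: (@measurable_holesT _ _ hT _ _ _ _ (fun i => X (inl i))). Qed.

Lemma measurable_percolates D n : (forall e, measurable [set t | holesX D t e]) ->
  measurable [set t | percolates o e0 n (holesX D t `\` delX t)].
Proof.
move=> mh; apply: (@depends_on_preimage _ _ _ _ (path_edges o e0 n) (percolates o e0 n)).
  move=> e; have mdel : measurable [set t | ~ delX t e] by apply: measurableC; exact: mX.
  exact: measurableI (mh e) mdel.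
exact: percolates_depends.
Qed.

Lemma percolatesS n w w' : w `<=` w' -> percolates o e0 n w -> percolates o e0 n w'.
Proof. by move=> ww' [z zn zw]; exists z => //; exact: upopen_sub ww' zw. Qed.

Lemma prob_percolates n :
  3^-1 <= prob P [set t | percolates o e0 n (holesX setT t `\` delX t)].
Proof.
pose A N := [set t | percolates o e0 n (holesX `I_N t `\` delX t)].
have mA N : measurable (A N).
  by apply: measurable_percolates => e; exact: measurable_hole_edge.
have mAT := measurable_percolates n measurable_hole_edgeT.
have AE : [set t | percolates o e0 n (holesX setT t `\` delX t)] = \bigcap_N A N.
  apply/seteqP; split=> t.
    move=> h N _; apply: percolatesS h => e [he de]; split=> //.
    by have /holesT := he; apply.
  move=> h; apply: contrapT => np.
  (* If no branch is open at all scales, each of the finitely many branches is blocked at some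
     truncation; the largest of these truncations blocks them all. *)
  have /choice[f fP] : forall z, exists N, z \in desc n o ->
      ~ upopen o e0 (holesX `I_N t `\` delX t) n z.
    move=> z; apply: contrapT => /forallNP nz; apply: np.
    have zn : z \in desc n o by apply: contrapT => zn; apply: (nz 0%N) => /zn.
    exists z => // i ilt; split; last first.
      have /not_implyP[_ /contrapT/(_ i ilt)[]] := nz 0%N.
      by [].
    apply/holesT => N; have /not_implyP[_ /contrapT/(_ i ilt)[]] := nz N.
    by [].
  have [z zn zo] := h (\max_(z <- enum_fset (desc n o)) f z)%N Logic.I.
  apply: (fP z zn); apply: upopen_sub zo => e [he de]; split=> //.
  by apply: holes_le he; exact: (@leq_bigmax_seq _ _ xpredT f z zn).
have cvgA : P \o A @ \oo --> P (\bigcap_N A N).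
  apply: nonincreasing_cvg_mu => //; first by rewrite (le_lt_trans (probability_le1 _ _)) ?ltry.
    by rewrite -AE.
  move=> N M NM; apply/subsetPset => t; apply: percolatesS => e [he de]; split=> //.
  exact: holes_le NM _ he.
rewrite AE -lee_fin -probE -?AE//; rewrite AE.
rewrite -(cvg_lim _ cvgA)//; apply: lime_ge; first by apply/cvg_ex; eexists; exact: cvgA.
by apply: nearW => N /=; rewrite probE// lee_fin; exact: prob_percolates_truncated.
Qed.

(** Sets in the ball of radius [m] have boundary points at depth up to [m + 1], hence the range of
    edges. *)
Lemma expanding_depends M m w w' :
  (forall u, verts T u -> u != o -> (depth u <= m.+1)%N -> (w (edge u) <-> w' (edge u))) ->
  expanding o e0 M m w -> expanding o e0 M m w'.
Proof.
move=> ww' ew K tK KD.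
have Kd z : z \in K -> (depth z <= m)%N by move=> /KD; exact: depth_min.
have tK' : rooted_tree o e0 w K.
  split; first by have [] := tK.
  move=> z zK; have [vz h] := tK.2 z zK; split=> // zo.
  have [pK wz] := h zo; split=> //; apply/ww' => //; exact: leqW (Kd z zK).
rewrite (_ : bdry o e0 w' K = bdry o e0 w K); first exact: ew.
apply/fsetP => z; apply/idP/idP => zb; have vz := bdry_verts hT zb.
  have [zo pK zK wz] := (in_bdry hT e0 vo w' K vz).1 zb.
  apply/(in_bdry hT e0 vo w K vz); split=> //; apply/ww' => //.
  by have [_ ->] := parentP hT vo vz zo; rewrite ltnS Kd.
have [zo pK zK wz] := (in_bdry hT e0 vo w K vz).1 zb.
apply/(in_bdry hT e0 vo w' K vz); split=> //; apply/ww' => //.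
by have [_ ->] := parentP hT vo vz zo; rewrite ltnS Kd.
Qed.

(** * Traps *)

Section Scale.
Variables (n rho M : nat).
Local Notation r := (Rad n).
(** A trap depends on bits within [3 * r] of its tip [y]. Placing [y] at [7 * r] below depth [rho]
    separates these bits from those within [rho + 2 * r] of the root and, since [7 * r] exceeds
    [6 * r], from those of the other traps. The bush occupies [2 * r] further generations, whence
    [9 * r] in [D]. *)
Local Notation L := (7 * Rad n)%N.
Local Notation D := (rho + 9 * Rad n)%N.
Hypothesis r2 : (2 <= r)%N.
Hypothesis rad_le : forall k, (k <= n)%N -> (Rad k <= r)%N.

(** If [K j] is the cluster down to depth [j], its boundary lies in the next sphere, so
    [#K j <= M * #S j.+1]. As [K j.+1] is the disjoint union of both, [M * #K j.+1] is at least
    [M.+1 * #K j]. Iteration gives the growth, stated without division. *)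
Lemma expanding_growth w : expanding o e0 M D w -> forall j, (j < D)%N ->
  (M.+1 ^ j <= M ^ j.+1 * #|` [fset z in desc j.+1 o | `[< conn o e0 w z >]]%fset|)%N.
Proof.
move=> ew.
pose S j := [fset z in desc j o | `[< conn o e0 w z >]]%fset.
pose K j := (\bigcup_(i <- iota 0 j.+1) S i)%fset.
have inS j z : z \in S j <-> z \in desc j o /\ conn o e0 w z.
  by rewrite !inE /=; split=> [/andP[-> /asboolP]//|[-> /asboolP->]].
have inK j z : z \in K j <-> [/\ verts T z, (depth z <= j)%N & conn o e0 w z].
  split.
    case/bigfcupP=> i; rewrite mem_iota add0n andbT ltnS /= => ij /inS[zi cz].
    have [vz dz _] := (descP hT vo i z vo).1 zi.
    by split=> //; rewrite dz depth_root.
  move=> [vz dz cz]; apply/bigfcupP; exists (depth z); first by rewrite mem_iota add0n ltnS dz.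
  by apply/inS; split=> //; exact: desc_depth.
have tK j : rooted_tree o e0 w (K j).
  split; first by apply/inK; split=> //; [rewrite depth_root|exact: conn_root].
  move=> z /inK[vz dz cz]; split=> // zo.
  have [cp wz] := (conn_parent hT e0 vo w vz zo).1 cz; split=> //.
  apply/inK; split=> //; first exact: parent_verts.
  by rewrite depth_parent// (leq_trans (leq_pred _)).
have bK j : (#|` bdry o e0 w (K j)| <= #|` S j.+1|)%N.
  apply: fsubset_leq_card; apply/fsubsetP => z zb.
  have vz := bdry_verts hT zb.
  have [zo /inK[_ dp cp] zK wz] := (in_bdry hT e0 vo w (K j) vz).1 zb.
  have cz : conn o e0 w z by apply/(conn_parent hT e0 vo).
  have [_ dz] := parentP hT vo vz zo.
  apply/inS; split=> //; have -> : j.+1 = depth z; last exact: desc_depth.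
  apply/eqP; rewrite eqn_leq dz !ltnS dp andbT.
  by rewrite leqNgt; apply/negP => dj; move/negP: zK; apply; apply/inK; split=> //; rewrite dz.
have grow j : (j < D)%N -> (#|` K j| <= M * #|` S j.+1|)%N.
  move=> jD; apply: leq_trans (ew _ (tK j) _) _; last by rewrite leq_mul2l bK orbT.
  move=> z /inK[vz dz _]; apply: (tball_le hT _ (depth_ball hT vo vz)).
  exact: leq_trans dz (ltnW jD).
have KS j : #|` K j.+1| = (#|` K j| + #|` S j.+1|)%N.
  have -> : K j.+1 = (K j `|` S j.+1)%fset.
    by rewrite /K -[j.+2]addn1 iotaD big_cat big_seq1.
  rewrite cardfsU (_ : _ `&` _ = fset0)%fset ?cardfs0 ?subn0//.
  apply/fsetP => z; rewrite in_fset0; apply/negP => /fsetIP[/inK[_ dz _] /inS[zS _]].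
  have [_ dz' _] := (descP hT vo _ z vo).1 zS.
  by move: dz; rewrite dz' depth_root// ltnn.
move=> j jD; rewrite -/(S j.+1).
suff h : (M.+1 ^ j <= M ^ j * #|` K j|)%N.
  apply: leq_trans h _; rewrite expnSr -mulnA leq_mul2l grow ?orbT//.
elim: j jD => [|j IH] jD.
  rewrite !expn0 mul1n cardfs_gt0; apply/fset0Pn; exists o; by have [] := tK 0%N.
have {}IH := IH (ltnW jD); have := grow j (ltnW jD); rewrite KS => g.
rewrite expnS (leq_trans (n := M.+1 * (M ^ j * #|` K j|))) ?leq_mul2l ?IH ?orbT//.
rewrite expnS -mulnA [leqRHS]mulnCA [leqLHS]mulnCA leq_mul2l; apply/orP; right.
by rewrite mulnDr mulSn addnC leq_add2l.
Qed.

Definition tip x : V := xget o [set z | z \in desc L x].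

Lemma tipP x : verts T x -> tip x \in desc L x.
Proof.
by move=> vx; rewrite /tip; case: xgetP => // h; have [z /h] := ex_desc hT vo L vx.
Qed.

Definition bush_branch y z : {fset I} := (branch_coords n.+1 r z `\` [fset bit_coord n y])%fset.

(** These edges join generations [r] to [2 * r] below [y], that is, they cross the annulus of the
    hole at [y] completely. *)
Definition leak y t := exists2 z, z \in desc (2 * r) y &
  forall i, (i < r)%N -> addX t (edge (iter i parent z)).

(* The hole around [y] is crossed by added edges above [y], surrounds a large
   connected bush below [y], and no added path crosses it downwards. *)
Definition trapped y t := [/\ X (bit_coord n y) t,
  forall i, (i < L)%N -> addX t (edge (iter i parent y)) /\ ~ delX t (edge (iter i parent y)),
  (2 ^ r.-1 <= size [seq z <- enum_fset (desc r y) | `[< off (bush_branch y z) t >]])%N &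
  ~ leak y t].

(** The violating set consists of the path from [o] to [y] and of everything connected to [y] within
    [2 * r] generations below it. The second part has no boundary: a vertex connected at generation
    [2 * r] would have crossed the hole by added edges, which is a leak. Only the children along the
    path can count, at most [4 * (rho + L)], against a bush of size [2 ^ r.-1]. *)
Lemma trapped_not_expanding x t : x \in desc rho o ->
  upopen o e0 (perturbed `I_n.+1 t) rho x -> trapped (tip x) t ->
  (4 * M * (rho + L) < 2 ^ r.-1)%N -> ~ expanding o e0 M D (perturbed `I_n.+1 t).
Proof.
move=> xr ox [Ga Gb Gc Gd] big ew; set w := perturbed `I_n.+1 t in ox ew.
have [vx dx ix] := (descP hT vo _ _ vo).1 xr; rewrite depth_root// add0n in dx.
set y := tip x in Ga Gb Gc Gd; have yx : y \in desc L x by exact: tipP.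
have [vy dy iy] := (descP hT vo _ _ vx).1 yx; rewrite dx in dy.
have yo : y != o.
  by apply/eqP => yo; move: dy; rewrite yo depth_root// => /esym/eqP; rewrite addn_eq0; clear -r2; lia.
pose K1 := [fset iter i parent y | i in iota 0 (rho + L).+1]%fset.
pose K2 := (\bigcup_(j <- iota 0 (2 * r).+1) [fset z in desc j y | `[< upopen o e0 w j z >]])%fset.
have inK1 z : z \in K1 <-> exists2 i, (i <= rho + L)%N & z = iter i parent y.
  split=> [/imfsetP[i /=]|[i il ->]].
    by rewrite -[_ :: _]/(iota 0 (rho + L).+1) mem_iota add0n ltnS => il ->; exists i.
  apply/imfsetP; exists i => //=.
  by rewrite -[_ :: _]/(iota 0 (rho + L).+1) mem_iota add0n ltnS.
have inK2 z : z \in K2 <-> exists j, [/\ (j <= 2 * r)%N, z \in desc j y & upopen o e0 w j z].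
  split.
    case/bigfcupP=> j; rewrite mem_iota andbT add0n ltnS => /= jr.
    by rewrite !inE /= => /andP[zj /asboolP oz]; exists j.
  move=> [j [jr zj oz]]; apply/bigfcupP; exists j; first by rewrite mem_iota add0n ltnS jr.
  by rewrite !inE /= zj; apply/asboolP.
have dK2 j z : z \in desc j y -> [/\ verts T z, depth z = (rho + L + j)%N & iter j parent z = y].
  by move=> /(descP hT vo _ _ vy)[vz dz iz]; rewrite -dy.
have spine i : (i < rho + L)%N -> w (edge (iter i parent y)).
  move=> il; have [iL|Li] := ltnP i L; first by have [ha hd] := Gb i iL; split=> //; right.
  rewrite -(subnK Li) iterD iy; apply: ox; clear -il Li; lia.
have yK2 : y \in K2 by apply/inK2; exists 0%N; split=> //; rewrite /= inE.
have tK : rooted_tree o e0 w (K1 `|` K2)%fset.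
  split.
    apply/fsetUP; left; apply/inK1; exists (rho + L)%N => //.
    by rewrite iterD iy ix.
  move=> z /fsetUP[/inK1[i il ->]|/inK2[j [jr zj oz]]].
    have vi : verts T (iter i parent y) by exact: iter_parent_verts.
    split=> // zo; have {}il : (i < rho + L)%N.
      rewrite ltn_neqAle il andbT; apply: contra zo => /eqP->.
      by rewrite iterD iy ix.
    split; last exact: spine.
    by apply/fsetUP; left; apply/inK1; exists i.+1.
  have [vz dz iz] := dK2 j z zj; split=> // zo.
  case: j jr zj oz dz iz => [|j] jr zj oz dz iz.
    rewrite /= in iz; rewrite iz; split; last by apply: (spine 0%N); clear -r2; lia.
    apply/fsetUP; left; apply/inK1; exists 1%N => //; clear -r2; lia.
  split; last exact: (oz 0%N).
  apply/fsetUP; right; apply/inK2; exists j; split; first exact: ltnW.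
    by have [] := (in_descS hT vo j y z).1 zj.
  exact: (@upopen_iter _ _ _ _ _ 1 j z oz).
have KD : {subset (K1 `|` K2)%fset <= tball T D o}.
  move=> z zK; have [vz _] := tK.2 z zK.
  apply: (tball_le hT _ (depth_ball hT vo vz)).
  move: zK => /fsetUP[/inK1[i il ->]|/inK2[j [jr zj oz]]].
    by rewrite depth_iter// dy; clear; lia.
  by have [_ -> _] := dK2 j z zj; clear -jr; lia.
have cK : (2 ^ r.-1 <= #|` (K1 `|` K2)%fset|)%N.
  apply: leq_trans Gc _; apply: uniq_leq_size; first by rewrite filter_uniq// fset_uniq.
  move=> z; rewrite mem_filter => /andP[/asboolP oz zr]; apply/fsetUP; right.
  have [vz dz iz] := dK2 r z zr.
  apply/inK2; exists r; split=> //; first by clear; lia.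
  (* The hole at [y] does not touch the bush above generation [r]: every such edge has its upper end
     within distance [r - 1] of [y]. So the branch is open with the bit of [y] left out. *)
  have oz' : upopen o e0 (holesX `I_n.+1 t `\` delX t) r z.
    apply: branch_off_except oz => //; [by rewrite dz; clear; lia| |by move=> e; rewrite inE].
    move=> i k v ir; rewrite inE => /eqP[-> cv] vv; have -> : v = y by exact: code_inj.
    have vi : verts T (iter i parent z) by exact: iter_parent_verts.
    have di : depth (iter i parent z) = (rho + L + r - i)%N by rewrite depth_iter// dz.
    have io : iter i parent z != o by apply/eqP => io; move: di; rewrite io depth_root//; clear -r2 ir; lia.
    move=> /(_ (parent (iter i parent z))); rewrite (edgeE hT)// !inE eqxx orbT => -[]//.
    move=> _; apply/negP; rewrite negbK -iterS.
    have pz := iter_parent_desc hT vo vy ir zr.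
    by apply: (tball_le hT _ (desc_tball hT vo vy pz)); clear; lia.
  by apply: upopen_sub oz' => e [he de]; split=> //; left.
have bK : (#|` bdry o e0 w (K1 `|` K2)%fset| <= 4 * (rho + L))%N.
  (* The enumeration starts at 1 because [y] belongs to [K2] and its open children do as well. *)
  apply: (@leq_trans #|` \bigcup_(i <- iota 1 (rho + L)) children T o (iter i parent y)|%fset).
    apply: fsubset_leq_card; apply/fsubsetP => z zb; have vz := bdry_verts hT zb.
    have [zo pK zK wz] := (in_bdry hT e0 vo w _ vz).1 zb.
    have [pK2|pK2] := boolP (parent z \in K2).
      exfalso; have /inK2[j [jr pj oj]] := pK2.
      have zj : z \in desc j.+1 y by apply/(in_descS hT vo).
      have ozj : upopen o e0 w j.+1 z.
        by apply: (@upopenD _ _ _ _ _ 1 j z) => // -[].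
      move: jr; rewrite leq_eqVlt => /orP[/eqP jr|jr]; last first.
        by move/negP: zK; apply; apply/fsetUP; right; apply/inK2; exists j.+1.
      apply: Gd; exists (parent z); first by rewrite -jr.
      move=> i ir; have [vp dp ip] := dK2 j _ pj.
      have vi : verts T (iter i parent (parent z)) by exact: iter_parent_verts.
      have di : depth (iter i parent (parent z)) = (rho + L + j - i)%N by rewrite depth_iter// dp.
      have io : iter i parent (parent z) != o.
        by apply/eqP => io; move: di; rewrite io depth_root//; clear -r2 ir jr; lia.
      (* An open edge of the annulus comes from [holesX] or from the added edges; the bit of [y]
         excludes the former. *)
      have [|[hw|//] _] := oj i; first by clear -r2 ir jr; lia.
      exfalso; apply: (hw n y) => //; first exact: ltnSn.
      have pdesc i' : (i' <= r)%N -> iter i' parent (parent z) \in tball T (2 * r) y /\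
          iter i' parent (parent z) \notin tball T r.-1 y.
        move=> ir'; have ij' : (i' <= j)%N by clear -ir' jr; lia.
        have pz := iter_parent_desc hT vo vy ij' pj; split.
          by apply: (tball_le hT _ (desc_tball hT vo vy pz)); clear -jr; lia.
        apply/negP => h; have := depth_tball hT vo vy h.
        by have [_ -> _] := dK2 _ _ pz; rewrite dy; clear -r2 ir' jr; lia.
      move=> u; rewrite (edgeE hT)// !inE => /orP[]/eqP->; first by apply: pdesc; exact: ltnW.
      by rewrite -iterS; exact: pdesc.
    move: pK => /fsetUP[/inK1[i il pi]|]; last by rewrite (negPf pK2).
    apply/bigfcupP; exists i; last by rewrite in_children// zo pi eqxx.
    rewrite mem_iota andbT add1n ltnS il andbT lt0n; apply: contra pK2 => /eqP i0.
    by rewrite pi i0.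
  apply: leq_trans (leq_card_bigfcup _ _) _.
  apply: (@leq_trans (\sum_(i <- iota 1 (rho + L)) 4)%N).
    by apply: leq_sum => i _; exact: card_children_le.
  by rewrite big_const_seq count_predT size_iota iter_addn_0.
have := leq_trans cK (ew _ tK KD); rewrite leqNgt => /negP; apply.
apply: leq_ltn_trans big; rewrite [(4 * M)%N]mulnC -mulnA leq_mul2l bK orbT//.
Qed.

Lemma depth_neq_root u : (0 < depth u)%N -> u != o.
Proof. by move=> du; apply/eqP => uo; move: du; rewrite uo depth_root. Qed.

Lemma tip_facts x : x \in desc rho o ->
  [/\ verts T x, depth x = rho, verts T (tip x), depth (tip x) = (rho + L)%N &
      tip x \in desc L x].
Proof.
move=> xr; have [vx dx _] := (descP hT vo _ _ vo).1 xr; rewrite depth_root// add0n in dx.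
have yx := tipP vx; have [vy dy _] := (descP hT vo _ _ vx).1 yx.
by split=> //; rewrite dy dx.
Qed.

(** * Coordinates and probability of a trap *)

Definition spine_on y : {fset I} :=
  (bit_coord n y |` [fset add_coord (edge (iter i parent y)) | i in iota 0 L])%fset.
Definition spine_off y : {fset I} :=
  [fset del_coord (edge (iter i parent y)) | i in iota 0 L]%fset.
Definition bush_coords y : {fset I} := (\bigcup_(z <- desc r y) bush_branch y z)%fset.
Definition leak_path z : {fset I} :=
  [fset add_coord (edge (iter i parent z)) | i in iota 0 r]%fset.
Definition leak_coords y : {fset I} := (\bigcup_(z <- desc (2 * r) y) leak_path z)%fset.
Definition trap_coords y : {fset I} :=
  (spine_on y `|` (spine_off y `|` (bush_coords y `|` leak_coords y)))%fset.

Definition big_bush y : set Om :=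
  [set t | (2 ^ r.-1 <= size [seq z <- enum_fset (desc r y) | `[< off (bush_branch y z) t >]])%N].

Lemma in_spine_on y c : c \in spine_on y <->
  c = bit_coord n y \/ exists2 i, (i < L)%N & c = add_coord (edge (iter i parent y)).
Proof.
split.
  case/fset1UP=> [->|/imfsetP[i il ->]]; [by left|right; exists i => //].
  by move: il; rewrite /= mem_iota add0n.
case=> [->|[i il ->]]; apply/fset1UP; [by left|right].
by apply/imfsetP; exists i; rewrite //= mem_iota add0n.
Qed.

Lemma in_spine_off y c : c \in spine_off y <->
  exists2 i, (i < L)%N & c = del_coord (edge (iter i parent y)).
Proof.
split=> [/imfsetP[i il ->]|[i il ->]].
  by exists i => //; move: il; rewrite /= mem_iota add0n.
by apply/imfsetP; exists i; rewrite //= mem_iota add0n.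
Qed.

Lemma in_leak_path z c : c \in leak_path z <->
  exists2 i, (i < r)%N & c = add_coord (edge (iter i parent z)).
Proof.
split=> [/imfsetP[i il ->]|[i il ->]].
  by exists i => //; move: il; rewrite /= mem_iota add0n.
by apply/imfsetP; exists i; rewrite //= mem_iota add0n.
Qed.

(** The four factors depend on pairwise disjoint sets of coordinates, so that the probability of a
    trap is a product. *)
Lemma trappedE y : [set t | trapped y t] =
  (\bigcap_(c in [set` spine_on y]) X c) `&`
  (off (spine_off y) `&` (big_bush y `&` ~` [set t | leak y t])).
Proof.
apply/seteqP; split=> t.
  move=> [Ga Gb Gc Gd]; split.
    by move=> c /= /in_spine_on[->//|[i iL ->]]; have [] := Gb i iL.
  by split=> // c /in_spine_off[i iL ->]; have [] := Gb i iL.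
move=> [on [offt [Gc Gd]]]; split=> //; first by apply: on; apply/in_spine_on; left.
move=> i iL; split; first by apply: on; apply/in_spine_on; right; exists i.
by apply: offt; apply/in_spine_off; exists i.
Qed.

Lemma depends_on_count (J : eqType) (s : seq J) (A : J -> set Om) l k :
  (forall j, j \in s -> depends_on X l (A j)) ->
  depends_on X l [set t | (k <= size [seq j <- s | `[< A j t >]])%N].
Proof.
move=> dA t t' tt' /=; congr (is_true (_ <= size _)%N); apply: eq_in_filter => j js.
by apply/asbool_equiv_eq; split; apply: (dA j js) => // i /tt' [h1 h2]; split.
Qed.

Lemma depends_on_spine_on y : depends_on X [set` spine_on y]
  (\bigcap_(c in [set` spine_on y]) X c).
Proof. by apply: depends_on_all => c cy; apply: (@depends_on1 _ _ _ c). Qed.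

Lemma depends_on_big_bush y : depends_on X [set` bush_coords y] (big_bush y).
Proof.
apply: depends_on_count => z zy; apply: (depends_onW _ (@depends_off _)) => c cz.
by apply/bigfcupP; exists z; rewrite ?zy.
Qed.

Lemma depends_on_leak y : depends_on X [set` leak_coords y] [set t | leak y t].
Proof.
apply: depends_on_ex => z zy; apply: depends_on_all => i ir.
apply: (@depends_on1 _ _ _ (add_coord (edge (iter i parent z)))).
apply/bigfcupP; exists z; first by rewrite zy.
by apply/in_leak_path; exists i.
Qed.

Lemma depends_on_trapped y : depends_on X [set` trap_coords y] [set t | trapped y t].
Proof.
rewrite trappedE.
have sub (A B C D' : {fset I}) c : [\/ c \in A, c \in B, c \in C | c \in D'] ->
    c \in (A `|` (B `|` (C `|` D')))%fset.
  by case=> h; apply/fsetUP; [left|right; apply/fsetUP; left|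
    right; apply/fsetUP; right; apply/fsetUP; left|
    right; apply/fsetUP; right; apply/fsetUP; right].
have dI (A B : set Om) l : depends_on X l A -> depends_on X l B -> depends_on X l (A `&` B).
  by move=> dA dB t t' tt' [At Bt]; split; [exact: dA At|exact: dB Bt].
apply: (dI); first by apply: (depends_onW _ (@depends_on_spine_on y)) => c h; apply: sub; apply: Or41.
apply: (dI); first by apply: (depends_onW _ (@depends_off _)) => c h; apply: sub; apply: Or42.
apply: (dI); first by apply: (depends_onW _ (@depends_on_big_bush y)) => c h; apply: sub; apply: Or43.
apply: depends_onC.
by apply: (depends_onW _ (@depends_on_leak y)) => c h; apply: sub; apply: Or44.
Qed.

Lemma add_coord_inj e e' : add_coord e = add_coord e' -> e = e'. Proof. by case. Qed.
Lemma del_coord_inj e e' : del_coord e = del_coord e' -> e = e'. Proof. by case. Qed.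

Lemma desc_iter_facts j i y z : verts T y -> z \in desc j y -> (i < j)%N ->
  [/\ verts T (iter i parent z), depth (iter i parent z) = (depth y + (j - i))%N &
      iter i parent z != o].
Proof.
move=> vy zj ij; have [vz dz _] := (descP hT vo _ _ vy).1 zj.
have vi : verts T (iter i parent z) by exact: iter_parent_verts.
have di : depth (iter i parent z) = (depth y + (j - i))%N.
  by rewrite depth_iter// dz addnBA// ltnW.
by split=> //; apply: depth_neq_root; rewrite di; clear -ij; lia.
Qed.

Lemma card_edges_image (f : edges T -> I) j y z : (forall e e', f e = f e' -> e = e') ->
  verts T y -> z \in desc j y ->
  #|` [fset f (edge (iter i parent z)) | i in iota 0 j]%fset| = j.
Proof.
move=> f_inj vy zj; rewrite card_in_imfset /=; first by rewrite undup_id ?iota_uniq// size_iota.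
move=> i i'; rewrite /= !mem_iota !add0n /= => ij i'j /f_inj.
have [v1 d1 n1] := desc_iter_facts vy zj ij; have [v2 d2 n2] := desc_iter_facts vy zj i'j.
move=> /(edge_inj hT vo v1 n1 v2 n2)/(congr1 depth); rewrite d1 d2.
clear -ij i'j; lia.
Qed.

Lemma prob_spine_on y x : verts T x -> y \in desc L x ->
  th n * eps ^+ L = prob P (\bigcap_(c in [set` spine_on y]) X c).
Proof.
move=> vx yx; rewrite indepX big_fsetU1 /=; last by apply/negP => /imfsetP[].
congr (_ * _); rewrite big_seq (eq_bigr (fun=> eps)); last by move=> c /imfsetP[i _ ->].
rewrite -big_seq big_const_seq count_predT iter_mulr_1; congr (_ ^+ _).
by rewrite (card_edges_image add_coord_inj vx yx).
Qed.

Lemma prob_spine_off y x : verts T x -> y \in desc L x ->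
  (1 - del) ^+ L = prob P (off (spine_off y)).
Proof.
move=> vx yx; rewrite prob_off big_seq (eq_bigr (fun=> 1 - del)); last first.
  by move=> c /imfsetP[i _ ->].
rewrite -big_seq big_const_seq count_predT iter_mulr_1; congr (_ ^+ _).
by rewrite (card_edges_image del_coord_inj vx yx).
Qed.

(** [reverse_markov] over the [3 ^ r] branches: the mean exceeds the threshold by one, hence the
    factor [3 ^- r]. So crude a bound is enough, being only exponential in [r]. *)
Lemma prob_big_bush y : verts T y -> y != o -> (3 ^- r) <= prob P (big_bush y).
Proof.
move=> vy yo.
have msr : measurable (big_bush y).
  by apply: depends_on_measurable (@depends_on_big_bush y) => c.
have seg_ge : {in enum_fset (desc r y), forall z, (4 / 5) ^+ r.+1 <= prob P (off (bush_branch y z))}.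
  move=> z _; rewrite prob_off; apply: le_trans (prod_branch_coords n.+1 r z) _.
  by apply: (prod_fset_sub off_bounds) => c; rewrite inE => /andP[].
have := reverse_markov (fun z => measurable_off (bush_branch y z)) seg_ge msr.
rewrite -/(big_bush y) (card_desc hT vo r vy yo : size (enum_fset (desc r y)) = _).
move: (prob P (big_bush y)) => q h.
rewrite -[leLHS]mul1r ler_pdivrMr ?exprn_gt0// mulrC.
apply: le_trans (mean_bush_ge R r2) _.
by move: h; rewrite !natrX.
Qed.

Lemma bush_coords_cases y c : verts T y -> c \in bush_coords y -> c <> bit_coord n y /\
  ((exists k v, [/\ verts T v, v \in tball T (3 * r) y & c = bit_coord k v]) \/
   (exists u, [/\ verts T u, u != o, (depth y < depth u)%N, in_subtree T o y u & c = del_coord (edge u)])).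
Proof.
move=> vy /in_bigfcup[z zr]; rewrite inE => /andP[/negP cl cz]; split.
  by move=> cy; apply: cl; rewrite cy inE.
case/in_branch_coords: cz => [[i ir /in_near_coords[k [v [kn vk ->]]]]|[i ir ->]].
  left; exists k, v; have ydesc := iter_parent_desc hT vo vy ir zr.
  have [vi _ _] := (descP hT vo _ _ vy).1 ydesc.
  split=> //; first exact: (tball_verts hT vi vk).
  apply: (tball_le hT _ (tball_trans hT (desc_tball hT vo vy ydesc) vk)).
  have := rad_le kn; clear; lia.
right; exists (iter i parent z); have [vi di io] := desc_iter_facts vy zr ir.
split=> //; first by rewrite di; clear -ir; lia.
exact: (desc_in_subtree hT vo vy (iter_parent_desc hT vo vy (ltnW ir) zr)).
Qed.

Lemma leak_coords_cases y c : verts T y -> c \in leak_coords y ->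
  exists u, [/\ verts T u, u != o, (depth y < depth u)%N, in_subtree T o y u & c = add_coord (edge u)].
Proof.
move=> vy /in_bigfcup[z zr] /in_leak_path[i ir ->]; have ir2 : (i < 2 * r)%N by clear -ir; lia.
exists (iter i parent z); have [vi di io] := desc_iter_facts vy zr ir2.
split=> //; first by rewrite di; clear -ir2; lia.
exact: (desc_in_subtree hT vo vy (iter_parent_desc hT vo vy (ltnW ir2) zr)).
Qed.

Lemma spine_facts x i : x \in desc rho o -> (i < L)%N ->
  [/\ verts T (iter i parent (tip x)), iter i parent (tip x) != o,
     (depth (iter i parent (tip x)) <= depth (tip x))%N,
     (rho < depth (iter i parent (tip x)))%N & in_subtree T o x (iter i parent (tip x))].
Proof.
move=> xr iL; have [vx dx vy dy yx] := tip_facts xr.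
have [vi di io] := desc_iter_facts vx yx iL; rewrite di dy dx.
split=> //; [by clear -iL; lia|by clear -iL; lia|].
exact: (desc_in_subtree hT vo vx (iter_parent_desc hT vo vx (ltnW iL) yx)).
Qed.

(** Union bound over at most [4 ^ (2 * r)] vertices, each needing [r] added edges. With [eps] at
    most 1/32 the base is [16 / 32], which is the origin of that threshold. *)
Lemma prob_leak y : verts T y -> prob P [set t | leak y t] <= 2^-1.
Proof.
move=> vy; pose A z := \bigcap_(c in [set` leak_path z]) X c.
have dA z : depends_on X [set` leak_path z] (A z).
  by apply: depends_on_all => c cy; apply: (@depends_on1 _ _ _ c).
have mA z : measurable (A z) by apply: depends_on_measurable (dA z).
have -> : [set t | leak y t] = [set t | exists2 z, z \in enum_fset (desc (2 * r) y) & A z t].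
  apply/seteqP; split=> t [z zr h]; exists z => //.
    by move=> c /in_leak_path[i ir ->]; exact: h.
  by move=> i ir; apply: h; apply/in_leak_path; exists i.
apply: le_trans (prob_union_le _ _ mA) _.
rewrite big_seq (eq_bigr (fun=> eps ^+ r)); last first.
  move=> z zr; rewrite /A indepX big_seq (eq_bigr (fun=> eps)); last first.
    by move=> c /imfsetP[i _ ->].
  rewrite -big_seq big_const_seq count_predT iter_mulr_1; congr (_ ^+ _).
  have r2r : (r <= 2 * r)%N by clear; lia.
  apply: (card_edges_image add_coord_inj _ (desc_iter_parent hT vo vy _ zr)).
    by apply: iter_parent_verts => //; have [] := (descP hT vo _ _ vy).1 zr.
  exact: r2r.
rewrite -big_seq big_const_seq count_predT iter_addr_0 -[leLHS]mulr_natl.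
have [e0' e32] := andP eps01.
apply: (@le_trans _ _ ((4 ^ (2 * r))%N%:R * 32^-1 ^+ r)).
  apply: ler_pM => //; first by rewrite exprn_ge0// ltW.
    by rewrite ler_nat; exact: card_desc_le.
  by apply: lerXn2r; rewrite ?nnegrE ?invr_ge0// ltW.
rewrite natrX exprM -exprMn.
have -> : 4%:R ^+ 2 * 32^-1 = 2^-1 :> R by rewrite expr2; lra.
rewrite -[leRHS]expr1; apply: ler_wiXn2l; [lra|lra|exact: leq_trans r2].
Qed.

(** The factors are: the bit of the hole, the added spine, a bound for the absence of deletions on
    the spine, the big bush, and the absence of a leak. *)
Definition trap_prob : R := th n * eps ^+ L * 2^-1 ^+ L * 3 ^- r * 2^-1.

Lemma prob_trapped x : x \in desc rho o -> trap_prob <= prob P [set t | trapped (tip x) t].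
Proof.
move=> xr; have [vx dx vy dy yx] := tip_facts xr; set y := tip x in vy dy yx *.
have yo : y != o by apply: depth_neq_root; rewrite dy; clear -r2; lia.
have dC := depends_onC (@depends_on_leak y).
have dI (A B : set Om) (F G : {fset I}) : depends_on X [set` F] A -> depends_on X [set` G] B ->
    depends_on X [set` (F `|` G)%fset] (A `&` B).
  move=> dA dB t t' tt' [At Bt]; split.
    by apply: dA At => c cF; apply: tt'; apply/fsetUP; left.
  by apply: dB Bt => c cF; apply: tt'; apply/fsetUP; right.
have d34 := dI _ _ _ _ (@depends_on_big_bush y) dC.
have d234 := dI _ _ _ _ (@depends_off (spine_off y)) d34.
have mleak : measurable [set t | leak y t] by apply: depends_on_measurable (@depends_on_leak y).
have diffe u u' : verts T u -> u != o -> verts T u' -> u' != o -> (depth u <= depth y)%N ->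
    (depth y < depth u')%N -> edge u = edge u' -> False.
  move=> v1 n1 v2 n2 d1 d2 /(edge_inj hT vo v1 n1 v2 n2) uu'; move: d1 d2; rewrite uu' => d1.
  by rewrite ltnNge d1.
rewrite trappedE (depends_indep mX indepX (@depends_on_spine_on y) d234); last first.
  move=> c /in_spine_on con /fsetUP[/in_spine_off[i iL cE]|/fsetUP[|]].
  - by case: con => [|[i' _]]; rewrite cE.
  - move=> /(bush_coords_cases vy)[cl [[k [v [vv vk cE]]]|[u [vu uo du yu cE]]]].
      by case: con => [//|[i' _]]; rewrite cE.
    by case: con => [//|[i' _]]; rewrite cE.
  - move=> /(leak_coords_cases vy)[u [vu uo du _ cE]].
    case: con => [|[i iL]]; rewrite cE// => /add_coord_inj/esym.
    have [v1 n1 d1 _ _] := spine_facts xr iL; exact: diffe.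
rewrite (depends_indep mX indepX (@depends_off (spine_off y)) d34); last first.
  move=> c /in_spine_off[i iL ->] /fsetUP[|].
  - move=> /(bush_coords_cases vy)[_ [[k [v [_ _]]]//|[u [vu uo du yu /del_coord_inj]]]].
    have [v1 n1 d1 _ _] := spine_facts xr iL; exact: diffe.
  - by move=> /(leak_coords_cases vy)[u [_ _ _ _]].
rewrite (depends_indep mX indepX (@depends_on_big_bush y) dC); last first.
  move=> c /(bush_coords_cases vy)[_ h] /(leak_coords_cases vy)[u [_ _ _ _ cE]].
  by case: h => [[k [v [_ _]]]|[u' [_ _ _ _]]]; rewrite cE.
rewrite -(prob_spine_on vx yx) -(prob_spine_off vx yx) probC//.
have := prob_leak vy; have := prob_big_bush vy yo.
move: (prob P (big_bush y)) (prob P [set t | leak y t]) => q3 q4 h3 h4.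
have [th0 _] := andP (th01 n); have [eps0 _] := andP eps01.
rewrite /trap_prob -!mulrA; apply: ler_wpM2l; first exact: ltW.
apply: ler_wpM2l; first by rewrite exprn_ge0// ltW.
have pos3 : 0 <= 3 ^- r :> R by rewrite invr_ge0 exprn_ge0.
apply: ler_pM; first by rewrite exprn_ge0.
- by rewrite mulr_ge0.
- apply: lerXn2r; rewrite ?nnegrE; move: del01; lra.
- by apply: ler_pM => //; lra.
Qed.

(** * Exploration down to depth [rho] and the estimate at one scale *)

Definition explored : {fset I} :=
  ((\bigcup_(k <- iota 0 n.+1) [fset bit_coord k v | v in tball T (rho + 2 * r) o]) `|`
   ([fset add_coord (edge u) | u in tball T rho o `\ o] `|`
    [fset del_coord (edge u) | u in tball T rho o `\ o]))%fset.

Lemma in_explored c : c \in explored ->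
  (exists k v, [/\ verts T v, v \in tball T (rho + 2 * r) o & c = bit_coord k v]) \/
  (exists u, [/\ verts T u, u != o, (depth u <= rho)%N & c = add_coord (edge u) \/ c = del_coord (edge u)]).
Proof.
have tb u : u \in (tball T rho o `\ o)%fset -> [/\ verts T u, u != o & (depth u <= rho)%N].
  rewrite !inE => /andP[uo ur]; split=> //; first exact: (tball_verts hT vo ur).
  exact: depth_min.
case/fsetUP=> [/bigfcupP[k _ /imfsetP[v /= vr ->]]|/fsetUP[|] /imfsetP[u /= /tb[vu uo du] ->]].
- by left; exists k, v; split=> //; exact: (tball_verts hT vo vr).
- by right; exists u; split=> //; left.
- by right; exists u; split=> //; right.
Qed.

Lemma trap_coords_cases x c : x \in desc rho o -> c \in trap_coords (tip x) ->
  (exists k v, [/\ verts T v, v \in tball T (3 * r) (tip x) & c = bit_coord k v]) \/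
  (exists u, [/\ verts T u, u != o, (rho < depth u)%N, in_subtree T o x u &
     c = add_coord (edge u) \/ c = del_coord (edge u)]).
Proof.
move=> xr; have [vx dx vy dy yx] := tip_facts xr; set y := tip x in vy dy yx *.
have below u : verts T u -> (depth y < depth u)%N -> in_subtree T o y u ->
    (rho < depth u)%N /\ in_subtree T o x u.
  move=> vu du yu; split; first by move: du; rewrite dy; clear; lia.
  exact: (desc_in_subtree hT vo vx (desc_trans hT vo vx yx yu)).
case/fsetUP=> [/in_spine_on[->|[i iL ->]]|/fsetUP[/in_spine_off[i iL ->]|/fsetUP[|]]].
- by left; exists n, y; split=> //; exact: (tball_center hT).
- right; have [v1 n1 _ d1 s1] := spine_facts xr iL.
  by exists (iter i parent y); split=> //; left.
- right; have [v1 n1 _ d1 s1] := spine_facts xr iL.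
  by exists (iter i parent y); split=> //; right.
- move=> /(bush_coords_cases vy)[_ [[k [v [vv vk cE]]]|[u [vu uo du yu cE]]]].
    by left; exists k, v.
  by right; exists u; have [h1 h2] := below u vu du yu; split=> //; right.
- move=> /(leak_coords_cases vy)[u [vu uo du yu cE]].
  by right; exists u; have [h1 h2] := below u vu du yu; split=> //; left.
Qed.

Lemma bit_coord_inj k v k' v' : verts T v -> verts T v' -> bit_coord k v = bit_coord k' v' -> v = v'.
Proof. by move=> vv vv' [_]; exact: code_inj. Qed.

Lemma edge_coord_inj c u u' : verts T u -> u != o -> verts T u' -> u' != o ->
  (c = add_coord (edge u) \/ c = del_coord (edge u)) -> (c = add_coord (edge u') \/ c = del_coord (edge u')) -> u = u'.
Proof.
move=> v1 n1 v2 n2 h1 h2; apply: (edge_inj hT vo v1 n1 v2 n2).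
case: h1 => c1; case: h2 => c2; move: c2; rewrite c1 => //; [exact: add_coord_inj|exact: del_coord_inj].
Qed.

Lemma same_subtree x x' u : x \in desc rho o -> x' \in desc rho o ->
  in_subtree T o x u -> in_subtree T o x' u -> x = x'.
Proof.
move=> xr x'r; have [vx dx _ _ _] := tip_facts xr; have [vx' dx' _ _ _] := tip_facts x'r.
move=> /(descP hT vo _ _ vx)[_ _ h] /(descP hT vo _ _ vx')[_ _ h'].
by rewrite -h -h' dx dx'.
Qed.

Lemma trap_explored_disj x c : x \in desc rho o -> c \in trap_coords (tip x) ->
  c \in explored -> False.
Proof.
move=> xr; have [vx dx vy dy yx] := tip_facts xr.
move=> /(trap_coords_cases xr)[[k [v [vv vy3 ->]]]|[u [vu uo du _ cu]]] /in_explored[].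
- move=> [k' [v' [vv' vk' /(bit_coord_inj vv vv') vE]]]; rewrite -vE in vk'.
  have := depth_tball hT vo vv (tball_sym hT vy3); have := depth_min vk'; rewrite dy.
  clear -r2; lia.
- by move=> [u [_ _ _ []]].
- by move=> [k [v [_ _ cE]]]; case: cu; rewrite cE.
- move=> [u' [vu' uo' du' cu']]; move: du'.
  by rewrite -(edge_coord_inj vu uo vu' uo' cu cu') leqNgt du.
Qed.

(** A common bit would give a walk of length [6 * r] between the two tips, but leaving the subtree
    of [x] from its tip takes more than [7 * r] steps. Common edges lie in both subtrees, which are
    disjoint for distinct vertices of equal depth. *)
Lemma trap_disj x x' c : x \in desc rho o -> x' \in desc rho o ->
  c \in trap_coords (tip x) -> c \in trap_coords (tip x') -> x = x'.
Proof.
move=> xr x'r; have [vx dx vy dy yx] := tip_facts xr; have [vx' dx' vy' dy' yx'] := tip_facts x'r.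
move=> /(trap_coords_cases xr) h /(trap_coords_cases x'r) h'.
case: h h' => [[k [v [vv vk ->]]]|[u [vu uo du xu cu]]] [].
- move=> [k' [v' [vv' vk' /(bit_coord_inj vv vv') vE]]]; rewrite -vE in vk'.
  have near := tball_trans hT vk (tball_sym hT vk').
  have xy := desc_in_subtree hT vo vx yx; have xy' := desc_in_subtree hT vo vx' yx'.
  have [xy2|nxy2] := boolP (in_subtree T o x (tip x')); first exact: same_subtree xy2 xy'.
  have [_ _] := subtree_exit hT vo vx xy near nxy2; rewrite dy dx.
  by clear -r2; lia.
- by move=> [u [_ _ _ _ []]].
- by move=> [k [v [_ _ cE]]]; case: cu; rewrite cE.
- move=> [u' [vu' uo' du' xu' cu']]; have uE := edge_coord_inj vu uo vu' uo' cu cu'.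
  by rewrite -uE in xu'; exact: same_subtree xu xu'.
Qed.

(** The equivalence fixes the reached set exactly, so the events for different [s] are disjoint and
    their probabilities sum to at most one. *)
Definition reached (s : {fset V}) : set Om :=
  [set t | forall x, x \in desc rho o -> (x \in s <-> upopen o e0 (perturbed `I_n.+1 t) rho x)].

(** A hole of scale at most [n] touching an edge above depth [rho] has its centre within
    [rho + 2 * r] of the root, so its bit is explored. *)
Lemma depends_on_reached s : depends_on X [set` explored] (reached s).
Proof.
suff dep x : x \in desc rho o -> forall t t',
    (forall c, c \in explored -> (X c t <-> X c t')) ->
    upopen o e0 (perturbed `I_n.+1 t) rho x -> upopen o e0 (perturbed `I_n.+1 t') rho x.
  move=> t t' tt' h x xr; have {}h := h x xr; split.
    by move=> /h; exact: dep.
  by move=> h'; apply/h; move: h'; apply: dep => // c /tt' [? ?]; split.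
move=> xr t t' tt' ox i ir; set u := iter i parent x.
have [vu du uo] := desc_iter_facts vo xr ir; rewrite -/u depth_root// add0n in vu du uo.
have ub : u \in (tball T rho o `\ o)%fset.
  rewrite !inE uo; apply: (tball_le hT _ (depth_ball hT vo vu)).
  by rewrite du; clear; lia.
have eadd : add_coord (edge u) \in explored.
  by apply/fsetUP; right; apply/fsetUP; left; apply/imfsetP; exists u.
have edel : del_coord (edge u) \in explored.
  by apply/fsetUP; right; apply/fsetUP; right; apply/imfsetP; exists u.
have [ho hd] := ox i ir; split; last by move=> /(tt' _ edel); exact: hd.
case: ho => [ho|/(tt' _ eadd)]; [left|by right].
move=> k v kn vv hv; have := ho k v kn vv hv; apply: contra_not => /tt'; apply.
apply/fsetUP; left; apply/bigfcupP; exists k; first by rewrite mem_iota kn.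
apply/imfsetP; exists v => //=; rewrite addnC; apply: (tball_le hT (n := rho + 2 * r)).
  by rewrite addnC.
have [|uv _] := hv u; first by rewrite (edgeE hT)// !inE eqxx.
have urho : u \in tball T rho o by move: ub; rewrite !inE => /andP[].
apply: (tball_le hT _ (tball_trans hT urho (tball_sym hT uv))).
by have := rad_le kn; clear; lia.
Qed.

Lemma trap_prob01 : 0 <= trap_prob <= 1.
Proof.
have [x xr] := ex_desc hT vo rho vo; have h := prob_trapped xr.
have mt : measurable [set t | trapped (tip x) t].
  by apply: depends_on_measurable (@depends_on_trapped (tip x)).
rewrite (le_trans h (prob_le1 P mt)) andbT /trap_prob.
have [th0 _] := andP (th01 n); have [eps0 _] := andP eps01.
by rewrite !mulr_ge0 ?invr_ge0 ?exprn_ge0 ?invr_ge0 ?ltW.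
Qed.

Definition expanding_edges : seq (edges T) := [seq edge u | u <- enum_fset (tball T D.+1 o)].

Lemma expanding_depends_on : depends_on (fun e (w : set (edges T)) => w e)
  [set` expanding_edges] (expanding o e0 M D).
Proof.
move=> w w' ww'; apply: expanding_depends => u vu uo du; apply: ww'.
apply: map_f; exact: (tball_le hT du (depth_ball hT vo vu)).
Qed.

Lemma measurable_perturbed_edge A e : (forall e, measurable [set t | holesX A t e]) ->
  measurable [set t | perturbed A t e].
Proof.
move=> mh; have mdel : measurable [set t | ~ delX t e] by apply: measurableC; exact: mX.
have madd : measurable [set t | addX t e] by exact: mX.
exact: measurableI (measurableU _ _ (mh e) madd) mdel.
Qed.

Lemma measurable_expanding A : (forall e, measurable [set t | holesX A t e]) ->
  measurable [set t | expanding o e0 M D (perturbed A t)].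
Proof.
move=> mh; apply: (@depends_on_preimage _ _ _ _ expanding_edges (expanding o e0 M D)).
  by move=> e; exact: measurable_perturbed_edge.
exact: expanding_depends_on.
Qed.

(* Given the explored part, the trap events are independent over the
   reached vertices at depth [rho]; expansion forces many of them. *)
Lemma prob_expanding_truncated N0 : (0 < rho)%N ->
  (4 * M * (rho + L) < 2 ^ r.-1)%N -> (M ^ rho * N0 <= M.+1 ^ rho.-1)%N ->
  prob P [set t | expanding o e0 M D (perturbed `I_n.+1 t)] <= (1 - trap_prob) ^+ N0.
Proof.
move=> rho0 big hN0.
pose ss : seq {fset V} := [seq s <- enum_fset (fpowerset (desc rho o)) | (N0 <= #|` s|)%N].
pose A s := reached s `&` [set t | forall x, x \in enum_fset s -> ~ trapped (tip x) t].
have dT x : depends_on X [set` trap_coords (tip x)] (~` [set t | trapped (tip x) t]).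
  by apply: depends_onC; exact: depends_on_trapped.
have mtr x : measurable [set t | trapped (tip x) t].
  by apply: depends_on_measurable (@depends_on_trapped (tip x)).
have mB s : measurable (reached s) by apply: depends_on_measurable (@depends_on_reached s).
have mA s : measurable (A s).
  apply: measurableI => //.
  apply: (@depends_on_measurable _ _ _ X
    (flatten [seq enum_fset (trap_coords (tip x)) | x <- enum_fset s])) => //.
  apply: depends_on_all => x xs; apply: (depends_onW _ (dT x)) => c cx.
  by apply/flattenP; exists (enum_fset (trap_coords (tip x))) => //; apply: map_f.
have sub (s : {fset V}) x : s \in ss -> x \in enum_fset s -> x \in desc rho o.
  by rewrite mem_filter fpowersetE => /andP[_ /fsubsetP h] /h.
have [g0 g1] := andP trap_prob01.
have PA (s : {fset V}) : s \in ss -> prob P (A s) <= prob P (reached s) * (1 - trap_prob) ^+ N0.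
  move=> sss; rewrite /A.
  have := @depends_indep_all _ _ _ P _ X _ mX indepX V (enum_fset s)
    (fun x => ~` [set t | trapped (tip x) t]) (fun x => enum_fset (trap_coords (tip x)))
    (reached s) (enum_fset explored).
  move=> ->//.
  - apply: ler_wpM2l; first exact: prob_ge0.
    have sN0 : (N0 <= #|` s|)%N by move: sss; rewrite mem_filter => /andP[].
    apply: (@le_trans _ _ ((1 - trap_prob) ^+ #|` s|)); last first.
      by apply: ler_wiXn2l => //; lra.
    have -> : (1 - trap_prob) ^+ #|` s| = \prod_(x <- enum_fset s) (1 - trap_prob).
      by rewrite big_const_seq count_predT iter_mulr_1.
    rewrite big_seq [leRHS]big_seq; apply: ler_prod => x xs.
    rewrite prob_ge0 /= probC//; have := prob_trapped (sub s x sss xs).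
    by move: (prob P _) => q; lra.
  - exact: depends_on_reached.
  - by move=> x xs; exact: dT.
  - by move=> x c xs; exact: (trap_explored_disj (sub s x sss xs)).
  - by move=> x x' c xs x's; exact: (trap_disj (sub s x sss xs) (sub s x' sss x's)).
have mE := measurable_expanding (measurable_hole_edge n.+1).
apply: (@le_trans _ _ (prob P [set t | exists2 s, s \in ss & A s t])).
  apply: prob_le => //.
    rewrite (_ : mkset _ = \big[setU/set0]_(s <- ss) A s); first exact: bigsetU_measurable.
    by rewrite -bigcup_seq; apply/seteqP; split=> t [s ? ?]; exists s.
  move=> t ew; set w := perturbed `I_n.+1 t in ew.
  pose s := [fset x in desc rho o | `[< upopen o e0 w rho x >]]%fset.
  have inS x : x \in s <-> x \in desc rho o /\ upopen o e0 w rho x.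
    by rewrite !inE /=; split=> [/andP[-> /asboolP]//|[-> /asboolP->]].
  exists s.
    rewrite mem_filter fpowersetE; apply/andP; split; last by apply/fsubsetP => x /inS[].
    (* Growth is applied at [rho - 1], where it bounds the sphere of radius [rho] from below. *)
    have rhoD : (rho.-1 < D)%N by move: rho0; clear -rho; lia.
    have := expanding_growth ew rhoD; rewrite prednK//.
    rewrite (_ : [fset z in desc rho o | `[< conn o e0 w z >]]%fset = s); last first.
      apply/fsetP => x; rewrite !inE /=; apply: andb_id2l => xr.
      by have [_ dx _ _ _] := tip_facts xr; rewrite /conn dx.
    move=> hM; have M0 : (0 < M)%N.
      rewrite lt0n; apply/eqP => M0; move: hM.
      by rewrite M0 exp0n// mul0n leqn0 expn_eq0.
    by have := leq_trans hN0 hM; rewrite leq_pmul2l// expn_gt0 M0.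
  split; first by move=> x xr; split=> [/inS[]//|ox]; apply/inS.
  by move=> x /inS[xr ox] tr; exact: trapped_not_expanding xr ox tr big ew.
apply: le_trans (prob_union_le _ _ mA) _.
apply: (@le_trans _ _ (\sum_(s <- ss) prob P (reached s) * (1 - trap_prob) ^+ N0)).
  by rewrite big_seq [leRHS]big_seq; exact: ler_sum.
rewrite -mulr_suml ler_piMl//; first by rewrite exprn_ge0//; lra.
apply: prob_partition_le => //; first by rewrite filter_uniq// fset_uniq.
move=> s s' t sss s'ss Bs Bs'; apply/fsetP => x; apply/idP/idP => xs.
  by have xr := sub s x sss xs; apply/(Bs' x xr)/(Bs x xr).
by have xr := sub s' x s'ss xs; apply/(Bs x xr)/(Bs' x xr).
Qed.

End Scale.

(** * Holes of scales beyond the truncation *)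

Lemma prob_X c : prob P (X c) = p c.
Proof.
have := indepX [fset c]%fset; rewrite big_seq_fset1 => <-; congr prob.
by rewrite bigcap_fset big_seq_fset1.
Qed.

Definition active k m : set Om :=
  [set t | exists2 v, v \in enum_fset (tball T m o) & X (bit_coord k v) t].

Lemma measurable_active k m : measurable (active k m).
Proof.
rewrite (_ : active k m = \big[setU/set0]_(v <- enum_fset (tball T m o)) X (bit_coord k v)).
  by apply: bigsetU_measurable => v _; exact: mX.
by rewrite -bigcup_seq; apply/seteqP; split=> t [v ? ?]; exists v.
Qed.

Lemma prob_active k m : prob P (active k m) <= th k * 5 ^+ m.
Proof.
apply: le_trans (prob_union_le _ _ (fun v => mX (bit_coord k v))) _.
rewrite (eq_bigr (fun=> th k)); last by move=> v _; rewrite prob_X.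
rewrite big_const_seq count_predT iter_addr_0 -[leLHS]mulr_natr.
apply: ler_wpM2l; first by have /andP[/ltW] := th01 k.
by rewrite -natrX ler_nat card_tball.
Qed.

(** Some hole of a scale above [n] is placed so that it could touch the ball of radius [m]. *)
Definition far n m : set Om := \bigcup_j active (n.+1 + j) (2 * Rad (n.+1 + j) + m).

Lemma measurable_far n m : measurable (far n m).
Proof. by apply: bigcupT_measurable => j; exact: measurable_active. Qed.

(** Countable union bound: the sum of [2 ^- k] over [k] above [n] is [2 ^- n]. *)
Lemma prob_far n m :
  (forall k, (n < k)%N -> th k * 5 ^+ (2 * Rad k + m) <= 2 ^- k) -> prob P (far n m) <= 2 ^- n.
Proof.
move=> hth; have mf := measurable_far n m; rewrite -lee_fin -probE//.
have e0' : 0 <= 2 ^- n :> R by rewrite invr_ge0 exprn_ge0.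
have PA j : (P (active (n.+1 + j) (2 * Rad (n.+1 + j) + m)) <=
    (2 ^- n / (2 ^ j.+1)%:R)%:E)%E.
  rewrite probE; last exact: measurable_active.
  rewrite lee_fin (le_trans (prob_active _ _))// (le_trans (hth _ _))//.
    by rewrite ltnS leq_addr.
  by rewrite addSnnS exprD invfM natrX.
have := @measure_sigma_subadditive _ _ _ P _ (fun j => active (n.+1 + j) (2 * Rad (n.+1 + j) + m))
  (fun j => measurable_active _ _) mf (fun=> id).
move=> /le_trans; apply; apply: le_trans (epsilon_trick0 xpredT e0').
by apply: lee_nneseries => j _ //; exact: PA.
Qed.

Lemma expanding_not_far n M m t : ~ far n m.+1 t ->
  expanding o e0 M m (perturbed setT t) -> expanding o e0 M m (perturbed `I_n.+1 t).
Proof.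
move=> nfar; apply: expanding_depends => u vu uo du.
split=> -[[h|h] nd]; split=> //; try by right.
  by left; have /holesT := h; apply.
left=> k v _ vv hv; have [kn|nk] := ltnP k n.+1; first exact: h.
move=> Xk; apply: nfar; exists (k - n.+1)%N => //; rewrite subnKC//.
exists v => //; rewrite addnC.
have [|uv _] := hv u; first by rewrite (edgeE hT)// !inE eqxx.
apply: (tball_trans hT _ (tball_sym hT uv)).
exact: (tball_le hT du (depth_ball hT vo vu)).
Qed.

End Model.

(** * Choice of the scales *)

Definition base_radius n := (5 ^ n * (n.+1)`!)%N.
(** The factor 10 serves [radius_big]: with [q = base_radius n] at least 3, the exponent
    [10 * q - 1] is at least [3 * q + 14], enough for a cubic polynomial in [q]. *)
Definition radius n := (10 * base_radius n)%N.

(* The factor [5 (n + 2)] between consecutive radii makes the bits of scale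
   larger than [n] negligible up to depth [trap_depth n + 9 * radius n], while
   the growth at depth [trap_depth n] beats [(theta n)^-1 = 2 ^ (20 * radius n)]. *)
Definition trap_depth n := (n * (20 * radius n))%N.

Lemma base_radius_gt n : (n < base_radius n)%N.
Proof.
have h : (n < 5 ^ n)%N by exact: ltn_expl.
by apply: (leq_trans h); rewrite leq_pmulr// fact_gt0.
Qed.

Lemma radiusS n : radius n.+1 = (5 * n.+2 * radius n)%N.
Proof. by rewrite /radius /base_radius expnS [(n.+2)`!]factS; nia. Qed.

Lemma radius_le m n : (m <= n)%N -> (radius m <= radius n)%N.
Proof.
move=> /subnKC <-; elim: (n - m)%N => [|k IH]; first by rewrite addn0.
by rewrite addnS (leq_trans IH)// radiusS leq_pmull.
Qed.

Lemma radius_ge n : (n.+1 <= radius n)%N.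
Proof. by apply: (leq_trans (base_radius_gt n)); rewrite leq_pmull. Qed.

Lemma radius_ge2 n : (2 <= radius n)%N.
Proof. by have := base_radius_gt n; rewrite /radius; lia. Qed.

(** The size of the bush against [M] times the boundary bound: exponential in the radius on one
    side, at most cubic in [base_radius n] on the other. *)
Lemma radius_big n M : (0 < n)%N -> (M <= n)%N ->
  (4 * M * (trap_depth n + 7 * radius n) < 2 ^ (radius n).-1)%N.
Proof.
move=> n0 Mn; rewrite /trap_depth /radius; set q := base_radius n.
have q3 : (3 <= q)%N.
  rewrite /q /base_radius -(prednK n0) expnS -mulnA (@leq_trans 5)//.
  by rewrite leq_pmulr// muln_gt0 expn_gt0 fact_gt0.
have nq : (n <= q)%N by exact: ltnW (base_radius_gt n).
have q2 : (q < 2 ^ q)%N by exact: ltn_expl.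
apply: (@leq_ltn_trans (2 ^ 14 * (q * q * q))).
  have : (4 * M * (n * (20 * (10 * q)) + 7 * (10 * q)) <= 4 * q * (q * (20 * (10 * q)) + 7 * q * (10 * q)))%N.
    by nia.
  move=> /leq_trans; apply.
  have -> : (4 * q * (q * (20 * (10 * q)) + 7 * q * (10 * q)) = 1080 * (q * q * q))%N by nia.
  by rewrite leq_mul2r orbC.
apply: (@leq_trans (2 ^ 14 * (2 ^ q * 2 ^ q * 2 ^ q))).
  by rewrite ltn_pmul2l ?expn_gt0//; do 2 apply: ltn_mul => //.
rewrite -!expnD leq_exp2l//; lia.
Qed.

Section Weights.
Context {R : realType}.

Definition theta n : R := 2 ^- (20 * radius n).

Lemma theta01 n : 0 < theta n < 1.
Proof.
rewrite /theta invr_gt0 exprn_gt0//= invf_lt1 ?exprn_gt0// exprn_egt1 ?ltr1n//.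
by rewrite muln_eq0 /= -lt0n; exact: ltnW (radius_ge2 n).
Qed.

(** Since [5 ^ 6 = 15625] and [2 ^ 14 = 16384]. *)
Lemma pow5_le m : (5 : R) ^+ (6 * m) <= 2 ^+ (14 * m).
Proof.
rewrite !exprM; apply: lerXn2r; rewrite ?nnegrE ?exprn_ge0//.
by rewrite -!natrX ler_nat.
Qed.

(** The factor [2 ^- (20 * radius n)] pays for balls of radius up to [6 * radius n], of size at most
    [2 ^ (14 * radius n)], and [2 ^- (6 * radius n)] is left. *)
Lemma theta_le n m : (m <= 6 * radius n)%N -> theta n * 5 ^+ m <= 2 ^- (6 * radius n).
Proof.
move=> mn; rewrite /theta.
have h : (5 : R) ^+ m <= 2 ^+ (14 * radius n).
  by apply: le_trans (pow5_le _); apply: ler_weXn2l => //; lra.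
rewrite mulrC ler_pdivrMr ?exprn_gt0//; apply: (le_trans h).
rewrite (_ : 20 * radius n = 6 * radius n + 14 * radius n)%N; last by lia.
by rewrite exprD mulKf// gt_eqF// exprn_gt0.
Qed.

Lemma theta_sum N : \sum_(k < N) theta k * 5 ^+ (2 * radius k) <= 10^-1.
Proof.
have h k : theta k * 5 ^+ (2 * radius k) <= 2^-1 ^+ k * 32^-1.
  apply: le_trans (theta_le _) _; first by have := radius_ge2 k; lia.
  rewrite -exprVn; have -> : (32^-1 : R) = 2^-1 ^+ 5 by rewrite exprVn -natrX.
  rewrite -exprD; apply: ler_wiXn2l; [lra|lra|]; have := radius_ge k; lia.
apply: (@le_trans _ _ (16^-1 - 16^-1 * 2^-1 ^+ N)).
  elim: N => [|N IH]; first by rewrite big_ord0 expr0; lra.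
  by rewrite big_ord_recr /= exprS; have := h N; lra.
have : 0 <= 2^-1 ^+ N :> R by rewrite exprn_ge0.
lra.
Qed.

(** By [radiusS], [4 * radius k] is at least [(20 * n + 40) * radius n], which covers
    [trap_depth n + 9 * radius n + 1]. The total radius is thus at most [6 * radius k], as
    [theta_le] demands. *)
Lemma theta_far n k : (n < k)%N ->
  theta k * 5 ^+ (2 * radius k + (trap_depth n + 9 * radius n).+1) <= 2 ^- k.
Proof.
move=> nk; have r1 := radius_ge n; have rk := radius_le nk; rewrite radiusS in rk.
apply: (le_trans (theta_le _)).
  rewrite /trap_depth; move: rk r1; move: (radius n) (radius k) => x y; nia.
rewrite lef_pV2 ?posrE ?exprn_gt0//; apply: ler_weXn2l; first by lra.
by have := radius_ge k; lia.
Qed.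

(** Bernoulli's inequality: the first two terms in the expansion of [M.+1 ^ M] both equal
    [M ^ M]. *)
Lemma pow_ratio M : (0 < M)%N -> (2 * M ^ M <= M.+1 ^ M)%N.
Proof.
move=> M0; have h k : (M ^ k + k * M ^ k.-1 <= M.+1 ^ k)%N.
  elim: k => [|k IH]; first by rewrite mul0n addn0.
  rewrite [leqRHS]expnS; apply: leq_trans (leq_mul (leqnn _) IH).
  case: k {IH} => [|k]; first by rewrite /= !expn0 mul0n; lia.
  by rewrite /= !expnS; nia.
have := h M; case: (M) M0 => // m _ /=; rewrite [in X in (_ <= X -> _)%N]expnS.
by rewrite !expnS; nia.
Qed.

(** [trap_depth n] is [M] times [20 * b * radius n], and each block of [M] generations doubles by
    [pow_ratio]. The loss [2 ^ M] pays for the one missing factor [M.+1]. *)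
Lemma many_reached M b n : (0 < M)%N -> n = (M * b)%N -> (0 < n)%N ->
  (M ^ trap_depth n * 2 ^ (20 * b * radius n - M) <= M.+1 ^ (trap_depth n).-1)%N.
Proof.
move=> M0 nE n0; set R0 := radius n.
have rhoE : trap_depth n = (M * (20 * b * R0))%N by rewrite /trap_depth -/R0 nE; nia.
have Mb : (M <= 20 * b * R0)%N.
  have b0 : (0 < b)%N by move: n0; rewrite nE muln_gt0 => /andP[].
  have : (M <= R0)%N by apply: leq_trans (ltnW (radius_ge n)); rewrite nE leq_pmulr.
  by nia.
have rho0 : (0 < trap_depth n)%N by rewrite rhoE; move: Mb; nia.
have key : (M ^ trap_depth n * 2 ^ (20 * b * R0) <= M.+1 ^ trap_depth n)%N.
  rewrite rhoE [(M ^ _)%N]expnM [(M.+1 ^ _)%N]expnM mulnC -expnMn leq_exp2r ?pow_ratio//.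
  exact: leq_trans M0 Mb.
have M2 : (M.+1 <= 2 ^ M)%N by exact: ltn_expl.
rewrite -(@leq_pmul2l (2 ^ M)) ?expn_gt0// mulnCA -expnD subnKC//.
apply: (leq_trans key); rewrite -{1}(prednK rho0) expnS.
by rewrite leq_mul2r M2 orbT.
Qed.

(** Rational substitute for bounding [(1 - g) ^ N] by an exponential. *)
Lemma bernoulli_bound (g : R) N : 0 <= g <= 1 -> (1 - g) ^+ N * (1 + N%:R * g) <= 1.
Proof.
move=> /andP[g0 g1]; elim: N => [|N IH]; first by rewrite expr0; lra.
apply: le_trans IH; rewrite exprSr -mulrA; apply: ler_wpM2l; first by rewrite exprn_ge0//; lra.
rewrite -[N.+1]addn1 natrD; have : 0 <= N%:R :> R by []; nra.
Qed.

End Weights.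

(** The exponents per unit of radius add up as 20 for the bit, [7 * a] for the added spine, 7 for
    the deletions, 2 for the bush and 1 for the leak. *)
Lemma trap_prob_ge (R : realType) (eps : R) a n : 2 ^- a <= eps ->
  2 ^- ((7 * a + 30) * radius n) <= trap_prob radius theta eps n.
Proof.
move=> ha; rewrite /trap_prob /theta; have := ltnW (radius_ge2 n).
move: (radius n) => r r1.
have pow0 k : 0 < (2 : R) ^- k by rewrite invr_gt0 exprn_gt0.
have h1 : 2 ^- (a * (7 * r)) <= eps ^+ (7 * r).
  have -> : 2 ^- (a * (7 * r)) = (2 ^- a) ^+ (7 * r) :> R by rewrite exprM exprVn.
  apply: lerXn2r; rewrite ?nnegrE//.
  exact: le_trans (ltW (pow0 a)) ha.
have h2 : 2 ^- (7 * r) <= 2^-1 ^+ (7 * r) :> R by rewrite exprVn.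
have h3 : 2 ^- (2 * r) <= 3 ^- r :> R.
  rewrite lef_pV2 ?posrE ?exprn_gt0// exprM; apply: lerXn2r; rewrite ?nnegrE ?exprn_ge0//.
  by rewrite expr2; lra.
have h4 : 2 ^- r <= 2^-1 :> R.
  rewrite lef_pV2 ?posrE ?exprn_gt0// -[leLHS]expr1.
  by apply: ler_weXn2l => //; lra.
have -> : 2 ^- ((7 * a + 30) * r) =
    2 ^- (20 * r) * 2 ^- (a * (7 * r)) * 2 ^- (7 * r) * 2 ^- (2 * r) * 2 ^- r :> R.
  by rewrite -!invfM -!exprD; congr (_ ^- _); lia.
by do 4 (apply: ler_pM => //; try by rewrite ?mulr_ge0// ltW).
Qed.

(** One term [2 ^- n] bounds the interference of larger scales, the other the absence of a trap
    among the reached vertices. *)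
Lemma prob_expanding (V : choiceType) (T : graph V) (hT : regular_tree 4 T)
    (code : V -> nat) (code_inj : forall x y, verts T x -> verts T y -> code x = code y -> x = y)
    (o : V) (e0 : edges T) (vo : verts T o)
    (R : realType) d (Om : measurableType d) (P : probability Om R)
    (X : nat * nat + (edges T + edges T) -> set Om) (eps del : R) (a b M n : nat) :
  (forall i, measurable (X i)) ->
  (forall F : {fset nat * nat + (edges T + edges T)},
     prob P (\bigcap_(i in [set` F]) X i) = \prod_(i <- F) coord_prob theta eps del i) ->
  0 < eps <= 32^-1 -> 0 < del <= 10^-1 -> 2 ^- a <= eps ->
  (0 < M)%N -> (a + 2 <= b)%N -> n = (M * b)%N ->
  prob P [set t | expanding o e0 M (trap_depth n + 9 * radius n) (perturbed code radius X setT t)]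
    <= 2 * 2 ^- n.
Proof.
move=> mX indepX eps01 del01 ha M0 ab nE.
have b0 : (0 < b)%N by lia.
have Mn : (M <= n)%N by rewrite nE leq_pmulr.
have n0 : (0 < n)%N by exact: leq_trans M0 Mn.
have rho0 : (0 < trap_depth n)%N.
  by rewrite /trap_depth muln_gt0 n0 muln_gt0; exact: ltnW (radius_ge2 n).
have th01 := @theta01 R; have th_sum := @theta_sum R.
have radle k : (k <= n)%N -> (radius k <= radius n)%N by exact: radius_le.
pose N0 := (2 ^ (20 * b * radius n - M))%N.
have trunc := prob_expanding_truncated hT code_inj e0 vo mX indepX th01 th_sum eps01 del01
  (radius_ge2 n) radle rho0 (radius_big n0 Mn) (many_reached M0 nE n0).
have hfar := prob_far hT code o mX indepX th01 (@theta_far R n).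
set D := (trap_depth n + 9 * radius n)%N in trunc hfar *.
have mh A : (forall e, measurable [set t | holesX code radius X A t e]) ->
    measurable [set t | expanding o e0 M D (perturbed code radius X A t)].
  by move=> mh; exact (measurable_expanding hT e0 vo mX n (trap_depth n) M mh).
have mT := mh setT (measurable_hole_edgeT hT code radius mX).
have mN := mh `I_n.+1 (measurable_hole_edge hT code radius mX n.+1).
have mfar := measurable_far code radius o mX n D.+1.
apply: (@le_trans _ _ (prob P ([set t | expanding o e0 M D (perturbed code radius X `I_n.+1 t)] `|`
    (~` [set t | expanding o e0 M D (perturbed code radius X `I_n.+1 t)] `&` far code radius o X n D.+1)))).
  apply: prob_le => //.
    by apply: measurableU => //; apply: measurableI => //; exact: measurableC.
  move=> t et; have [h|h] := pselect (expanding o e0 M D (perturbed code radius X `I_n.+1 t)); [by left|].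
  right; split=> //; apply: contrapT => nf; apply: h.
  exact: (expanding_not_far hT vo nf).
rewrite probU//; last first.
- by apply/seteqP; split=> t // [? []].
- by apply: measurableI => //; exact: measurableC.
rewrite mulr_natl mulr2n; apply: lerD; last first.
  apply: le_trans hfar; apply: prob_le => //.
  by apply: measurableI => //; exact: measurableC.
apply: (le_trans trunc); set g := trap_prob _ _ _ _.
have g01 : 0 <= g <= 1.
  exact: (trap_prob01 hT code e0 vo mX indepX th01 th_sum eps01 del01 n (radius_ge2 n) radle).
have big : 2 ^+ n <= 1 + N0%:R * g.
  have Rn := ltnW (radius_ge n).
  (* Both [n] and [M] are at most [radius n], so [7 * a + 32] must not exceed [20 * b]; this follows
     from [a + 2 <= b]. *)
  have hexp : (n + (7 * a + 30) * radius n <= 20 * b * radius n - M)%N.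
    have Mr : (M <= radius n)%N by exact: leq_trans Mn Rn.
    have : ((7 * a + 32) * radius n <= 20 * b * radius n)%N by rewrite leq_mul2r; lia.
    by rewrite !mulnDl; lia.
  have h := trap_prob_ge n ha; rewrite -/g in h.
  apply: (@le_trans _ _ (N0%:R * 2 ^- ((7 * a + 30) * radius n))).
    rewrite ler_pdivlMr ?exprn_gt0// -exprD /N0 natrX; apply: ler_weXn2l => //; lra.
  apply: (@le_trans _ _ (N0%:R * g)); first by apply: ler_wpM2l.
  by rewrite lerDr.
have := bernoulli_bound N0 g01 => hb.
have pos : 0 < (2 : R) ^+ n by rewrite exprn_gt0.
rewrite -[leRHS]mul1r ler_pdivlMr//; apply: le_trans hb.
by apply: ler_wpM2l => //; apply: exprn_ge0; lra.
Qed.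

(** * Transfer to an arbitrary probability space *)

Lemma fset_sum3 (A B C : choiceType) (F : {fset A + (B + C)}) :
  exists (F1 : {fset A}) (F2 : {fset B}) (F3 : {fset C}),
  [/\ forall a, (inl a \in F) = (a \in F1), forall b, (inr (inl b) \in F) = (b \in F2),
      forall c, (inr (inr c) \in F) = (c \in F3) &
      forall (R : comPzSemiRingType) (f : A + (B + C) -> R), \prod_(i <- F) f i =
        \prod_(a <- F1) f (inl a) *
        (\prod_(b <- F2) f (inr (inl b)) * \prod_(c <- F3) f (inr (inr c)))].
Proof.
pose pa (i : A + (B + C)) := if i is inl a then Some a else None.
pose pb (i : A + (B + C)) := if i is inr (inl b) then Some b else None.
pose pc (i : A + (B + C)) := if i is inr (inr c) then Some c else None.
have in_pmap (K : choiceType) (f : A + (B + C) -> option K) (g : K -> A + (B + C)) k :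
    ocancel f g -> pcancel g f -> (g k \in F) = (k \in [fset k in pmap f F]%fset).
  move=> fg gf; rewrite inE mem_pmap /=; apply/idP/mapP => [gk|[i iF fi]].
    by exists (g k); rewrite ?gf.
  by have := fg i; rewrite -fi /= => ->.
exists [fset k in pmap pa F]%fset, [fset k in pmap pb F]%fset, [fset k in pmap pc F]%fset.
have Ha a : (inl a \in F) = (a \in [fset k in pmap pa F]%fset).
  by apply: in_pmap => //; case.
have Hb b : (inr (inl b) \in F) = (b \in [fset k in pmap pb F]%fset).
  by apply: (in_pmap _ pb (fun b => inr (inl b))) => //; case=> // -[].
have Hc c : (inr (inr c) \in F) = (c \in [fset k in pmap pc F]%fset).
  by apply: (in_pmap _ pc (fun c => inr (inr c))) => //; case=> // -[].
split=> // R f; move: Ha Hb Hc.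
move: [fset k in pmap pa F]%fset [fset k in pmap pb F]%fset [fset k in pmap pc F]%fset.
move=> F1 F2 F3 Ha Hb Hc.
have -> : \prod_(i <- F) f i = \prod_(i <- [seq inl a | a <- F1] ++
    ([seq inr (inl b) | b <- F2] ++ [seq inr (inr c) | c <- F3])) f i.
  apply/perm_big/uniq_perm; first exact: fset_uniq.
    rewrite !cat_uniq !map_inj_uniq ?fset_uniq /=; [|by move=> ? ? []..].
    rewrite andbT; apply/andP; split.
      by apply/hasPn => i; rewrite mem_cat => /orP[] /mapP[? _ ->]; apply/negP => /mapP[].
    by apply/hasPn => i /mapP[? _ ->]; apply/negP => /mapP[].
  move=> i; rewrite !mem_cat; apply/idP/or3P.
    case: i => [a|[b|c]]; rewrite ?Ha ?Hb ?Hc => h; [apply: Or31|apply: Or32|apply: Or33];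
    exact: map_f.
  by case=> /mapP[j jF ->]; rewrite ?Ha ?Hb ?Hc.
by rewrite !big_cat /= !big_map.
Qed.

Lemma ex_half_pow_le (R : archiRealFieldType) (x : R) : 0 < x ->
  exists m, forall n, (m <= n)%N -> 2 ^- n <= x.
Proof.
move=> x0; exists (Num.bound x^-1) => n /upper_nthrootP h.
by rewrite invf_ple ?posrE ?exprn_gt0// ltW.
Qed.

Section Coupling.
Variables (V : choiceType) (T : graph V).
Hypothesis hT : regular_tree 4 T.
Variable (code : V -> nat).
Context {R : realType}.
Context db (Ob : measurableType db) (Pb : probability Ob R) (B : nat * nat -> set Ob).
Hypothesis mB : forall i, measurable (B i).
Hypothesis indepB : forall F : {fset nat * nat},
  prob Pb (\bigcap_(i in [set` F]) B i) = \prod_(i <- F) theta i.1.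
Variable mu : probability (configs T) R.
Hypothesis muE : forall A : set (configs T), measurable A ->
  mu A = Pb [set u | A (holes code radius setT (B^~ u))].
Variables (d : measure_display) (Om : measurableType d) (P : probability Om R).
Variables (omega eta_eps eta_del : {RV P >-> configs T}) (eps del : R).
Hypothesis omega_law : has_law omega mu.
Hypothesis eps_law : bernoulli_percolation eta_eps eps.
Hypothesis del_law : bernoulli_percolation eta_del del.
Hypothesis indep : independent3 omega eta_eps eta_del.

Local Notation I := (nat * nat + (edges T + edges T))%type.

(** The bits come from the auxiliary space [Ob] and the noises from the given space. On the product,
    holes built from the bits replace the given [omega]. *)
Definition coupled (i : I) : set (Ob * Om) :=
  match i with
  | inl k => B k `*` setT
  | inr (inl e) => setT `*` [set t | (eta_eps t : set (edges T)) e]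
  | inr (inr e) => setT `*` [set t | (eta_del t : set (edges T)) e]
  end.

Let PP : probability (Ob * Om)%type R := (Pb \x P)%E.

Definition supset (F : {fset edges T}) : set (configs T) :=
  [set w | forall e, e \in F -> (w : set (edges T)) e].

Lemma measurable_supset F : measurable (supset F).
Proof.
have -> : supset F = \bigcap_(e in [set` F]) [set w : configs T | (w : set (edges T)) e].
  by apply/seteqP; split=> w h e; exact: h.
rewrite bigcap_fset; apply: big_ind => // [A C|e _]; first exact: measurableI.
exact: configs_cylinder.
Qed.

Lemma measurable_RV (Y : {RV P >-> configs T}) A : measurable A -> measurable (Y @^-1` A).
Proof. exact: measurable_funPTI. Qed.

Lemma measurable_RV_edge (Y : {RV P >-> configs T}) e :
  measurable [set t | (Y t : set (edges T)) e].
Proof. exact: measurable_RV (configs_cylinder e). Qed.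

Lemma measurable_coupled i : measurable (coupled i).
Proof.
case: i => [k|[e|e]] /=; apply: measurableX => //; exact: measurable_RV_edge.
Qed.

Lemma bernoulli_supset (Y : {RV P >-> configs T}) q F : bernoulli_percolation Y q ->
  prob P (Y @^-1` supset F) = \prod_(e <- F) q.
Proof.
move=> [Yq Yind]; apply: EFin_inj; rewrite -probE; last exact: measurable_RV (measurable_supset F).
rewrite -prodEFin; transitivity (\prod_(e <- F) P [set t | (Y t : set (edges T)) e])%E.
  rewrite -Yind; congr (P _); apply/seteqP; split=> t h e eF; exact: h.
by apply: eq_bigr => e _; rewrite Yq.
Qed.

Lemma prob_indep (A1 A2 A3 : set (configs T)) :
  measurable A1 -> measurable A2 -> measurable A3 ->
  prob P (omega @^-1` A1 `&` eta_eps @^-1` A2 `&` eta_del @^-1` A3) =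
  prob P (omega @^-1` A1) * prob P (eta_eps @^-1` A2) * prob P (eta_del @^-1` A3).
Proof.
move=> m1 m2 m3; apply: EFin_inj; rewrite !EFinM -!probE; try exact: measurable_RV.
  exact: indep.
by apply: measurableI; [apply: measurableI|]; exact: measurable_RV.
Qed.

Lemma prob_noises (A2 A3 : set (configs T)) : measurable A2 -> measurable A3 ->
  prob P (eta_eps @^-1` A2 `&` eta_del @^-1` A3) =
  prob P (eta_eps @^-1` A2) * prob P (eta_del @^-1` A3).
Proof.
move=> m2 m3; have := prob_indep measurableT m2 m3.
by rewrite preimage_setT setTI probT mul1r.
Qed.

Lemma prob_rectangle (A : set Ob) (C : set Om) : measurable A -> measurable C ->
  prob PP (A `*` C) = prob Pb A * prob P C.
Proof.
move=> mA mC; apply: EFin_inj; rewrite EFinM -!probE//; last exact: measurableX.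
exact: product_measure1E.
Qed.

Lemma indep_coupled (F : {fset I}) :
  prob PP (\bigcap_(i in [set` F]) coupled i) = \prod_(i <- F) coord_prob theta eps del i.
Proof.
have [F1 [F2 [F3 [h1 h2 h3 ->]]]] := fset_sum3 F.
have -> : \bigcap_(i in [set` F]) coupled i =
    (\bigcap_(i in [set` F1]) B i) `*` (eta_eps @^-1` supset F2 `&` eta_del @^-1` supset F3).
  apply/seteqP; split=> -[u t].
    move=> h; split=> /=.
      by move=> k kF; have [] := h (inl k) (etrans (h1 k) kF).
    by split=> e eF; [have [] := h (inr (inl e)) (etrans (h2 e) eF)|
      have [] := h (inr (inr e)) (etrans (h3 e) eF)].
  move=> [/= hB [h_eps h_del]] [k|[e|e]] /= iF; split=> //=.
  - by apply: hB; rewrite /= -h1.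
  - by apply: h_eps; rewrite -h2.
  - by apply: h_del; rewrite -h3.
rewrite prob_rectangle; last first.
- by apply: measurableI; apply: measurable_RV; exact: measurable_supset.
- by rewrite bigcap_fset; apply: big_ind => // A C; exact: measurableI.
by rewrite indepB prob_noises; try exact: measurable_supset; rewrite (bernoulli_supset _ eps_law) (bernoulli_supset _ del_law).
Qed.

(** The edges of [omega] are not independent of each other, so joint laws are compared: on finite
    sets of edges both triples have the probability [mu (supset F1)] times the two Bernoulli
    factors. *)
Lemma prob_transfer_perturbed (l : seq (edges T)) (Q : set (set (edges T))) :
  depends_on (fun e (w : set (edges T)) => w e) [set` l] Q ->
  prob P [set t | Q (perturbation (omega t) (eta_eps t) (eta_del t))] =
  prob PP [set t | Q (perturbed code radius coupled setT t)].
Proof.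
move=> dQ.
pose J := (edges T + (edges T + edges T))%type.
pose E (i : J) : set Om := match i with
  | inl e => [set t | (omega t : set (edges T)) e]
  | inr (inl e) => [set t | (eta_eps t : set (edges T)) e]
  | inr (inr e) => [set t | (eta_del t : set (edges T)) e] end.
pose E' (i : J) : set (Ob * Om) := match i with
  | inl e => [set t | holesX code radius coupled setT t e]
  | inr (inl e) => coupled (inr (inl e))
  | inr (inr e) => coupled (inr (inr e)) end.
pose A : set (J -> Prop) := [set x | Q (perturbation [set e | x (inl e)]
  [set e | x (inr (inl e))] [set e | x (inr (inr e))])].
pose lJ : seq J := [seq inl e | e <- l] ++ ([seq inr (inl e) | e <- l] ++ [seq inr (inr e) | e <- l]).
have dA : depends_on (fun i (x : J -> Prop) => x i) [set` lJ] A.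
  move=> x x' xx'; apply: dQ => e el.
  have m1 : inl e \in lJ by rewrite !mem_cat; apply/or3P/Or31/map_f.
  have m2 : inr (inl e) \in lJ by rewrite !mem_cat; apply/or3P/Or32/map_f.
  have m3 : inr (inr e) \in lJ by rewrite !mem_cat; apply/or3P/Or33/map_f.
  have [a1 b1] := xx' _ m1; have [a2 b2] := xx' _ m2; have [a3 b3] := xx' _ m3.
  rewrite /perturbation /=; split=> -[h nh]; split; try by move=> ?; apply: nh; tauto.
    by case: h => h; [left; exact: a1|right; exact: a2].
  by case: h => h; [left; exact: b1|right; exact: b2].
apply: (@prob_transfer R _ _ _ _ P PP J E E' lJ A) => //.
- by case=> [e|[e|e]]; exact: measurable_RV_edge.
- case=> [e|[e|e]]; [|exact: measurable_coupled..].
  exact: (measurable_hole_edgeT hT code radius measurable_coupled).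
move=> F; have [F1 [F2 [F3 [h1 h2 h3 _]]]] := fset_sum3 F.
have -> : \bigcap_(i in [set` F]) E i =
    omega @^-1` supset F1 `&` eta_eps @^-1` supset F2 `&` eta_del @^-1` supset F3.
  apply/seteqP; split=> t.
    move=> h; split; [split|] => e eF.
    - exact: (h (inl e) (etrans (h1 e) eF)).
    - exact: (h (inr (inl e)) (etrans (h2 e) eF)).
    - exact: (h (inr (inr e)) (etrans (h3 e) eF)).
  move=> [[ho h_eps] h_del] [e|[e|e]] /= iF.
  - by apply: ho; rewrite -h1.
  - by apply: h_eps; rewrite -h2.
  - by apply: h_del; rewrite -h3.
have -> : \bigcap_(i in [set` F]) E' i =
    [set u | supset F1 (holes code radius setT (B^~ u))] `*`
    (eta_eps @^-1` supset F2 `&` eta_del @^-1` supset F3).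
  have holE u t e : holesX code radius coupled setT (u, t) e <->
      holes code radius setT (B^~ u) e.
    split=> h k v kT vv hv; first by move=> b; apply: (h k v) => //; split.
    by move=> [b _]; apply: (h k v).
  apply/seteqP; split=> -[u t].
    move=> h; split=> /=.
      by move=> e eF; apply/(holE u t); exact: (h (inl e) (etrans (h1 e) eF)).
    by split=> e eF; [have [] := h (inr (inl e)) (etrans (h2 e) eF)|
      have [] := h (inr (inr e)) (etrans (h3 e) eF)].
  move=> [/= ho [h_eps h_del]] [e|[e|e]] /= iF.
  - by apply/(holE u t); apply: ho; rewrite -h1.
  - by split=> //; apply: h_eps; rewrite -h2.
  - by split=> //; apply: h_del; rewrite -h3.
rewrite prob_indep; try exact: measurable_supset.
rewrite prob_rectangle; last first.
- by apply: measurableI; apply: measurable_RV; exact: measurable_supset.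
- exact: (measurable_holesT_fset hT code radius mB).
rewrite prob_noises; try exact: measurable_supset.
rewrite mulrA; congr (_ * _ * _); apply: EFin_inj.
rewrite -probE; last exact: measurable_RV (measurable_supset _).
have -> : P (omega @^-1` supset F1) = mu (supset F1) by exact: omega_law (measurable_supset _).
rewrite muE ?probE//; last exact: measurable_supset.
exact: (measurable_holesT_fset hT code radius mB).
Qed.

Hypothesis code_inj : forall x y, verts T x -> verts T y -> code x = code y -> x = y.
Hypothesis eps01 : 0 < eps <= 32^-1.
Hypothesis del01 : 0 < del <= 10^-1.
Variables (o : V) (e0 : edges T).
Hypothesis vo : verts T o.

Let open t : set (edges T) := perturbation (omega t) (eta_eps t) (eta_del t).

Lemma measurable_open_edge e : measurable [set t | open t e].
Proof.
have mdel : measurable [set t | ~ (eta_del t : set (edges T)) e].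
  by apply: measurableC; exact: measurable_RV_edge.
apply: measurableI mdel; apply: measurableU; exact: measurable_RV_edge.
Qed.

(** Added edges only help, so the bound for holes and deletions carries over. *)
Lemma prob_percolates_open n : 3^-1 <= prob P [set t | percolates o e0 n (open t)].
Proof.
have mX := measurable_coupled.
have mh := measurable_hole_edgeT hT code radius mX.
rewrite (prob_transfer_perturbed (@percolates_depends _ _ o e0 n)).
apply: (le_trans (prob_percolates hT code_inj e0 vo mX (indep_coupled)
  theta01 theta_sum eps01 del01 n)).
apply: prob_le; first exact: measurable_percolates.
  apply: (@depends_on_preimage _ _ _ _ (path_edges o e0 n) (percolates o e0 n)); last exact: percolates_depends.
  by move=> e; exact: measurable_perturbed_edge.
by move=> t; apply: percolatesS => e [he de]; split=> //; left.
Qed.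

Lemma percolatesW n m w : (n <= m)%N -> percolates o e0 m w -> percolates o e0 n w.
Proof.
move=> nm [z zm zw]; exists (iter (m - n) (parent T o) z).
  by have := iter_parent_desc hT vo vo (leq_subr n m) zm; rewrite subKn.
by apply: upopen_iter; rewrite subnK.
Qed.

Lemma infinite_cluster_percolates w :
  infinite_set (verts (open_cluster w o)) <-> forall n, percolates o e0 n w.
Proof.
rewrite (infinite_clusterP hT e0 vo); split=> h n; have [z zn zw] := h n; exists z => //.
  have [_ dz _] := (descP hT vo n z vo).1 zn.
  by move: zw; rewrite /conn dz depth_root.
by have [_ dz _] := (descP hT vo n z vo).1 zn; rewrite /conn dz depth_root.
Qed.

Lemma prob_infinite_cluster :
  (0 < P [set t | infinite_set (verts (open_cluster (open t) o))])%E.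
Proof.
pose A n := [set t | percolates o e0 n (open t)].
have mA n : measurable (A n).
  apply: (@depends_on_preimage _ _ _ _ (path_edges o e0 n) (percolates o e0 n)); last exact: percolates_depends.
  exact: measurable_open_edge.
rewrite (_ : mkset _ = \bigcap_n A n); last first.
  apply/seteqP; split=> t; rewrite /= infinite_cluster_percolates => h n; first by move=> _; exact: h.
  exact: h n Logic.I.
have cvgA : P \o A @ \oo --> P (\bigcap_n A n).
  apply: nonincreasing_cvg_mu => //; first by rewrite (le_lt_trans (probability_le1 _ _)) ?ltry.
    exact: bigcap_measurable.
  by move=> n m nm; apply/subsetPset => t; exact: percolatesW.
apply: (@lt_le_trans _ _ (3^-1)%:E); first by rewrite lte_fin invr_gt0.
rewrite -(cvg_lim _ cvgA)//; apply: lime_ge; first by apply/cvg_ex; eexists; exact: cvgA.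
by apply: nearW => n /=; rewrite probE// lee_fin; exact: prob_percolates_open.
Qed.

(** Expansion at all ranges implies it at the range of every scale that is a large multiple of [M],
    where its probability is at most [2 * 2 ^- n]. *)
Lemma negligible_expanding M : (0 < M)%N ->
  P.-negligible [set t | forall D, expanding o e0 M D (open t)].
Proof.
move=> M0; have mX := measurable_coupled.
have [a ha] : exists a, 2 ^- a <= eps.
  have /andP[/ex_half_pow_le[a ha] _] := eps01.
  by exists a; exact: ha.
(* Multiples of [M] whose cofactor is at least [a + 2], as [prob_expanding] requires, tending to
   infinity with [b]. *)
pose n b := (M * (a + 2 + b))%N.
pose A b := [set t | expanding o e0 M (trap_depth (n b) + 9 * radius (n b)) (open t)].
have mA b : measurable (A b).
  apply: (@depends_on_preimage _ _ _ _ (expanding_edges radius o e0 (n b) (trap_depth (n b)))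
    (expanding o e0 M (trap_depth (n b) + 9 * radius (n b)))); last exact: expanding_depends_on.
  exact: measurable_open_edge.
have mA' : measurable (\bigcap_b A b) by exact: bigcap_measurable.
exists (\bigcap_b A b); split=> //; last by move=> t h b _; exact: h.
rewrite probE//; congr (_%:E); apply/le_anti/andP; split; last exact: prob_ge0.
apply/ler_addgt0Pl => q q0; rewrite addr0.
have [b hb] : exists b, 2 * 2 ^- n b <= q.
  have [b hb] := ex_half_pow_le (divr_gt0 q0 (ltr0Sn R 1)).
  exists b; rewrite mulrC -ler_pdivlMr//; apply: hb; rewrite /n; clear -M0; nia.
apply: le_trans hb; apply: (@le_trans _ _ (prob P (A b))); first by apply: prob_le => // t; apply.
rewrite /A (prob_transfer_perturbed (@expanding_depends_on _ _ hT radius o e0 vo _ _ _)).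
apply: (prob_expanding hT code_inj e0 vo mX (indep_coupled)
  eps01 del01 ha M0 (leq_addr b _)) => //.
Qed.

End Coupling.

Theorem theorem2 (R : realType) (V : choiceType) (T : graph V)
    (hT : regular_tree 4 T) :
  exists (mu : probability (configs T) R) (delta0 epsilon0 : R),
    [/\ invariant_law mu, 0 < delta0, 0 < epsilon0 &
    forall delta epsilon : R,
      0 < delta < delta0 -> 0 < epsilon < epsilon0 ->
    forall (d : measure_display) (Omega : measurableType d)
      (P : probability Omega R)
      (omega eta_eps eta_del : {RV P >-> configs T}),
      has_law omega mu ->
      bernoulli_percolation eta_eps epsilon ->
      bernoulli_percolation eta_del delta ->
      independent3 omega eta_eps eta_del ->
    forall o : V, verts T o ->
      let C (t : Omega) : graph V :=
        open_cluster (perturbation (omega t) (eta_eps t) (eta_del t)) o in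
      (0 < P [set t | infinite_set (verts (C t))])%E /\
      {ae P, forall t, infinite_set (verts (C t)) ->
                       ~ anchored_expansion R (C t)}].
Proof.
have [code code_inj] := ex_code hT.
have [db [Ob [Pb [B [mB indepB]]]]] := exists_bits R (fun k => 20 * radius k)%N.
have [mu [mu_inv muE]] := exists_law hT (th := theta) radius code_inj mB indepB.
(* Deletions below 1/10 keep each link of a branch open with probability 4/5; added edges below 1/32
   make leaks unlikely. *)
exists mu, 10^-1, 32^-1; split=> //; try by rewrite invr_gt0.
move=> del eps /andP[del0 /ltW del1] /andP[eps0 /ltW eps1] d Om P omega eta_eps eta_del.
move=> omega_law eps_law del_law indep o vo C.
have eps01 : 0 < eps <= 32^-1 by rewrite eps0.
have del01 : 0 < del <= 10^-1 by rewrite del0.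
have [y oy] : exists y, adj T o y.
  have : (0 < #|` nbrs T o|)%N by rewrite card_nbrs.
  by rewrite cardfs_gt0 => /fset0Pn[y]; rewrite in_nbrs//; exists y.
pose e0 : edges T := exist _ [fset o; y]%fset oy.
split; first exact: (prob_infinite_cluster hT mB indepB muE omega_law eps_law del_law indep
  code_inj eps01 del01 e0 vo).
(* Since the base vertex in [anchored_expansion] depends on the configuration, there is one null set
   for each vertex. [dec] enumerates the vertices by their codes and returns [o] for a number that
   is no code. *)
pose dec m := xget o [set v | verts T v /\ code v = m].
have decK v : verts T v -> dec (code v) = v.
  move=> vv; rewrite /dec; case: xgetP => [u _ [vu uv]|/(_ v)[]//].
  exact: code_inj.
have vdec m : verts T (dec m) by rewrite /dec; case: xgetP => [u _ []|].
(* The union runs over [M.+1] because the null sets are available for positive constants; the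
   condition with [M] implies the one with [M.+1]. *)
apply: (@negligibleS _ _ _ _ (\bigcup_m \bigcup_M [set t | forall D, expanding (dec m) e0 M.+1 D
  (perturbation (omega t) (eta_eps t) (eta_del t))])); last first.
  apply: negligible_bigcup => m; apply: negligible_bigcup => M.
  exact: (negligible_expanding hT mB indepB muE omega_law eps_law del_law indep code_inj
    eps01 del01 e0 (vdec m)).
move=> t /not_implyP[_ /contrapT[v vC inf0]].
have vv : verts T v by have [] := vC.
have [M hM] := anchored_expanding hT e0 vv vC inf0.
exists (code v) => //; exists M => // D; rewrite decK// => K tK KD.
by apply: leq_trans (hM D K tK KD) _; rewrite leq_mul2r leqnSn orbT.
Qed.
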